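(* Let $n\ge1$ and let $T$ be a good tree on the vertex set $[n+1]$. The Ehrhart polynomial and volume of the polytope $\mathcal{P}(T)$ are, respectively, $$L_{\mathcal{P}(T)}(t)=(-1)^n\sum_{i=0}^n(-1)^i f_{T,i}\binom{t+i}{i},\qquad \mathrm{vol}\,\mathcal{P}(T)=\frac{f_{T,n}}{n!},$$ where $f_{T,k}$ is the number of noncrossing alternating spanning forests $F$ of $\overline{T}$ with $k$ edges containing the edge $(1,n+1)$, at least one edge of the form $(i_1,j)$ with $i_1\le i$ for each right pseudo-component of $T$ on $[i,j]$, and at least one edge of the form $(i,j_1)$ with $j\le j_1$ for each left pseudo-component of $T$ on $[i,j]$.
   Context: Graphs have vertex set $[n+1]=\{1,\ldots,n+1\}$; an edge joining $i<j$ is written $(i,j)$, and $(i,j)_a$ is the edge $(i,j)$ with label $a$. A graph is noncrossing if there are no $i<j<k<l$ with $(i,k),(j,l)$ both edges; alternating if there are no $i<j<k$ with $(i,j),(j,k)$ both edges. The transitive closure $\overline{G}$ has as edges all $(i,j)$ for which there are edges $(i,i_1),(i_1,i_2),\ldots,(i_r,j)$ of $G$ with $i<i_1<\cdots<i_r<j$ (edges of $G$ included). A spanning forest of $\overline{T}$ is a forest with vertex set $[n+1]$ (isolated vertices allowed) with all edges in $\overline{T}$. A forest $H$ on $[n+1]$ with $k$ edges labeled $1,\ldots,k$ is good if: (i) if $(i,j)_a,(j,k)_b$ are edges, $i<j<k$, then $a<b$; (ii) if $(i,j)_a,(i,k)_b$ are edges with $i<j<k$, then $a>b$; (iii) if $(i,j)_a,(k,j)_b$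 are edges with $i<k<j$, then $a>b$; (iv) $H$ is noncrossing. A good tree is a good forest that is a tree. Pseudo-components of a noncrossing tree $T$ (on a finite set of integers) are defined inductively. The simple path $P$ in $T$ from the smallest to the largest vertex of $T$ (from $1$ to $n+1$ when the vertex set is $[n+1]$) is a pseudo-component. The graph $T\setminus P$ (edges of $P$ removed) is an edge-disjoint union of trees $T_1,\ldots,T_k$ such that if $v$ is a vertex of $P$ and $v\in T_l$, then $v$ is either the minimal or the maximal vertex of $T_l$, and such that no $k-1$ trees with edge-disjoint union $T\setminus P$ satisfy these requirements. The set of pseudo-components is $ps(T)=\{P\}\cup ps(T_1)\cup\cdots\cup ps(T_k)$. A pseudo-component is on $[i,j]$, $i<j$, if it is a path with endpoints $i$ and $j$. A pseudo-component on $[i,j]$ is a left pseudo-component of $T$ if there is no edge $(s,i)\in E(T)$ with $s<i$, and a right pseudo-component of $T$ if there is no edge $(j,s)\in E(T)$ with $j<s$ (it may be both). Let $e_1,\ldots,e_{n+1}$ be the coordinate vectors of $\mathbb{R}^{n+1}$. $\mathcal{P}(A_n^+)$ is the convex hull of the origin and the points $e_i-e_j$, $1\le i<j\le n+1$; $\mathcal{C}(G)$ is the cone of nonnegative combinations of the $e_i-e_j$ with $(i,j)\in E(G)$, $i<j$; and $\mathcal{P}(G)=\mathcal{P}(A_n^+)\cap\mathcal{C}(G)$. The Ehrhart polynomial of an integer polytope $\mathcal{P}\subset\mathbb{R}^{n+1}$ is $L_{\mathcal{P}}(t)=\#(t\mathcal{P}\cap\mathbb{Z}^{n+1})$, $t\mathcal{P}=\{tx\mid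 x\in\mathcal{P}\}$. Volume is $n$-dimensional volume in the hyperplane $x_1+\cdots+x_{n+1}=0$, normalized so that a fundamental parallelepiped of the lattice of integer points in that hyperplane has volume $1$. *)

(* Defs.v *)
From HB Require Import structures.
From mathcomp Require Import all_boot all_order all_algebra finmap.
From mathcomp Require Import all_classical all_reals all_analysis.

Set Implicit Arguments.
Unset Strict Implicit.
Unset Printing Implicit Defensive.

Import Order.TTheory GRing.Theory Num.Theory.

(* Graphs on a vertex set {1 < ... < m} are graphs on 'I_m (vertex v is the   *)
(* ordinal v - 1), given by their edge sets; the edge joining i < j is the    *)
(* pair (i, j).                                                               *)

Definition is_graph m (E : {set 'I_m * 'I_m}) : Prop :=
  forall e, e \in E -> e.1 < e.2.

Definition adj m (E : {set 'I_m * 'I_m}) : rel 'I_m :=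
  fun x y => ((x, y) \in E) || ((y, x) \in E).

Definition noncrossing m (E : {set 'I_m * 'I_m}) : Prop :=
  forall i j k l : 'I_m, i < j -> j < k -> k < l ->
    ~ ((i, k) \in E /\ (j, l) \in E).

Definition alternating m (E : {set 'I_m * 'I_m}) : Prop :=
  forall i j k : 'I_m, i < j -> j < k -> ~ ((i, j) \in E /\ (j, k) \in E).

(* Every step of a path counted by [connect] below is an edge, hence goes     *)
(* from a smaller to a larger vertex when E is a graph.                       *)
Definition tclosure m (E : {set 'I_m * 'I_m}) : {set 'I_m * 'I_m} :=
  [set e : 'I_m * 'I_m |
    (e.1 < e.2) && connect [rel x y | (x, y) \in E] e.1 e.2].

Definition forest m (E : {set 'I_m * 'I_m}) : Prop :=
  is_graph E /\
  forall c : seq 'I_m, 2 < size c -> uniq c -> ~~ cycle (adj E) c.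

Definition vset m (E : {set 'I_m * 'I_m}) : {set 'I_m} :=
  [set x | [exists y, adj E x y]].

Definition tree_on m (W : {set 'I_m}) (E : {set 'I_m * 'I_m}) : Prop :=
  [/\ forest E, vset E \subset W &
      {in W &, forall x y, connect (adj E) x y}].

(* [lab e] is the label of the edge [e]; the labels of the k edges are        *)
(* exactly 1, ..., k.                                                         *)
Definition labeling m (E : {set 'I_m * 'I_m}) (lab : 'I_m * 'I_m -> nat) :=
  {in E &, injective lab} /\ (forall e, e \in E -> 1 <= lab e <= #|E|).

Definition good_forest m (E : {set 'I_m * 'I_m}) (lab : 'I_m * 'I_m -> nat) :=
  [/\ forest E /\ labeling E lab,
      forall i j k : 'I_m, i < j -> j < k ->
        (i, j) \in E -> (j, k) \in E -> lab (i, j) < lab (j, k),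
      forall i j k : 'I_m, i < j -> j < k ->
        (i, j) \in E -> (i, k) \in E -> lab (i, j) > lab (i, k),
      forall i j k : 'I_m, i < k -> k < j ->
        (i, j) \in E -> (k, j) \in E -> lab (i, j) > lab (k, j) &
      noncrossing E].

Definition good_tree m (E : {set 'I_m * 'I_m}) (lab : 'I_m * 'I_m -> nat) :=
  good_forest E lab /\ tree_on [set: 'I_m] E.

Definition minimal_in m (W : {set 'I_m}) (x : 'I_m) : Prop :=
  x \in W /\ forall y, y \in W -> x <= y.

Definition maximal_in m (W : {set 'I_m}) (x : 'I_m) : Prop :=
  x \in W /\ forall y, y \in W -> y <= x.

Definition mkedge m (x y : 'I_m) : 'I_m * 'I_m :=
  if x < y then (x, y) else (y, x).

(* Edge set of the walk through the vertices x :: s. *)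
Definition path_edges m (x : 'I_m) (s : seq 'I_m) : {set 'I_m * 'I_m} :=
  [set e in pairmap (@mkedge m) x s].

(* P is the simple path in E from the smallest to the largest vertex. A tree  *)
(* with at least one edge is determined by its edge set, with vertex set      *)
(* [vset E]; the empty edge set has no spine.                                 *)
Definition spine m (E P : {set 'I_m * 'I_m}) : Prop :=
  exists (x : 'I_m) (s : seq 'I_m),
    [/\ minimal_in (vset E) x, maximal_in (vset E) (last x s),
        path (adj E) x s, uniq (x :: s) & P = path_edges x s].

(* D is a set of trees whose edge-disjoint union is E \ P and which meet P    *)
(* only at their minimal or maximal vertices.                                 *)
Definition splitting m (E P : {set 'I_m * 'I_m})
    (D : {set {set 'I_m * 'I_m}}) : Prop :=
  [/\ finset.partition D (E :\: P),
      forall Tl, Tl \in D -> tree_on (vset Tl) Tl &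
      forall Tl v, Tl \in D -> v \in vset P -> v \in vset Tl ->
        minimal_in (vset Tl) v \/ maximal_in (vset Tl) v].

Definition min_splitting m (E P : {set 'I_m * 'I_m})
    (D : {set {set 'I_m * 'I_m}}) : Prop :=
  splitting E P D /\ forall D', splitting E P D' -> #|D'|.+1 <> #|D|.

(* [pseudo_component T Q] : Q, as an edge set, belongs to ps(T). *)
Inductive pseudo_component m :
    {set 'I_m * 'I_m} -> {set 'I_m * 'I_m} -> Prop :=
| PsSpine E P : spine E P -> pseudo_component E P
| PsSub E P D Tl Q : spine E P -> min_splitting E P D -> Tl \in D ->
    pseudo_component Tl Q -> pseudo_component E Q.

Definition pseudo_component_on m (T : {set 'I_m * 'I_m}) (i j : 'I_m) : Prop :=
  i < j /\ exists s : seq 'I_m,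
    [/\ uniq (i :: s), last i s = j & pseudo_component T (path_edges i s)].

Definition left_pseudo_component_on m (T : {set 'I_m * 'I_m}) (i j : 'I_m) :=
  pseudo_component_on T i j /\ ~ exists s : 'I_m, s < i /\ (s, i) \in T.

Definition right_pseudo_component_on m (T : {set 'I_m * 'I_m}) (i j : 'I_m) :=
  pseudo_component_on T i j /\ ~ exists s : 'I_m, j < s /\ (j, s) \in T.

Definition admissible_forest n (T : {set 'I_n.+1 * 'I_n.+1}) (k : nat)
    (F : {set 'I_n.+1 * 'I_n.+1}) : Prop :=
  [/\ [/\ forest F, F \subset tclosure T, noncrossing F & alternating F],
      #|F| = k,
      (ord0, ord_max) \in F,
      forall i j, right_pseudo_component_on T i j ->
        exists2 i1 : 'I_n.+1, i1 <= i & (i1, j) \in F &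
      forall i j, left_pseudo_component_on T i j ->
        exists2 j1 : 'I_n.+1, j <= j1 & (i, j1) \in F].

Definition fnum n (T : {set 'I_n.+1 * 'I_n.+1}) (k : nat) : nat :=
  #|[set F | `[< admissible_forest T k F >]]|.

Local Open Scope classical_set_scope.
Local Open Scope ring_scope.

Definition root_vec (R : realType) m (e : 'I_m * 'I_m) : 'rV[R]_m :=
  delta_mx 0 e.1 - delta_mx 0 e.2.

Definition convex_hull (R : realType) m (A : set 'rV[R]_m) : set 'rV[R]_m :=
  smallest (@convex_set R 'rV[R]_m) A.

Definition full_root_polytope (R : realType) m : set 'rV[R]_m :=
  convex_hull ([set 0] `|`
    [set root_vec R e | e in [set e : 'I_m * 'I_m | (e.1 < e.2)%N]]).

Definition root_cone (R : realType) m (E : {set 'I_m * 'I_m}) : set 'rV[R]_m :=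
  [set x | exists2 c : 'I_m * 'I_m -> R, (forall e, 0 <= c e) &
           x = \sum_(e in E) c e *: root_vec R e].

Definition root_polytope (R : realType) m (E : {set 'I_m * 'I_m}) :
    set 'rV[R]_m :=
  @full_root_polytope R m `&` root_cone E.

(* [fset_set] is meaningful on finite sets only; it is applied to the lattice *)
(* points of a bounded set.                                                   *)
Definition ehrhart (R : realType) m (P : set 'rV[R]_m) (t : nat) : nat :=
  #|` fset_set [set z : 'rV[int]_m |
      [set t%:R *: x | x in P] (map_mx intr z)]|%fset.

(* n-dimensional Lebesgue measure, as an iterated product measure. *)
Fixpoint lebesgueN (R : realType) n : set (n.-tuple R) -> \bar R :=
  match n with
  | 0 => fun A => \d_([tuple] : 0.-tuple R) A
  | n'.+1 => fun A =>
      ((@lebesgue_measure R) \x (@lebesgueN R n'))%E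
        [set p : R * n'.-tuple R | A [tuple of p.1 :: p.2]]
  end.

(* Forgetting the last coordinate maps the hyperplane x_1 + ... + x_{n+1} = 0 *)
(* of R^{n+1} linearly and bijectively onto R^n, and its integer points onto  *)
(* Z^n; so Lebesgue measure on R^n gives volume 1 to the image of a           *)
(* fundamental parallelepiped of the lattice.                                 *)
Definition hyperplane_volume (R : realType) n (A : set 'rV[R]_n.+1) : \bar R :=
  lebesgueN [set [tuple x 0 (widen_ord (leqnSn n) i) | i < n] |
             x in A `&` [set y : 'rV[R]_n.+1 | \sum_i y 0 i = 0]].

(* Main.v *)
Require Import Defs.
From mathcomp Require Import all_boot all_order all_algebra finmap.
From mathcomp Require Import boolp zify ring.
Import Order.TTheory GRing.Theory Num.Theory.

(* T is a noncrossing tree, and its labels play no role. Write each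
   lattice point z of the cone of T as a combination of the edges of an
   alternating noncrossing forest F in the transitive closure of T: such F and
   its weights exist (move one unit at a time from a positive entry of z to the
   next negative one) and are unique, and the weights add up to the sum of the
   positive entries of z, which is at most t exactly when z lies in t P(T).

   Fix an integer vector q with sum 0, interior to the cone, and such that no
   nonempty proper subset of its entries sums to 0. For large M the forest of M z + q
   is a spanning tree G, and z is a combination of G with coefficients that
   are nonnegative, and positive on the edges of G where q has a negative
   coordinate. Hence L(t) is the sum over all such spanning trees G of
   C(t + p(G), n), where p(G) is the number of edges of G where q has a
   positive coordinate. Applied to M F - q, the same argument shows that an
   alternating noncrossing forest F covers every edge of T if and only if F
   lies between the positive edges of a (unique) G and G itself; an alternating
   sum over these intervals gives the formula of the theorem. Pseudo-components
   enter only through the fact that the admissible forests are those which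
   cover every edge of T.

   The volume follows by comparing P(T) with unions of cubes of side 1/t. *)

Set Implicit Arguments.
Unset Strict Implicit.
Unset Printing Implicit Defensive.

(** * Noncrossing graphs *)

(** The cones of the spanning trees [G] triangulate the cone of [T], and a lattice point on a common
    wall lies in several of them. The perturbation by [q] gives each wall to one side only, so that
    the cones become disjoint half-open cones. A half-open cone with [p] weak and [n - p] strict
    coordinates has [C(t + p, n)] lattice points of height at most [t], the height being the sum of
    the positive entries. A forest [F] covers every edge of [T] exactly when its indicator vector is
    interior to the cone of [T]; a large multiple of it then stays inside after subtracting [q], and
    the opposite sign turns the positive edges of [G] into those that [F] must contain.

    Covering agrees with admissibility because a tree cut off by the recursion touches the rest of
    [T] at no more than one extreme vertex: every pseudo-component is therefore left or right, and a
    single long edge covers all of it.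

    The polytope is given as a convex hull. It is tied to the height by two facts: the height is
    convex, and it is the least total weight of a nonnegative combination of roots [e_i - e_j],
    [i < j]. *)

Definition erel m (E : {set 'I_m * 'I_m}) : rel 'I_m := fun x y => (x, y) \in E.

Lemma mem_tclosure m (E : {set 'I_m * 'I_m}) (x y : 'I_m) :
  ((x, y) \in tclosure E) = (x < y) && connect (erel E) x y.
Proof. by rewrite inE. Qed.

Lemma sub_arc m (E E' : {set 'I_m * 'I_m}) :
  E \subset E' -> subrel (erel E) (erel E').
Proof. by move=> /subsetP sub x y; apply: sub. Qed.

Lemma connect_arc_sub m (E E' : {set 'I_m * 'I_m}) x y :
  E \subset E' -> connect (erel E) x y -> connect (erel E') x y.
Proof.
by move=> sub; apply: connect_sub => a b /(sub_arc sub)/connect1.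
Qed.

Lemma is_graph_sub m (E E' : {set 'I_m * 'I_m}) :
  E \subset E' -> is_graph E' -> is_graph E.
Proof. by move=> /subsetP sub gE e /sub /gE. Qed.

Lemma noncrossing_sub m (E E' : {set 'I_m * 'I_m}) :
  E \subset E' -> noncrossing E' -> noncrossing E.
Proof.
move=> /subsetP sub ncE i j k l ij jk kl [/sub ik /sub jl].
exact: (ncE i j k l).
Qed.

Lemma alternating_sub m (E E' : {set 'I_m * 'I_m}) :
  E \subset E' -> alternating E' -> alternating E.
Proof.
move=> /subsetP sub altE i j k ij jk [/sub hij /sub hjk].
exact: (altE i j k).
Qed.

Lemma forest_sub m (E E' : {set 'I_m * 'I_m}) :
  E \subset E' -> forest E' -> forest E.
Proof.
move=> sub [gE' cE']; split; first exact: is_graph_sub gE'.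
move=> c c2 uc; apply/negP => cyc; have /negP := cE' c c2 uc; apply.
apply: sub_cycle cyc => x y /orP[] /(subsetP sub) h; apply/orP; by [left|right].
Qed.

Lemma is_graph_tclosure m (E : {set 'I_m * 'I_m}) : is_graph (tclosure E).
Proof. by move=> e; rewrite inE => /andP[]. Qed.

Lemma connect_arc_le m (E : {set 'I_m * 'I_m}) (x y : 'I_m) :
  is_graph E -> connect (erel E) x y -> x <= y.
Proof.
move=> gE /connectP[p]; elim: p x => [|z p IH] x /=; first by move=> _ ->.
by case/andP=> /gE/= xz /IH{}IH /IH; apply: leq_trans (ltnW xz).
Qed.

(** The threshold [u] is a number and not a vertex, so that both gaps next to a vertex [j] can be
    named, as [j] and [j.-1]. *)
Lemma jump m (E : {set 'I_m * 'I_m}) (x y : 'I_m) (u : nat) :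
    is_graph E -> connect (erel E) x y -> x <= u -> u < y ->
  exists a b, [/\ (a, b) \in E, connect (erel E) x a, connect (erel E) b y,
                  a <= u & u < b].
Proof.
move=> gE /connectP[p]; elim: p x => [|z p IH] x /=.
  by move=> _ -> ux xu; move: (leq_trans xu ux); rewrite ltnn.
case/andP=> xz pz ly xu uy; have [zu|uz] := leqP z u.
  have [a [b [ab za bY au ub]]] := IH _ pz ly zu uy.
  by exists a, b; split=> //; apply: connect_trans za; apply: connect1.
by exists x, z; split=> //; apply/connectP; exists p.
Qed.

(** The edge of the path from [i] over the gap before [j] either ends at [j] or passes over it. In
    the second case its source [a] lies on the path from [h] too, since an edge of that path passing
    over [a] would cross it; the second path then leads from [a] to [j]. *)
Lemma connect_meet m (E : {set 'I_m * 'I_m}) (h i j k : 'I_m) :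
    is_graph E -> noncrossing E -> h <= i -> i < j -> j <= k ->
    connect (erel E) i k -> connect (erel E) h j ->
  connect (erel E) i j.
Proof.
move=> gE ncE hi ij jk cik chj.
have [||a [b [ab ia bk aj jb]]] := jump (u := j.-1) gE cik; try by lia.
have [bj|bj] := eqVneq b j.
  by subst b; apply: connect_trans ia _; apply: connect1.
have {bj}jb : j < b by move/eqP: bj => bj; have : b <> j :> nat; [move=> /val_inj | lia].
have ia' := connect_arc_le gE ia.
have [||p [q [pq hp qj pa aq]]] := jump (u := a) gE chj; try by lia.
have qj' := connect_arc_le gE qj.
have [pa'|pa'] := eqVneq p a.
  subst p; apply: connect_trans ia _; apply: connect_trans qj; exact: connect1.
have pa'' : p < a by move/eqP: pa' => bj'; have : p <> a :> nat; [move=> /val_inj | lia].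
by case: (ncE p a q b) => //; lia.
Qed.

Lemma adj_sym m (E : {set 'I_m * 'I_m}) : symmetric (adj E).
Proof. by move=> x y; rewrite /adj orbC. Qed.

Lemma adj_connect_sym m (E : {set 'I_m * 'I_m}) : connect_sym (adj E).
Proof. by apply: sym_connect_sym; apply: adj_sym. Qed.

Lemma sub_adj m (E E' : {set 'I_m * 'I_m}) :
  E \subset E' -> subrel (adj E) (adj E').
Proof. by move=> /subsetP sub x y /orP[] /sub h; apply/orP; [left|right]. Qed.

Lemma connect_adj_sub m (E E' : {set 'I_m * 'I_m}) x y :
  E \subset E' -> connect (adj E) x y -> connect (adj E') x y.
Proof.
by move=> sub; apply: connect_sub => a b /(sub_adj sub)/connect1.
Qed.

Lemma connect_arc_adj m (E : {set 'I_m * 'I_m}) (x y : 'I_m) :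
  connect (erel E) x y -> connect (adj E) x y.
Proof.
by apply: connect_sub => a b ab; apply: connect1; rewrite /adj -/(erel E a b) ab.
Qed.

(* Closing up a path around a removed edge would produce a cycle. *)
Lemma forest_cut m (E : {set 'I_m * 'I_m}) e :
  forest E -> e \in E -> ~~ connect (adj (E :\ e)) e.1 e.2.
Proof.
case: e => a b [gE cE] abE /=; have ab := gE _ abE.
apply/negP => /connectP[p0 pp0 lp0].
case/shortenP: pp0 lp0 => p pp up _ lp {p0}.
have p2 : 1 < size p.
  case: p pp up lp => [|c [|d p]] //= pp up lp.
    by move: ab; rewrite /= lp ltnn.
  move: pp; rewrite -lp /adj !inE !eqxx /= andbT.
  by rewrite xpair_eqE => /andP[_ /gE/=]; rewrite ltnNge ltnW.
have /negP[] := cE (a :: p) p2 up.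
rewrite /= rcons_path -lp /adj abE orbT andbT.
by apply: sub_path pp; apply: sub_adj; apply: subD1set.
Qed.

(** The component of [e.1] once [e] is removed. In a forest, summing over it is the linear form that
    reads off the coefficient of [e] in a combination of root vectors of edges. *)
Definition cut_side m (E : {set 'I_m * 'I_m}) (e : 'I_m * 'I_m) : {set 'I_m} :=
  [set v | connect (adj (E :\ e)) e.1 v].

Lemma cut_sideE m (E : {set 'I_m * 'I_m}) e f :
    forest E -> e \in E -> f \in E ->
  (f.1 \in cut_side E e) = (f == e) || (f.2 \in cut_side E e).
Proof.
move=> fE eE fE'; rewrite !inE; have [->|fe] := eqVneq; first by rewrite connect0.
have cff : connect (adj (E :\ e)) f.1 f.2.
  by apply: connect1; rewrite /adj !inE -surjective_pairing fe fE'.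
by apply: (same_connect_r (@adj_connect_sym _ _)).
Qed.

Lemma cut_side2 m (E : {set 'I_m * 'I_m}) e :
  forest E -> e \in E -> e.2 \notin cut_side E e.
Proof. by move=> fE eE; rewrite inE forest_cut. Qed.

Lemma next_neq_prev (T : eqType) (c : seq T) x :
  uniq c -> (2 < size c)%N -> x \in c -> next c x != prev c x.
Proof.
move=> uc c2 xc; have [i s ec] := rot_to xc.
rewrite -(next_rot i uc) -(prev_rot i uc) ec.
have us : uniq (x :: s) by rewrite -ec rot_uniq.
have s2 : (1 < size s)%N by move: c2; rewrite -(size_rot i) ec.
have prevE z s' : x \notin s' -> prev_at x x z s' \in z :: s'.
  elim: s' z => [|y s' IH] z /=; first by rewrite eqxx mem_head.
  by rewrite inE negb_or => /andP[/negPf -> /IH h]; rewrite inE h orbT.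
case: s us s2 {ec} => [|y [|z s]] //= /and3P[xs ys _] _; rewrite !eqxx.
move: xs; rewrite !inE !negb_or => /and3P[/negPf -> /negPf -> xs].
by apply: contra ys => /eqP ->; apply: prevE.
Qed.

(* The edges next to a shortest edge of a cycle would cross. *)
Lemma forest_noncrossing_alternating m (F : {set 'I_m * 'I_m}) :
  is_graph F -> noncrossing F -> alternating F -> forest F.
Proof.
move=> gF nF aF; split=> // c c2 uc; apply/negP => cyc.
pose C := [set e in F | [&& e.1 \in c & e.2 \in c] &&
                        ((e.2 == next c e.1) || (e.1 == next c e.2))].
have other x y : x \in c ->
    exists2 z, z != y & ((x, z) \in C) || ((z, x) \in C).
  move=> xc; have ne := next_neq_prev uc c2 xc.
  have [z zy zE] : exists2 z, z != y & z \in [:: next c x; prev c x].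
    have [ny|] := eqVneq (next c x) y; last by exists (next c x); rewrite ?inE ?eqxx.
    by exists (prev c x); rewrite ?inE ?eqxx ?orbT // -ny eq_sym.
  exists z => //; move: zE; rewrite !inE => /orP[] /eqP -> /=;
    rewrite ?mem_next ?mem_prev ?xc ?(next_prev uc) ?eqxx ?orbT ?andbT.
    exact: next_cycle cyc xc.
  by have := prev_cycle cyc xc; rewrite /adj orbC.
have [x0 x0c] : exists x, x \in c.
  by case: c c2 {uc cyc C other} => // x c _; exists x; rewrite mem_head.
have [e0 e0C] : exists e, e \in C.
  have [z _ /orP[h|h]] := other x0 x0 x0c; [by exists (x0, z)|by exists (z, x0)].
case: (arg_minnP (fun e : 'I_m * 'I_m => (e.2 - e.1)%N) e0C) => -[i j] ijC minC.
have {}ijC : (i, j) \in C by [].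
have := ijC; rewrite inE /= => /andP[ijF /andP[/andP[ic jc] _]].
have ij := gF _ ijF; simpl in ij.
have CF e : e \in C -> e \in F by rewrite inE => /andP[].
have [k kj /orP[ik|ki]] := other i j ic; last first.
  by have := CF _ ki => kiF; case: (aF k i j (gF _ kiF) ij).
have [h hi /orP[jh|hj]] := other j i jc.
  by have := CF _ jh => jhF; case: (aF i j h ij (gF _ jhF)).
have /= lik := gF _ (CF _ ik); have /= lhj := gF _ (CF _ hj).
have /= m1 := minC _ ik; have /= m2 := minC _ hj.
have : k <> j :> nat by move=> /val_inj/eqP; rewrite (negPf kj).
have : h <> i :> nat by move=> /val_inj/eqP; rewrite (negPf hi).
move=> h1 h2; have hi' : (h < i)%N by clear -ij lhj m2 h1; lia.
have jk : (j < k)%N by clear -ij lik m1 h2; lia.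
by apply: (nF h i j k) => //; split; apply: CF.
Qed.

Definition connected m (E : {set 'I_m * 'I_m}) : Prop :=
  forall x y, connect (adj E) x y.

Definition nctree m (T : {set 'I_m * 'I_m}) : Prop :=
  [/\ forest T, noncrossing T & connected T].

(** Index sets of the cones that triangulate the cone of a noncrossing tree [T]. That they are
    forests follows, see [face_forest]. *)
Definition face m (T F : {set 'I_m * 'I_m}) : Prop :=
  [/\ F \subset tclosure T, noncrossing F & alternating F].

Definition facet m (T G : {set 'I_m * 'I_m}) : Prop := face T G /\ connected G.

Lemma face_graph m (T F : {set 'I_m * 'I_m}) : face T F -> is_graph F.
Proof. by case=> sF _ _; apply: is_graph_sub sF _; apply: is_graph_tclosure. Qed.

Lemma face_forest m (T F : {set 'I_m * 'I_m}) : face T F -> forest F.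
Proof.
move=> fF; have [_ nF aF] := fF.
by apply: forest_noncrossing_alternating => //; apply: face_graph fF.
Qed.

Lemma face_sub m (T F F' : {set 'I_m * 'I_m}) :
  F' \subset F -> face T F -> face T F'.
Proof.
move=> sF [tF nF aF]; split; first exact: fintype.subset_trans sF tF.
  exact: noncrossing_sub nF.
exact: alternating_sub aF.
Qed.

(** For [F] in the closure of a tree [T]: the directed path of [T] underlying some [f] runs through
    [e]. In terms of cones, no facet of the cone of [T] contains all root vectors of [F]. *)
Definition covers m (T F : {set 'I_m * 'I_m}) : Prop :=
  forall e, e \in T -> exists f, [/\ f \in F, connect (erel T) f.1 e.1 &
    connect (erel T) e.2 f.2].

Lemma tclosure_connect m (T : {set 'I_m * 'I_m}) f :
  f \in tclosure T -> connect (erel T) f.1 f.2.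
Proof. by case: f => x y; rewrite mem_tclosure => /andP[]. Qed.

(** * Pseudo-components *)

Lemma ord_ltP m (x y : 'I_m) : x <= y -> x != y -> x < y.
Proof. by move=> xy /eqP ne; have : x <> y :> nat; [move=> /val_inj | lia]. Qed.

Lemma vset1 m (E : {set 'I_m * 'I_m}) e : e \in E -> e.1 \in vset E.
Proof.
by move=> eE; rewrite inE; apply/existsP; exists e.2; rewrite /adj -surjective_pairing eE.
Qed.

Lemma vset2 m (E : {set 'I_m * 'I_m}) e : e \in E -> e.2 \in vset E.
Proof.
by move=> eE; rewrite inE; apply/existsP; exists e.1; rewrite /adj -surjective_pairing eE orbT.
Qed.

Lemma vsetP m (E : {set 'I_m * 'I_m}) v :
  v \in vset E -> exists2 e, e \in E & (e.1 == v) || (e.2 == v).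
Proof.
rewrite inE => /existsP[y /orP[h|h]].
  by exists (v, y); rewrite ?eqxx.
by exists (y, v); rewrite ?eqxx ?orbT.
Qed.

Lemma vset_touch m (E : {set 'I_m * 'I_m}) e v :
  e \in E -> (e.1 == v) || (e.2 == v) -> v \in vset E.
Proof. by move=> eE /orP[] /eqP <-; [apply: vset1|apply: vset2]. Qed.

Lemma vset_sub m (E E' : {set 'I_m * 'I_m}) :
  E \subset E' -> {subset vset E <= vset E'}.
Proof. by move=> /subsetP sE v /vsetP[e /sE eE]; apply: vset_touch. Qed.

Lemma adj_edge m (E : {set 'I_m * 'I_m}) (x y : 'I_m) :
  is_graph E -> x < y -> adj E x y -> (x, y) \in E.
Proof. by move=> gE xy /orP[//|/gE /=]; lia. Qed.

(** A step out of the open interval that avoids both [p] and [q] would cross the edge [(p, q)]. *)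
Lemma trapped m (E : {set 'I_m * 'I_m}) (p q y : 'I_m) s :
    is_graph E -> noncrossing E -> (p, q) \in E ->
    path (adj E) y s -> p \notin s -> q \notin s -> p < y < q ->
  p < last y s < q.
Proof.
move=> gE nE pqE; elim: s y => //= z s IH y /andP[yz ps].
rewrite !inE !negb_or => /andP[pz pns] /andP[qz qns] /andP[py yq].
apply: IH => //; have pz' : p != z :> nat by apply: contra pz => /eqP/val_inj ->.
have qz' : q != z :> nat by apply: contra qz => /eqP/val_inj ->.
apply/andP; split.
  rewrite ltn_neqAle pz' /= leqNgt; apply/negP => zp.
  have zy : z < y by lia.
  have zyE : (z, y) \in E by apply: adj_edge => //; rewrite adj_sym.
  exact: (nE z p y q).
rewrite ltn_neqAle eq_sym qz' /= leqNgt; apply/negP => zq.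
have yz' : y < z by lia.
have yzE : (y, z) \in E by apply: adj_edge.
exact: (nE p y q z).
Qed.

(** The next vertex [y] is the smallest one left: a later vertex between [x] and [y] would leave the
    rest of the path trapped under the edge [(x, y)], while its last vertex is the maximum. *)
Lemma path_increasing m (E : {set 'I_m * 'I_m}) (x : 'I_m) s :
    is_graph E -> noncrossing E -> path (adj E) x s -> uniq (x :: s) ->
    (forall z, z \in s -> x < z) -> (forall z, z \in s -> z <= last x s) ->
  path (erel E) x s.
Proof.
move=> gE nE; elim: s x => //= y s IH x /andP[xy ps] /and3P[xns yns us] xlt le_last.
have xy' : x < y by apply: xlt; rewrite mem_head.
have xyE := adj_edge gE xy' xy; rewrite [erel _ _ _]xyE /=.
have ys z : z \in s -> y < z.
  move=> zs; apply: ord_ltP; last by apply: contraNneq yns => ->.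
  rewrite leqNgt; apply/negP => zy.
  have xz : x < z by apply: xlt; rewrite inE zs orbT.
  case/splitPr: zs ps yns xns le_last => s1 s2.
  rewrite cat_path /= last_cat /= => /and3P[_ _ ps2] yns xns le_last.
  have := trapped gE nE xyE ps2.
  rewrite xz zy => /(_ _ _ isT) /andP[||_].
  - by move: xns; rewrite inE mem_cat inE !negb_or => /and4P[].
  - by move: yns; rewrite mem_cat inE !negb_or => /and3P[].
  - by rewrite ltnNge le_last // mem_head.
apply: IH; rewrite ?yns //.
by move=> z zs; apply: le_last; rewrite inE zs orbT.
Qed.

Lemma path_edges_cons m (x y : 'I_m) s :
  path_edges x (y :: s) = mkedge x y |: path_edges y s.
Proof. by apply/setP => e; rewrite !inE. Qed.

Lemma vset_path_edges m (x : 'I_m) s v : v \in vset (path_edges x s) -> v \in x :: s.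
Proof.
elim: s x => [|y s IH] x.
  by move=> /vsetP[e]; rewrite inE.
move=> /vsetP[e]; rewrite path_edges_cons in_setU1 => /orP[/eqP ->|eE te].
  by rewrite /mkedge; case: ifP => _ /orP[] /eqP /= <-; rewrite !inE eqxx ?orbT.
by rewrite inE IH ?orbT //; apply: vset_touch te.
Qed.

(** An increasing path as an edge set: crossing arguments need an edge over a given gap, not a
    position in a vertex list. *)
Record route m (Q : {set 'I_m * 'I_m}) (i j : 'I_m) : Prop := Route {
  route_lt : i < j;
  route_graph : is_graph Q;
  route_connect : connect (erel Q) i j;
  route_vset : forall v, v \in vset Q -> connect (erel Q) i v /\ connect (erel Q) v j;
  route_no_jump : forall e v, e \in Q -> v \in vset Q -> e.1 < v -> v < e.2 -> False
}.

Lemma path_route m (E : {set 'I_m * 'I_m}) (x : 'I_m) s :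
  is_graph E -> path (erel E) x s -> s != [::] ->
  route (path_edges x s) x (last x s) /\ path_edges x s \subset E.
Proof.
move=> gE; elim: s x => //= y s IH x /andP[xyE ps] _.
have xy : x < y := gE _ xyE.
rewrite path_edges_cons /mkedge xy.
have [s0|sn0] := eqVneq s [::].
  have -> : (x, y) |: path_edges y s = [set (x, y)].
    by apply/setP => e; rewrite s0 !inE orbF.
  have g1 : is_graph [set (x, y)] by move=> e; rewrite inE => /eqP ->.
  have cxy : connect (erel [set (x, y)]) x y by apply: connect1; rewrite /erel inE.
  rewrite s0 /=; split; last by rewrite sub1set.
  have vE v : v \in vset [set (x, y)] -> v = x \/ v = y.
    by move=> /vsetP[e]; rewrite inE => /eqP -> /orP[] /eqP <-; [left|right].
  split=> //; first by move=> v /vE[] ->.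
  by move=> e v; rewrite inE => /eqP -> /vE[] -> /=; rewrite ltnn.
have [[yl gP cP vP nP] sP] := IH y ps sn0.
set Q := _ |: _; have sPQ : path_edges y s \subset Q by apply: subsetUr.
have sQE : Q \subset E by rewrite subUset sub1set; apply/andP.
have cxy : connect (erel Q) x y by apply: connect1; rewrite /erel setU11.
have cyl : connect (erel Q) y (last y s) by apply: connect_arc_sub cP.
have vQ v : v \in vset Q -> v = x \/ v \in vset (path_edges y s).
  move=> /vsetP[e]; rewrite in_setU1 => /orP[/eqP ->|eP te]; last first.
    by right; apply: vset_touch te.
  case/orP => /eqP <-; [by left|right] => /=.
  have /connectP[[|z r] /=] := cP; first by move=> _ e0; move: yl; rewrite e0 ltnn.
  by move=> /andP[yz _] _; exact: (vset1 yz).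
have vge v : v \in vset (path_edges y s) -> y <= v.
  by move=> /vP[/(connect_arc_le gP)].
split=> //; split.
- exact: ltn_trans yl.
- exact: is_graph_sub sQE gE.
- exact: connect_trans cyl.
- move=> v /vQ[->|vv]; first by split; [exact: connect0|exact: connect_trans cyl].
  have [c1 c2] := vP v vv; split; last exact: connect_arc_sub c2.
  by apply: connect_trans cxy _; apply: connect_arc_sub c1.
- move=> e v; rewrite in_setU1 => /orP[/eqP ->|eP] /vQ[->|vv] /=.
  + by rewrite ltnn.
  + by move=> _; rewrite ltnNge vge.
  + by move=> ex _; have := ltn_trans ex (leq_trans xy (vge _ (vset1 eP))); rewrite ltnn.
  + exact: nP.
Qed.

Lemma route_vset1 m (Q : {set 'I_m * 'I_m}) i j : route Q i j -> i \in vset Q.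
Proof.
move=> rQ; have /connectP[[|z r] /=] := route_connect rQ.
  by move=> _ e; have := route_lt rQ; rewrite e ltnn.
by move=> /andP[iz _] _; exact: (vset1 iz).
Qed.

Lemma route_vset2 m (Q : {set 'I_m * 'I_m}) i j : route Q i j -> j \in vset Q.
Proof.
move=> rQ; have ij := route_lt rQ.
have [||a [b [ab _ bj aj jb]]] := jump (u := j.-1) (route_graph rQ) (route_connect rQ); try lia.
have bj' := connect_arc_le (route_graph rQ) bj.
have <- : b = j by apply: val_inj => /=; lia.
exact: (vset2 ab).
Qed.

Lemma route_bounds m (Q : {set 'I_m * 'I_m}) i j v :
  route Q i j -> v \in vset Q -> i <= v <= j.
Proof.
move=> rQ /(route_vset rQ)[c1 c2]; have gQ := route_graph rQ.
by rewrite (connect_arc_le gQ c1) (connect_arc_le gQ c2).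
Qed.

Lemma route_jump m (Q : {set 'I_m * 'I_m}) i j (u : nat) :
  route Q i j -> i <= u < j ->
  exists a b, [/\ (a, b) \in Q, a <= u & u < b].
Proof.
move=> rQ /andP[iu uj].
have [a [b [ab _ _ au ub]]] := jump (route_graph rQ) (route_connect rQ) iu uj.
by exists a, b.
Qed.

(** [pseudo_component_on] admits any vertex list that yields the edge set, so the ends must be
    recovered from the edges. Inner vertices of the list have two distinct neighbours, [i0] and [j0]
    only one each; [i < last i s] rules out the reversed list. *)
Lemma route_endpoints m (Q : {set 'I_m * 'I_m}) (i0 j0 i : 'I_m) s :
    route Q i0 j0 -> Q = path_edges i s -> uniq (i :: s) -> i < last i s ->
  i = i0 /\ last i s = j0.
Proof.
move=> rQ eQ us il; have gQ := route_graph rQ.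
have nbr v : v \in vset Q -> v != i -> v != last i s ->
    exists x y, [/\ x != y, adj Q x v & adj Q v y].
  rewrite {1}eQ => /vset_path_edges; rewrite inE => /orP[->//|vs] _ vl.
  case/splitPr: vs eQ us vl {il} => s1 [|y s2] eQ us vl.
    by move: vl; rewrite last_cat eqxx.
  have mk x z s3 s4 : s1 ++ v :: y :: s2 = s3 ++ z :: s4 -> x = last i s3 -> adj Q x z.
    move=> es ex; have : mkedge x z \in Q.
      by rewrite eQ inE es pairmap_cat mem_cat /= -ex mem_head orbT.
    by rewrite /mkedge /adj; case: ifP => _ ->; rewrite ?orbT.
  exists (last i s1), y; split; last 2 first.
  - exact: (mk _ _ s1 (y :: s2 )).
  - by apply: (mk _ _ (rcons s1 v) s2); rewrite ?cat_rcons ?last_rcons.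
  move: us; rewrite -cat_cons cat_uniq => /and3P[_ /hasPn h _].
  by apply: contraNneq (h y _) => [<-|]; [exact: mem_last|rewrite !inE eqxx orbT].
(* Of two edges leaving [i0], the longer would pass over the end of the shorter. *)
have one0 x y : adj Q x i0 -> adj Q i0 y -> x = y.
  have up z : adj Q i0 z -> (i0, z) \in Q.
    move=> /orP[//|h]; have := route_bounds rQ (vset1 h); have := gQ _ h => /=; lia.
  rewrite adj_sym => /up h1 /up h2; apply/eqP/negPn/negP => ne.
  have [xy|yx] : x < y \/ y < x.
    by have [?|] := leqP x y; [left; apply: ord_ltP|right].
  - exact: (route_no_jump rQ h2 (vset2 h1) (gQ _ h1) xy).
  - exact: (route_no_jump rQ h1 (vset2 h2) (gQ _ h2) yx).
have one1 x y : adj Q x j0 -> adj Q j0 y -> x = y.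
  have up z : adj Q j0 z -> (z, j0) \in Q.
    move=> /orP[h|//]; have := route_bounds rQ (vset2 h); have := gQ _ h => /=; lia.
  rewrite adj_sym => /up h1 /up h2; apply/eqP/negPn/negP => ne.
  have [xy|yx] : x < y \/ y < x.
    by have [?|] := leqP x y; [left; apply: ord_ltP|right].
  - exact: (route_no_jump rQ h1 (vset1 h2) xy (gQ _ h2)).
  - exact: (route_no_jump rQ h2 (vset1 h1) yx (gQ _ h1)).
have ij := route_lt rQ.
have e0 : (i0 == i) || (i0 == last i s).
  apply/negPn/negP; rewrite negb_or => /andP[n1 n2].
  have [x [y [xy ax ay]]] := nbr _ (route_vset1 rQ) n1 n2.
  by move: xy; rewrite (one0 x y) ?eqxx.
have e1 : (j0 == i) || (j0 == last i s).
  apply/negPn/negP; rewrite negb_or => /andP[n1 n2].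
  have [x [y [xy ax ay]]] := nbr _ (route_vset2 rQ) n1 n2.
  by move: xy; rewrite (one1 x y) ?eqxx.
case/orP: e0 => /eqP e0; case/orP: e1 => /eqP e1; rewrite ?e0 ?e1 //.
- by move: ij; rewrite e0 e1 ltnn.
- by move: ij il; rewrite e0 e1; lia.
- by move: ij; rewrite e0 e1 ltnn.
Qed.

(** Otherwise the edge of the route that passes over [u] would cross [(u, w)]. *)
Lemma route_escape_right m (T Q : {set 'I_m * 'I_m}) (i j u w : 'I_m) :
    noncrossing T -> Q \subset T -> route Q i j ->
    (u, w) \in T -> i <= u -> u < j -> j < w ->
  u \in vset Q.
Proof.
move=> nT sQ rQ uw iu uj jw.
have [|a [b [ab au ub]]] := @route_jump _ _ _ _ u rQ; first by rewrite iu.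
have /andP[_ bj] := route_bounds rQ (vset2 ab).
have [<-|ne] := eqVneq a u; first exact: (vset1 ab).
case: (nT a u b w) => //; [exact: ord_ltP|exact: leq_ltn_trans jw|].
by split=> //; apply: (subsetP sQ).
Qed.

Lemma route_escape_left m (T Q : {set 'I_m * 'I_m}) (i j u w : 'I_m) :
    noncrossing T -> Q \subset T -> route Q i j ->
    (w, u) \in T -> i < u -> u <= j -> w < i ->
  u \in vset Q.
Proof.
move=> nT sQ rQ wu iu uj wi.
have [|a [b [ab au ub]]] := @route_jump _ _ _ _ u.-1 rQ; first by lia.
have /andP[ia _] := route_bounds rQ (vset1 ab).
have [<-|ne] := eqVneq b u; first exact: (vset2 ab).
have ub' : u < b by apply: ord_ltP; rewrite 1?eq_sym //; lia.
case: (nT w a u b) => //; [exact: leq_trans wi ia|by lia|].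
by split=> //; apply: (subsetP sQ).
Qed.

(** What is used of a pseudo-component. The first alternative of [gr_end] makes it a left one, the
    second a right one; in each, the second half forbids an edge of [T] that starts or stops at an
    end of the component and bypasses all of it. *)
Record good_route m (T Q : {set 'I_m * 'I_m}) (i j : 'I_m) : Prop := GoodRoute {
  gr_route : route Q i j;
  gr_sub : Q \subset T;
  gr_right : forall v w : 'I_m, v \in vset Q -> i < v -> v < j -> (v, w) \in T -> w <= j;
  gr_left : forall v w : 'I_m, v \in vset Q -> i < v -> v < j -> (w, v) \in T -> i <= w;
  gr_end : ((forall w : 'I_m, w < i -> (w, i) \notin T) /\ (forall w : 'I_m, j < w -> (i, w) \notin T))
        \/ ((forall w : 'I_m, j < w -> (j, w) \notin T) /\ (forall w : 'I_m, w < i -> (w, j) \notin T))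
}.

(** The last edge of the route is covered by an edge ending at [j], as nothing leaves [j]; let
    [(p, j)] be the longest such edge. If [p] were beyond [i], the route edge over the gap before
    [p] would be covered by some [(p', q')] with [p' < p <= q']. *)
Lemma right_edge m (T Q F : {set 'I_m * 'I_m}) (i j : 'I_m) :
    is_graph T -> noncrossing T -> good_route T Q i j -> face T F -> covers T F ->
    (forall w : 'I_m, j < w -> (j, w) \notin T) ->
  exists2 p : 'I_m, p <= i & (p, j) \in F.
Proof.
move=> gT nT [rQ sQ gR _ _] fF cF jT; have gF := face_graph fF.
have [sF nF aF] := fF; have ij := route_lt rQ.
have stop q : connect (erel T) j q -> q = j.
  move=> cjq; have := connect_arc_le gT cjq; rewrite leq_eqVlt.
  move=> /orP[/eqP/val_inj //|jq].
  have [a [b [ab ja _ aj jb]]] := jump gT cjq (leqnn _) jq.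
  have ea : a = j by apply: val_inj; apply/eqP; rewrite eqn_leq aj (connect_arc_le gT ja).
  by move: (jT b jb); rewrite -ea ab.
have [|a [b [ab aj jb]]] := @route_jump _ _ _ _ j.-1 rQ; first by lia.
have eb : b = j.
  have /andP[_ /= bj] := route_bounds rQ (vset2 ab).
  by apply: val_inj => /=; lia.
subst b; have [[p q] [pqF /= pa jq]] := cF _ (subsetP sQ _ ab).
have eq := stop _ jq; subst q.
pose P x := (x, j) \in F.
have Pp : P p by [].
case: (arg_minnP (fun x : 'I_m => x : nat) Pp) => {}p {Pp pqF pa}pF pmin.
rewrite /P in pF; have /= pj := gF _ pF.
exists p => //; rewrite leqNgt; apply/negP => ip.
have [|a' [b' [ab' ap pb]]] := @route_jump _ _ _ _ p.-1 rQ; first by lia.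
have [[p' q'] [pqF' /= pa' bq']] := cF _ (subsetP sQ _ ab').
have /= l1 := connect_arc_le gT pa'; have /= l2 := connect_arc_le gT bq'.
have /andP[_ /= b'j] := route_bounds rQ (vset2 ab').
have pp' : p' < p by clear -ap l1 ip; lia.
have pq' : p <= q' by clear -pb l2; lia.
(* Every position of [q'] is excluded: [q' = p] breaks alternation, [q' < j] is a crossing, [q' = j]
   contradicts the choice of [p], and for [q' > j] the path of [T] to [q'] would leave the interval
   from an inner vertex of the route. *)
have [e|ne] := eqVneq p q'; first by subst q'; apply: (aF p' p j).
have {ne}pq' := ord_ltP pq' ne.
have [q'j|jq'] := ltnP q' j; first by apply: (nF p' p q' j).
have [e|ne] := eqVneq j q'; first by subst q'; have := pmin p' pqF'; rewrite leqNgt pp'.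
have {ne}jq' := ord_ltP jq' ne.
have [x [w [xw bx _ xj jw]]] := jump gT bq' b'j jq'.
have [e|ne] := eqVneq x j; first by move: (jT w jw); rewrite -e xw.
have {ne}xj := ord_ltP xj ne; have := connect_arc_le gT bx => b'x.
have ix : i < x by clear -ip pb b'x; lia.
have xQ := route_escape_right nT sQ rQ xw (ltnW ix) xj jw.
by have := gR x w xQ ix xj xw; rewrite leqNgt jw.
Qed.

Lemma left_edge m (T Q F : {set 'I_m * 'I_m}) (i j : 'I_m) :
    is_graph T -> noncrossing T -> good_route T Q i j -> face T F -> covers T F ->
    (forall w : 'I_m, w < i -> (w, i) \notin T) ->
  exists2 q : 'I_m, j <= q & (i, q) \in F.
Proof.
move=> gT nT [rQ sQ _ gL _] fF cF iT; have gF := face_graph fF.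
have [sF nF aF] := fF; have ij := route_lt rQ.
have stop p : connect (erel T) p i -> p = i.
  move=> cpi; have := connect_arc_le gT cpi; rewrite leq_eqVlt.
  move=> /orP[/eqP/val_inj //|pi].
  have [||a [b [ab _ bi ai ib]]] := jump (u := i.-1) gT cpi; try by lia.
  have eb : b = i by apply: val_inj => /=; have := connect_arc_le gT bi; lia.
  by move: (iT a); rewrite -{2}eb ab => /(_ _)/negP; case => //; lia.
have [|a [b [ab ai ib]]] := @route_jump _ _ _ _ i rQ; first by rewrite leqnn.
have ea : a = i.
  have /andP[/= ia _] := route_bounds rQ (vset1 ab).
  by apply: val_inj => /=; lia.
subst a; have [[p q] [pqF /= pi bq]] := cF _ (subsetP sQ _ ab).
have ep := stop _ pi; subst p.
pose P x := (i, x) \in F.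
have Pq : P q by [].
case: (arg_maxnP (fun x : 'I_m => x : nat) Pq) => {}q {Pq pqF bq}qF qmax.
rewrite /P in qF; have /= iq := gF _ qF.
exists q => //; rewrite leqNgt; apply/negP => qj.
have [|a' [b' [ab' aq qb]]] := @route_jump _ _ _ _ q rQ; first by lia.
have [[p' q'] [pqF' /= pa' bq']] := cF _ (subsetP sQ _ ab').
have /= l1 := connect_arc_le gT pa'; have /= l2 := connect_arc_le gT bq'.
have /andP[/= ia' _] := route_bounds rQ (vset1 ab').
have qq' : q < q' by clear -qb l2; lia.
have pq' : p' <= q by clear -aq l1; lia.
have [e|ne] := eqVneq p' q; first by subst p'; apply: (aF i q q').
have {ne}pq' := ord_ltP pq' ne.
have [ip'|p'i] := ltnP i p'; first by apply: (nF i p' q q').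
have [e|ne] := eqVneq p' i; first by subst p'; have := qmax q' pqF'; rewrite /= leqNgt qq'.
have {ne}p'i := ord_ltP p'i ne.
have [||w [x [wx _ xa wi ix]]] := jump (u := i.-1) gT pa'.
- by clear -p'i; lia.
- by clear -p'i ia'; lia.
have wi' : w < i by clear -wi p'i; lia.
have [e|ne] := eqVneq i x; first by move: (iT w wi'); rewrite e wx.
have {ne}ix : i < x by apply: ord_ltP => //; clear -ix; lia.
have := connect_arc_le gT xa => xa'.
have xj : x < j by clear -xa' aq qj; lia.
have xQ := route_escape_left nT sQ rQ wx ix (ltnW xj) wi'.
by have := gL x w xQ ix xj wx; rewrite leqNgt wi'.
Qed.

(** The path of [T] from [i] to [q] goes through [j]: an edge passing over [j] would start at [i] or
    at an inner vertex of the route, and both are excluded. *)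
Lemma left_edge_cover m (T Q : {set 'I_m * 'I_m}) (i j q : 'I_m) e :
    is_graph T -> noncrossing T -> good_route T Q i j ->
    (forall w : 'I_m, j < w -> (i, w) \notin T) -> (i, q) \in tclosure T -> j <= q -> e \in Q ->
  connect (erel T) i e.1 /\ connect (erel T) e.2 q.
Proof.
move=> gT nT [rQ sQ gR gL _] iT; rewrite mem_tclosure => /andP[iq ciq] jq eQ.
split; first by apply: connect_arc_sub sQ _; have [] := route_vset rQ (vset1 eQ).
have cej : connect (erel T) e.2 j.
  by apply: connect_arc_sub sQ _; have [] := route_vset rQ (vset2 eQ).
apply: connect_trans cej _; have [->//|ne] := eqVneq j q.
have {ne}jq := ord_ltP jq ne; have ij := route_lt rQ.
have [x [w [xw ix wq xj jw]]] := jump gT ciq (ltnW ij) jq.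
have [e'|ne] := eqVneq x j.
  by subst x; apply: connect_trans wq; apply: connect1.
have {ne}xj := ord_ltP xj ne; have lix := connect_arc_le gT ix.
have xQ := route_escape_right nT sQ rQ xw lix xj jw.
have [e'|ne] := eqVneq i x; first by subst x; move: (iT w jw); rewrite xw.
by have := gR x w xQ (ord_ltP lix ne) xj xw; rewrite leqNgt jw.
Qed.

Lemma right_edge_cover m (T Q : {set 'I_m * 'I_m}) (i j p : 'I_m) e :
    is_graph T -> noncrossing T -> good_route T Q i j ->
    (forall w : 'I_m, w < i -> (w, j) \notin T) -> (p, j) \in tclosure T -> p <= i -> e \in Q ->
  connect (erel T) p e.1 /\ connect (erel T) e.2 j.
Proof.
move=> gT nT [rQ sQ gR gL _] jT; rewrite mem_tclosure => /andP[pj cpj] pi eQ.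
split; last by apply: connect_arc_sub sQ _; have [] := route_vset rQ (vset2 eQ).
have cie : connect (erel T) i e.1.
  by apply: connect_arc_sub sQ _; have [] := route_vset rQ (vset1 eQ).
apply: connect_trans cie; have [->//|ne] := eqVneq p i.
have {ne}pi := ord_ltP pi ne; have ij := route_lt rQ.
have [||w [x [wx pw xj wi ix]]] := jump (u := i.-1) gT cpj; try by lia.
have wi' : w < i by lia.
have ix' : i <= x by lia.
have [e'|ne] := eqVneq i x.
  by subst x; apply: connect_trans pw _; apply: connect1.
have {ne ix'}ix' := ord_ltP ix' ne; have lxj := connect_arc_le gT xj.
have xQ := route_escape_left nT sQ rQ wx ix' lxj wi'.
have [e'|ne] := eqVneq x j; first by subst x; move: (jT w wi'); rewrite wx.
by have := gL x w xQ ix' (ord_ltP lxj ne) wx; rewrite leqNgt wi'.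
Qed.

Lemma route_adj m (Q : {set 'I_m * 'I_m}) i j x y :
  route Q i j -> x \in vset Q -> y \in vset Q -> connect (adj Q) x y.
Proof.
move=> rQ /(route_vset rQ)[ix _] /(route_vset rQ)[iy _].
apply: (@connect_trans _ _ i); last exact: connect_arc_adj.
by rewrite adj_connect_sym; apply: connect_arc_adj.
Qed.

(** * Spines and minimal splittings *)

Lemma spine_route m (E P : {set 'I_m * 'I_m}) :
  is_graph E -> noncrossing E -> spine E P ->
  exists i s, [/\ minimal_in (vset E) i, maximal_in (vset E) (last i s),
    P = path_edges i s, uniq (i :: s) & route P i (last i s) /\ P \subset E].
Proof.
move=> gE nE [i [s [mini maxl ps us eP]]]; exists i, s.
have psE : {subset s <= vset E}.
  elim: s i ps {mini maxl us eP} => //= y s IH i /andP[iy ps] z.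
  rewrite inE => /orP[/eqP ->|]; last exact: IH ps z.
  by rewrite inE; apply/existsP; exists i; rewrite adj_sym.
have s0 : s != [::].
  apply/eqP => s0; move: maxl; rewrite s0 /= => -[_ maxi].
  have [_ min] := mini; have [e eE _] := vsetP mini.1.
  have := gE e eE; have := min _ (vset1 eE); have := maxi _ (vset2 eE).
  by move=> h1 h2 h3; have := leq_trans h3 (leq_trans h1 h2); rewrite ltnn.
have pe : path (erel E) i s.
  apply: path_increasing => //.
    move=> z zs; apply: ord_ltP; first by apply: mini.2; apply: psE.
    by move: us => /andP[ins _]; apply: contraNneq ins => ->.
  by move=> z zs; apply: maxl.2; apply: psE.
by split=> //; rewrite eP; apply: path_route.
Qed.

(** Let the edge be [(x, y)]. To avoid a crossing, the route edge over the gap after [x] starts at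
    [x] and the one over the gap before [y] ends at [y]. So both ends lie on [P], and the edge
    closes a cycle. *)
Lemma edge_no_jump m (E P : {set 'I_m * 'I_m}) i j e u :
    forest E -> noncrossing E -> route P i j -> P \subset E ->
    minimal_in (vset E) i -> maximal_in (vset E) j ->
    e \in E :\: P -> u \in vset P -> e.1 < u -> u < e.2 -> False.
Proof.
move=> fE nE rP sP [_ mini] [_ maxj]; case: e => x y; rewrite inE => /andP[xyP xyE] uP /= xu uy.
have [gE _] := fE; have gP := route_graph rP.
have ix : i <= x := mini _ (vset1 xyE); have yj : y <= j := maxj _ (vset2 xyE).
have [|a [b [ab ax xb]]] := @route_jump _ _ _ _ x rP.
  by rewrite ix (ltn_trans xu (leq_trans uy yj)).
have bu : b <= u.
  by rewrite leqNgt; apply/negP => ub; exact: (route_no_jump rP ab uP (leq_ltn_trans ax xu) ub).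
have eax : a = x.
  apply/eqP/negPn/negP => ne; apply: (nE a x b y (ord_ltP ax ne) xb (leq_ltn_trans bu uy)).
  by split=> //; apply: (subsetP sP).
have xP : x \in vset P by rewrite -eax (vset1 ab).
have [|c [d [cd cy yd]]] := @route_jump _ _ _ _ y.-1 rP.
  by clear -ix xu uy yj; lia.
have uc : u <= c.
  rewrite leqNgt; apply/negP => cu; apply: (route_no_jump rP cd uP cu) => /=.
  by clear -uy yd; lia.
have edy : y = d.
  apply/eqP/negPn/negP => ne; apply: (nE x c y d) => //.
  - exact: leq_trans uc.
  - by clear -cy uy; lia.
  - by apply: ord_ltP ne; clear -yd uy; lia.
  - by split=> //; apply: (subsetP sP).
have yP : y \in vset P by rewrite edy (vset2 cd).
have /negP[] := forest_cut fE xyE; apply: connect_adj_sub (route_adj rP xP yP).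
apply/subsetP => e eP; rewrite !inE (subsetP sP) // andbT.
by apply: contraNneq xyP => <-.
Qed.

Lemma connect_side m (B : {set 'I_m * 'I_m}) (u x y : 'I_m) :
    is_graph B -> (forall e, e \in B -> e.1 < u -> u < e.2 -> False) ->
    u \notin vset B -> connect (adj B) x y ->
  (u < x) = (u < y).
Proof.
move=> gB nj uB cxy.
suff cl : closed (adj B) [pred z : 'I_m | u < z] by have := closed_connect cl cxy; rewrite !inE.
have half a b : (a, b) \in B -> (u < a) = (u < b).
  move=> ab; have lab := gB _ ab; simpl in lab.
  apply/idP/idP => [h|ub]; first exact: ltn_trans lab.
  rewrite ltnNge; apply/negP => au; apply: (nj _ ab) => //=.
  apply: ord_ltP au _; apply: contraNneq uB => <-; exact: (vset1 ab).
by move=> a b /orP[] /half.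
Qed.

(** Here minimality of the splitting acts: two of its trees that share a vertex [v] outside [P]
    could be replaced by their union. The union still meets [P] only at its extreme vertices,
    because both trees lie on the same side of any vertex of [P] as [v] does. *)
Lemma splitting_merge m (E P : {set 'I_m * 'I_m}) D i j v e e' Tl Tl' :
    forest E -> noncrossing E -> route P i j -> P \subset E ->
    minimal_in (vset E) i -> maximal_in (vset E) j ->
    min_splitting E P D -> v \notin vset P ->
    Tl \in D -> Tl' \in D -> e \in Tl -> e' \in Tl' ->
    (e.1 == v) || (e.2 == v) -> (e'.1 == v) || (e'.2 == v) ->
  Tl = Tl'.
Proof.
move=> fE nE rP sP mini maxj [[partD treeD endD] minD] vP TlD TlD' eT eT' ev ev'.
apply/eqP/negPn/negP => neT.
have /and3P[/eqP covD trivD D0] := partD.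
have subD B : B \in D -> B \subset E :\: P.
  by move=> BD; rewrite -covD; apply: bigcup_sup BD.
have subE B : B \in D -> B \subset E.
  by move=> /subD h; apply: fintype.subset_trans h (subsetDl _ _).
have [gE _] := fE.
have vTl := vset_touch eT ev; have vTl' := vset_touch eT' ev'.
have side B u : B \in D -> v \in vset B -> u \in vset P ->
    (u < v -> forall y, y \in vset B -> u <= y) /\
    (v < u -> forall y, y \in vset B -> y <= u).
  move=> BD vB uP; have [uB|uB] := boolP (u \in vset B).
    have [[_ h]|[_ h]] := endD B u BD uP uB; split=> // h1; have := h v vB.
      by rewrite leqNgt h1.
    by rewrite leqNgt h1.
  have [[gB _] _ cB] := treeD B BD.
  have same y : y \in vset B -> (u < v) = (u < y).
    move=> yB; apply: (connect_side gB) => //; last exact: cB.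
    move=> f fB; apply: (edge_no_jump fE nE rP sP mini maxj) => //.
    exact: (subsetP (subD B BD)).
  split=> [uv y yB|vu y yB]; first by apply: ltnW; rewrite -same.
  by rewrite leqNgt -same // -leqNgt ltnW.
pose U := Tl :|: Tl'.
have vU z : z \in vset U -> z \in vset Tl \/ z \in vset Tl'.
  by move=> /vsetP[f]; rewrite inE => /orP[] fT tf; [left|right]; apply: vset_touch tf.
have UD : U \notin D :\: [set Tl; Tl'].
  apply/negP; rewrite !inE negb_or => /andP[/andP[UT UT'] UD].
  have /trivIsetP/(_ _ _ UD TlD UT) := trivD; rewrite -setI_eq0 => /eqP/setP/(_ e).
  by rewrite !inE eT.
pose D' := U |: (D :\: [set Tl; Tl']).
apply: (minD D'); last first.
  rewrite cardsU1 UD add1n; have := cardsID [set Tl; Tl'] D.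
  have -> : D :&: [set Tl; Tl'] = [set Tl; Tl'].
    by apply/finset.setIidPr/subsetP => B; rewrite !inE => /orP[] /eqP ->.
  by rewrite cards2 neT => <-.
split.
- apply/and3P; split.
  + rewrite -covD eqEsubset; apply/andP; split; apply/subsetP => f /bigcupP[B].
      rewrite in_setU1 => /orP[/eqP ->|]; last first.
        by rewrite inE => /andP[_ BD] fB; apply/bigcupP; exists B.
      by rewrite inE => /orP[] fT; apply/bigcupP; [exists Tl|exists Tl'].
    move=> BD fB; have [BT|] := boolP (B \in [set Tl; Tl']).
      apply/bigcupP; exists U; first by rewrite setU11.
      by move: BT; rewrite !inE => /orP[] /eqP <-; rewrite fB ?orbT.
    by move=> nB; apply/bigcupP; exists B => //; rewrite in_setU1 inE nB BD orbT.
  + have disU B : B \in D :\: [set Tl; Tl'] -> [disjoint U & B].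
      rewrite !inE negb_or => /andP[/andP[n1 n2] BD].
      rewrite -setI_eq0 setIUl finset.setU_eq0 !setI_eq0.
      by apply/andP; split; apply: (trivIsetP trivD) => //; rewrite eq_sym.
    apply/trivIsetP => A B; rewrite !in_setU1.
    case/orP=> [/eqP ->|AD]; case/orP=> [/eqP ->|BD] ne; first by rewrite eqxx in ne.
    * exact: disU.
    * by rewrite disjoint_sym; apply: disU.
    * move: AD BD; rewrite !inE => /andP[_ AD] /andP[_ BD].
      exact: (trivIsetP trivD).
  + rewrite !inE negb_or negb_and D0 orbT andbT eq_sym.
    by apply/set0Pn; exists e; rewrite inE eT.
- move=> B; rewrite in_setU1 => /orP[/eqP ->|]; last first.
    by rewrite inE => /andP[_ BD]; apply: treeD.
  split=> //; first by apply: forest_sub fE; rewrite subUset !subE.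
  have cv z : z \in vset U -> connect (adj U) z v.
    move=> /vU[zT|zT].
      by apply: connect_adj_sub (subsetUl _ _) _; have [_ _ ->] := treeD _ TlD.
    by apply: connect_adj_sub (subsetUr _ _) _; have [_ _ ->] := treeD _ TlD'.
  move=> x y /cv cx /cv cy; apply: connect_trans cx _.
  by rewrite adj_connect_sym.
- move=> B u; rewrite in_setU1 => /orP[/eqP -> uP uU|]; last first.
    by rewrite inE => /andP[_ BD]; apply: endD.
  have uv : u != v by apply: contraNneq vP => <-.
  have [s1 s2] := side Tl u TlD vTl uP; have [s1' s2'] := side Tl' u TlD' vTl' uP.
  have [ltuv|ltvu] : u < v \/ v < u.
    by have [?|] := leqP u v; [left; apply: ord_ltP|right].
  + by left; split=> // y /vU[]; [apply: s1|apply: s1'].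
  + by right; split=> // y /vU[]; [apply: s2|apply: s2'].
Qed.

Definition touches m (e : 'I_m * 'I_m) (v : 'I_m) : bool := (e.1 == v) || (e.2 == v).

(* Invariant of the recursion producing pseudo-components: a piece communicates
   with the rest of T through at most one of its extreme vertices. *)
Definition piece m (T E : {set 'I_m * 'I_m}) : Prop :=
  [/\ E \subset T, {in vset E &, forall x y, connect (adj E) x y} &
   forall x y, minimal_in (vset E) x -> maximal_in (vset E) y ->
     (forall v e, v \in vset E -> x < v -> v < y -> e \in T -> touches e v -> e \in E) /\
     ((forall e, e \in T -> touches e x -> e \in E) \/
      (forall e, e \in T -> touches e y -> e \in E))].

Lemma piece_good_route m (T E P : {set 'I_m * 'I_m}) :
    is_graph T -> noncrossing T -> piece T E -> spine E P ->
  exists i s, [/\ P = path_edges i s, uniq (i :: s) & good_route T P i (last i s)].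
Proof.
move=> gT nT [sE cE hE] spP.
have gE := is_graph_sub sE gT; have nE := noncrossing_sub sE nT.
have [i [s [mini maxj eP us [rP sP]]]] := spine_route gE nE spP.
exists i, s; split=> //.
have [hin hend] := hE _ _ mini maxj; set j := last i s in rP mini maxj hin hend *.
have t1 (a b : 'I_m) : touches (a, b) a by rewrite /touches eqxx.
have t2 (a b : 'I_m) : touches (a, b) b by rewrite /touches eqxx orbT.
have vE : {subset vset P <= vset E} := vset_sub sP.
split=> //; first exact: fintype.subset_trans sE.
- move=> v w /vE vv iv vj vw; have vwE := hin v _ vv iv vj vw (t1 _ _).
  by apply: maxj.2; apply: (vset2 vwE).
- move=> v w /vE vv iv vj vw; have vwE := hin v _ vv iv vj vw (t2 _ _).
  by apply: mini.2; apply: (vset1 vwE).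
case: hend => h; [left|right]; split=> w lt; apply/negP => eT.
- by have := mini.2 _ (vset1 (h _ eT (t2 _ _))); rewrite leqNgt lt.
- by have := maxj.2 _ (vset2 (h _ eT (t1 _ _))); rewrite leqNgt lt.
- by have := maxj.2 _ (vset2 (h _ eT (t1 _ _))); rewrite leqNgt lt.
- by have := mini.2 _ (vset1 (h _ eT (t2 _ _))); rewrite leqNgt lt.
Qed.

(** At a vertex of [Tl] outside [P] all edges of [T] belong to [Tl], by [splitting_merge]; a vertex
    of [Tl] on [P] is extreme. The extreme vertices are not both on [P]: they would be consecutive
    there, and the edge of [P] joining them would close a cycle with [Tl]. *)
Lemma piece_sub m (T E P : {set 'I_m * 'I_m}) D Tl :
    forest T -> noncrossing T -> piece T E -> spine E P -> min_splitting E P D ->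
    Tl \in D ->
  piece T Tl.
Proof.
move=> fT nT [sE cE hE] spP msD TlD; have [gT _] := fT.
have gE := is_graph_sub sE gT; have nE := noncrossing_sub sE nT.
have fE := forest_sub sE fT.
have [i [s [mini maxj eP us [rP sP]]]] := spine_route gE nE spP.
have [hin hend] := hE _ _ mini maxj; set j := last i s in rP mini maxj hin hend *.
have [[partD treeD endD] _] := msD; have /and3P[/eqP covD trivD D0] := partD.
have sTl : Tl \subset E :\: P by rewrite -covD; apply: bigcup_sup TlD.
have sTlE : Tl \subset E by apply: fintype.subset_trans sTl (subsetDl _ _).
have [[gTl _] _ cTl] := treeD _ TlD.
have full v : v \in vset Tl -> v \notin vset P ->
    forall e, e \in T -> touches e v -> e \in Tl.
  move=> vTl vP e eT te.
  have vE := vset_sub sTlE vTl.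
  have iv : i < v.
    by apply: ord_ltP; [exact: mini.2|apply: contraNneq vP => <-; apply: route_vset1 rP].
  have vj : v < j.
    by apply: ord_ltP; [exact: maxj.2|apply: contraNneq vP => ->; apply: route_vset2 rP].
  have eE := hin v e vE iv vj eT te.
  have : e \in cover D.
    rewrite covD inE eE andbT; apply: contra vP => eP'; exact: vset_touch te.
  case/bigcupP=> Tl' TlD' eTl'; have [e0 e0T te0] := vsetP vTl.
  by rewrite (splitting_merge fE nE rP sP mini maxj msD vP TlD TlD' e0T eTl' te0 te).
split; [exact: fintype.subset_trans sE|exact: cTl|].
move=> x y minx maxy; split.
  move=> v e vTl xv vy eT te; apply: (full v) => //; apply/negP => vP.
  have [[_ h]|[_ h]] := endD Tl v TlD vP vTl.
    by have := h x minx.1; rewrite leqNgt xv.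
  by have := h y maxy.1; rewrite leqNgt vy.
have [xP|xP] := boolP (x \in vset P); last by left; apply: full => //; exact: minx.1.
have [yP|yP] := boolP (y \in vset P); last by right; apply: full => //; exact: maxy.1.
exfalso.
have xy : x < y.
  have [e eT _] := vsetP minx.1; have := gTl _ eT.
  have := minx.2 _ (vset1 eT); have := maxy.2 _ (vset2 eT).
  by move=> h1 h2 h3; exact: leq_ltn_trans h2 (leq_trans h3 h1).
(* In [Tl] such a vertex would have to be extreme; outside [Tl], connectedness would force an edge
   of [Tl] to pass over it. *)
have between u : u \in vset P -> x < u -> u < y -> False.
  move=> uP xu uy; have [uT|uT] := boolP (u \in vset Tl).
    have [[_ h]|[_ h]] := endD Tl u TlD uP uT.
      by have := h x minx.1; rewrite leqNgt xu.
    by have := h y maxy.1; rewrite leqNgt uy.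
  have := @connect_side _ Tl u x y gTl _ uT (cTl _ _ minx.1 maxy.1).
  rewrite uy ltnNge (ltnW xu) => /(_ _)/notF; apply.
  move=> f fTl; apply: (edge_no_jump fE nE rP sP mini maxj) => //.
  exact: (subsetP sTl).
have /andP[ix _] := route_bounds rP xP; have /andP[_ yj] := route_bounds rP yP.
have [|p [q [pq px xq]]] := @route_jump _ _ _ _ x rP.
  by rewrite ix (leq_trans xy).
have ep : p = x.
  apply/eqP/negPn/negP => ne.
  exact: (route_no_jump rP pq xP (ord_ltP px ne) xq).
have eq : q = y.
  apply/eqP/negPn/negP => ne; have [qy|yq] := leqP q y.
    exact: (between q (vset2 pq) xq (ord_ltP qy ne)).
  by apply: (route_no_jump rP pq yP) => //=; rewrite ep.
subst p q; have := forest_cut fE (subsetP sP _ pq).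
move=> /negP[]; apply: connect_adj_sub (cTl _ _ minx.1 maxy.1).
apply/subsetP => f fTl; rewrite !inE (subsetP sTlE) // andbT.
by apply: contraTneq fTl => ->; apply/negP => /(subsetP sTl); rewrite inE pq.
Qed.

Lemma pseudo_component_good m (T E Q : {set 'I_m * 'I_m}) :
    forest T -> noncrossing T -> pseudo_component E Q -> piece T E ->
  exists i s, [/\ Q = path_edges i s, uniq (i :: s) & good_route T Q i (last i s)].
Proof.
move=> fT nT; have [gT _] := fT.
elim=> {E Q} [E P spP|E P D Tl Q spP msD TlD _ IH] pE; first exact: piece_good_route spP.
exact: IH (piece_sub fT nT pE spP msD TlD).
Qed.

Lemma spine_exists m (E : {set 'I_m * 'I_m}) e :
  {in vset E &, forall x y, connect (adj E) x y} -> e \in E -> exists P, spine E P.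
Proof.
move=> cE eE; have v0 := vset1 eE.
case: (arg_minnP (fun x : 'I_m => x : nat) v0) => x xE xmin.
case: (arg_maxnP (fun x : 'I_m => x : nat) v0) => y yE ymax.
have {}xE : x \in vset E by []. have {}yE : y \in vset E by [].
have /connectP[p0 pp0 lp0] := cE _ _ xE yE.
case/shortenP: pp0 lp0 => p pp up _ lp.
exists (path_edges x p), x, p; split=> //; rewrite -?lp; split=> //.
Qed.

(** Single edges form a splitting; one with the fewest trees is minimal in the required sense. *)
Lemma min_splitting_exists m (E P : {set 'I_m * 'I_m}) :
  forest E -> exists D, min_splitting E P D.
Proof.
move=> fE; have [gE _] := fE.
pose D0 := [set [set e] | e in E :\: P].
have s0 : splitting E P D0.
  have inD0 B : B \in D0 -> exists2 e, e \in E :\: P & B = [set e].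
    by move=> /imsetP[e eE ->]; exists e.
  split.
  - apply/and3P; split.
    + apply/eqP/setP => f; apply/bigcupP/idP => [[B /inD0[e eE ->]]|fE'].
        by rewrite !inE => /eqP ->; rewrite inE in eE.
      by exists [set f]; [apply/imsetP; exists f|rewrite inE].
    + apply/trivIsetP => A B /inD0[e eE ->] /inD0[f fE' ->] ne.
      by rewrite disjoints1 inE; apply: contraNneq ne => ->.
    + by apply/negP => /inD0[e _ /setP/(_ e)]; rewrite !inE eqxx.
  - move=> B /inD0[e eE ->]; split=> //.
      by apply: forest_sub fE; rewrite sub1set; move: eE; rewrite inE => /andP[].
    have ce : adj [set e] e.1 e.2 by rewrite /adj inE -surjective_pairing eqxx.
    have ce' : adj [set e] e.2 e.1 by rewrite adj_sym.
    have vE v : v \in vset [set e] -> v = e.1 \/ v = e.2.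
      by move=> /vsetP[f]; rewrite inE => /eqP -> /orP[] /eqP <-; [left|right].
    by move=> x y /vE[] -> /vE[] ->; rewrite ?connect0 ?connect1.
  - move=> B v /inD0[e eE ->] _ /vsetP[f]; rewrite inE => /eqP -> te.
    have e12 : e.1 < e.2 by apply: gE; move: eE; rewrite inE => /andP[].
    have vE w : w \in vset [set e] -> w = e.1 \/ w = e.2.
      by move=> /vsetP[f']; rewrite inE => /eqP -> /orP[] /eqP <-; [left|right].
    case/orP: te => /eqP <-; [left|right]; split.
    + by apply: vset1; rewrite inE.
    + by move=> y /vE[] -> //; apply: ltnW.
    + by apply: vset2; rewrite inE.
    + by move=> y /vE[] -> //; apply: ltnW.
pose S D := `[< splitting E P D >].
have S0 : S D0 by apply/asboolP.
case: (arg_minnP (fun D : {set {set 'I_m * 'I_m}} => #|D|) S0) => D /asboolP sD Dmin.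
exists D; split=> // D' sD' e; have := Dmin D'; rewrite -e ltnn => /(_ _)/notF; apply.
exact/asboolP.
Qed.

(** An edge off the spine lies in a tree of a minimal splitting, which is smaller because the spine
    has an edge. *)
Lemma pseudo_component_exists m (T E : {set 'I_m * 'I_m}) e :
    forest T -> noncrossing T -> piece T E -> e \in E ->
  exists2 Q, pseudo_component E Q & e \in Q.
Proof.
move=> fT nT; have [gT _] := fT.
have [k] := ubnP #|E|; elim: k E => // k IH E Ek pE eE.
have [sE cE _] := pE; have fE := forest_sub sE fT.
have [P spP] := spine_exists cE eE.
have [eP|eP] := boolP (e \in P); first by exists P => //; apply: PsSpine.
have [D msD] := min_splitting_exists P fE.
have [[partD _ _] _] := msD; have /and3P[/eqP covD _ _] := partD.
have : e \in cover D by rewrite covD inE eP.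
case/bigcupP=> Tl TlD eTl.
have sTl : Tl \subset E :\: P by rewrite -covD; apply: bigcup_sup TlD.
have [i [s [_ _ _ _ [rP sP]]]] := spine_route fE.1 (noncrossing_sub sE nT) spP.
have [f fP _] := vsetP (route_vset1 rP).
have [|Q pQ eQ] := IH Tl _ (piece_sub fT nT pE spP msD TlD) eTl; last first.
  by exists Q => //; exact: (PsSub spP msD TlD pQ).
rewrite -ltnS; apply: leq_trans Ek; rewrite ltnS; apply: proper_card; apply/properP; split.
  exact: fintype.subset_trans sTl (subsetDl _ _).
exists f; first exact: (subsetP sP).
by apply/negP => /(subsetP sTl); rewrite inE fP.
Qed.

Lemma tree_piece m (T : {set 'I_m * 'I_m}) : connected T -> piece T T.
Proof. by move=> cT; split=> //; split=> //; left. Qed.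

(** Each edge of [T] lies in a pseudo-component, which is left or right, and the long edge
    prescribed for it covers the whole component. Conversely [left_edge] and [right_edge] produce
    the prescribed edges. *)
Lemma admissible_covers n (T F : {set 'I_n.+1 * 'I_n.+1}) k :
    0 < n -> nctree T ->
  admissible_forest T k F <-> [/\ face T F, covers T F & #|F| = k].
Proof.
move=> n0 [fT nT cT]; have [gT _] := fT; have pT := tree_piece cT.
split=> [[[fF sF nF aF] Fk _ hright hleft]|[fF cF Fk]].
  split=> // e eT.
  have [Q pQ eQ] := pseudo_component_exists fT nT pT eT.
  have [i [s [eQs us gQ]]] := pseudo_component_good fT nT pQ pT.
  set j := last i s in gQ.
  have pon : pseudo_component_on T i j.
    by split; [exact: route_lt gQ.(gr_route)|exists s; split=> //; rewrite -eQs].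
  have [[h1 h2]|[h1 h2]] := gr_end gQ.
    have [|q jq qF] := hleft i j.
      by split=> // -[w [wi wT]]; move: (h1 w wi); rewrite wT.
    have [] := left_edge_cover gT nT gQ h2 (subsetP sF _ qF) jq eQ.
    by exists (i, q).
  have [|p pi pF] := hright i j.
    by split=> // -[w [wi wT]]; move: (h1 w wi); rewrite wT.
  have [] := right_edge_cover gT nT gQ h2 (subsetP sF _ pF) pi eQ.
  by exists (p, j).
have gF := face_graph fF; have [sF nF aF] := fF.
have ends i j : pseudo_component_on T i j -> exists2 Q, good_route T Q i j & True.
  move=> [ij [s [us ls pQ]]].
  have [i0 [s0 [eQ us0 gQ]]] := pseudo_component_good fT nT pQ pT.
  have [e0 e1] : i = i0 /\ last i s = last i0 s0.
    by apply: (route_endpoints (gr_route gQ) erefl us); rewrite ls.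
  by exists (path_edges i s) => //; rewrite {2}e0 -ls e1.
have hright i j : right_pseudo_component_on T i j ->
    exists2 i1 : 'I_n.+1, i1 <= i & (i1, j) \in F.
  move=> [/ends[Q gQ _] nj]; apply: (right_edge gT nT gQ fF cF) => w jw.
  by apply/negP => jwT; apply: nj; exists w.
have hleft i j : left_pseudo_component_on T i j ->
    exists2 j1 : 'I_n.+1, j <= j1 & (i, j1) \in F.
  move=> [/ends[Q gQ _] nj]; apply: (left_edge gT nT gQ fF cF) => w wi.
  by apply/negP => jwT; apply: nj; exists w.
split=> //.
  by split=> //; exact: face_forest fF.
(* As [0 < n], every vertex has an edge, so the spine of [T] runs from [ord0] to [ord_max]. The edge
   prescribed for it as a right pseudo-component is [(ord0, ord_max)]. *)
have vT x : x \in vset T.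
  have [y nxy] : exists y, x != y.
    by have [->|h] := eqVneq x ord0; [exists ord_max; rewrite -val_eqE /= neq_ltn n0|exists ord0].
  have /connectP[[|z p] /=] := cT x y; first by move=> _ e; rewrite e eqxx in nxy.
  by move=> /andP[xz _] _; rewrite inE; apply/existsP; exists z.
have [e eT _] := vsetP (vT ord0).
have [P spP] := spine_exists (in2W cT) eT.
have [i [s [mini maxj eP us [rP sP]]]] := spine_route gT nT spP.
have i0 : i = ord0 by apply: val_inj => /=; apply/eqP; rewrite -leqn0; exact: (mini.2 ord0).
have jm : last i s = ord_max.
  apply: val_inj => /=; apply/eqP; rewrite eqn_leq -ltnS ltn_ord /=.
  exact: (maxj.2 ord_max).
have [|p p0 pF] := hright i (last i s).
  split; first by split; [exact: route_lt rP|exists s; split=> //; rewrite -eP; exact: PsSpine].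
  by move=> [w []]; rewrite jm ltnNge -ltnS ltn_ord.
have -> : ord0 = p by apply: val_inj => /=; move: p0; rewrite i0 leqn0 => /eqP.
by rewrite -jm.
Qed.

(** * Alternating noncrossing representations *)

Local Open Scope ring_scope.

(** Root vectors over any ring: integers for lattice points, rationals for the number of edges of a
    tree, reals for the polytope. *)
Definition rt (R : pzRingType) m (e : 'I_m * 'I_m) (v : 'I_m) : R :=
  (v == e.1)%:R - (v == e.2)%:R.

Lemma sum_indic (R : pzRingType) m (S : {set 'I_m}) (x : 'I_m) :
  \sum_(v in S) (v == x)%:R = (x \in S)%:R :> R.
Proof.
rewrite big_mkcond (bigD1 x) //= eqxx big1 ?addr0; first by case: (x \in S).
by move=> v /negPf ->; case: (v \in S).
Qed.

Lemma sum_rt (R : pzRingType) m (S : {set 'I_m}) e :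
  \sum_(v in S) rt R e v = (e.1 \in S)%:R - (e.2 \in S)%:R.
Proof. by rewrite big_split sumrN !sum_indic. Qed.

Lemma sum_comb (R : pzRingType) m (A : {pred 'I_m * 'I_m})
    (c : 'I_m * 'I_m -> R) (S : {set 'I_m}) :
  \sum_(v in S) \sum_(e in A) c e * rt R e v =
  \sum_(e in A) c e * ((e.1 \in S)%:R - (e.2 \in S)%:R).
Proof.
rewrite exchange_big; apply: eq_bigr => e _; rewrite -mulr_sumr.
by rewrite sum_rt.
Qed.

(** Any other edge has both ends or neither in the cut side, so its contributions cancel. *)
Lemma sum_comb_cut (R : pzRingType) m (E : {set 'I_m * 'I_m})
    (c : 'I_m * 'I_m -> R) e : forest E -> e \in E ->
  \sum_(v in cut_side E e) \sum_(f in E) c f * rt R f v = c e.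
Proof.
move=> fE eE; rewrite sum_comb (bigD1 e) //= big1 ?addr0.
  rewrite (cut_sideE fE eE eE) eqxx (negPf (cut_side2 fE eE)) subr0.
  by rewrite mulr1.
move=> f /andP[fE' /negPf fe]; rewrite (cut_sideE fE eE fE') fe subrr.
by rewrite mulr0.
Qed.

Definition supp m (w : 'I_m * 'I_m -> nat) : {set 'I_m * 'I_m} :=
  [set e | (0 < w e)%N].

(** The vector of a multiset of edges with multiplicities [w]; natural multiplicities allow
    induction on their total. *)
Definition flow m (w : 'I_m * 'I_m -> nat) (v : 'I_m) : int :=
  \sum_e (w e)%:R * rt int e v.

Definition decr m (w : 'I_m * 'I_m -> nat) f : 'I_m * 'I_m -> nat :=
  fun e => (w e - (e == f))%N.

Lemma supp_decr m (w : 'I_m * 'I_m -> nat) f : supp (decr w f) \subset supp w.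
Proof. by apply/subsetP => e; rewrite !inE /decr; lia. Qed.

Lemma flow_decr m (w : 'I_m * 'I_m -> nat) f v : f \in supp w ->
  flow w v = flow (decr w f) v + rt int f v.
Proof.
rewrite inE => f0; rewrite /flow (bigD1 f) //= [in RHS](bigD1 f) //=.
rewrite addrAC; congr (_ + _); last first.
  by apply: eq_bigr => e /negPf ef; rewrite /decr ef subn0.
by rewrite /decr eqxx natrB // mulrBl mul1r subrK.
Qed.

Lemma sum_decr m (w : 'I_m * 'I_m -> nat) f : f \in supp w ->
  (\sum_e w e = (\sum_e decr w f e).+1)%N.
Proof.
rewrite inE => f0; rewrite (bigD1 f) //= [in RHS](bigD1 f) //=.
rewrite /decr eqxx subn1 -addSn prednK //; congr (_ + _)%N.
by apply: eq_bigr => e /negPf ->; rewrite subn0.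
Qed.

Lemma sum_flow m (w : 'I_m * 'I_m -> nat) (S : {set 'I_m}) :
  \sum_(v in S) flow w v =
  \sum_e (w e)%:R * ((e.1 \in S)%:R - (e.2 \in S)%:R).
Proof. exact: sum_comb. Qed.

Lemma consecutive_signs m (z : 'I_m -> int) (a b : 'I_m) :
    (a < b)%N -> 0 < z a -> z b < 0 ->
  exists i j : 'I_m, [/\ (i < j)%N, 0 < z i, z j < 0 &
    forall u : 'I_m, (i < u)%N -> (u < j)%N -> z u = 0].
Proof.
move=> ab za zb.
pose P (p : 'I_m * 'I_m) := [&& (p.1 < p.2)%N, 0 < z p.1 & z p.2 < 0].
have Pab : P (a, b) by rewrite /P /= ab za zb.
case: (arg_minnP (fun p : 'I_m * 'I_m => p.2 - p.1)%N Pab) => -[i j].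
rewrite /P /= => /and3P[ij zi zj] minij; exists i, j; split=> // u iu uj.
apply/eqP; case: ltgtP => // zu.
  by have := minij (i, u); rewrite /= iu zi zu; lia.
by have := minij (u, j); rewrite /= uj zj zu; lia.
Qed.

Lemma flow_gt0_source m (w : 'I_m * 'I_m -> nat) i :
  0 < flow w i -> exists2 e, e \in supp w & e.1 = i.
Proof.
move=> wi; have [/existsP[e /andP[ew /eqP ei]]|no] :=
  boolP [exists e, (e \in supp w) && (e.1 == i)]; first by exists e.
move: wi; rewrite ltNge => /negP[]; apply: sumr_le0 => e _.
have [ew|] := boolP (e \in supp w); last first.
  by rewrite inE -eqn0Ngt => /eqP ->; rewrite mul0r.
rewrite mulr_ge0_le0 // /rt eq_sym.
have /negPf -> : e.1 != i by apply: contra no => ei; apply/existsP; exists e; rewrite ew.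
by rewrite sub0r oppr_le0.
Qed.

Lemma flow_lt0_sink m (w : 'I_m * 'I_m -> nat) j :
  flow w j < 0 -> exists2 e, e \in supp w & e.2 = j.
Proof.
move=> wi; have [/existsP[e /andP[ew /eqP ei]]|no] :=
  boolP [exists e, (e \in supp w) && (e.2 == j)]; first by exists e.
move: wi; rewrite ltNge => /negP[]; apply: sumr_ge0 => e _.
have [ew|] := boolP (e \in supp w); last first.
  by rewrite inE -eqn0Ngt => /eqP ->; rewrite mul0r.
rewrite mulr_ge0 // /rt [j == e.2]eq_sym.
have /negPf -> : e.2 != j by apply: contra no => ei; apply/existsP; exists e; rewrite ew.
by rewrite subr0.
Qed.

Lemma alternating_disj m (E : {set 'I_m * 'I_m}) e f :
  is_graph E -> alternating E -> e \in E -> f \in E -> e.2 != f.1.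
Proof.
case: e f => a b [c d] gE altE ab cd /=; apply/eqP => bc; subst c.
exact: (altE a b d (gE _ ab) (gE _ cd)).
Qed.

Lemma flow_alternating m (w : 'I_m * 'I_m -> nat) e :
    is_graph (supp w) -> alternating (supp w) -> e \in supp w ->
  0 < flow w e.1 /\ flow w e.2 < 0.
Proof.
move=> gw aw ew; have e12 := gw _ ew.
have w0 : (0 < w e)%N by move: ew; rewrite inE.
have ne : e.1 != e.2 by apply/eqP => h; move: e12; rewrite h ltnn.
split.
  rewrite /flow (bigD1 e) //= /rt eqxx (negPf ne) subr0 mulr1.
  apply: ltr_pwDl; first by rewrite ltr0n.
  apply: sumr_ge0 => f _; have [fw|] := boolP (f \in supp w); last first.
    by rewrite inE -eqn0Ngt => /eqP ->; rewrite mul0r.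
  by rewrite [e.1 == f.2]eq_sym (negPf (alternating_disj gw aw fw ew)) subr0 mulr_ge0.
rewrite /flow (bigD1 e) //= /rt eqxx [e.2 == e.1]eq_sym (negPf ne) sub0r mulrN1.
rewrite -oppr_gt0 opprD opprK -sumrN; apply: ltr_pwDl; first by rewrite ltr0n.
apply: sumr_ge0 => f _; have [fw|] := boolP (f \in supp w); last first.
  by rewrite inE -eqn0Ngt => /eqP ->; rewrite mul0r oppr0.
by rewrite (negPf (alternating_disj gw aw ew fw)) sub0r mulrN opprK mulr_ge0.
Qed.

(** Some edge leaves [i] and ends at [j] or beyond, some edge enters [j] and starts at [i] or
    before; if neither is [(i, j)], they cross. *)
Lemma flow_inner_edge m (w : 'I_m * 'I_m -> nat) (i j : 'I_m) :
    is_graph (supp w) -> alternating (supp w) -> noncrossing (supp w) ->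
    (i < j)%N -> 0 < flow w i -> flow w j < 0 ->
    (forall u : 'I_m, (i < u)%N -> (u < j)%N -> flow w u = 0) ->
  (i, j) \in supp w.
Proof.
move=> gw aw nw ij wi wj w0.
have [[i' k] ik /= ei] := flow_gt0_source wi; subst i'.
have [[h j'] hj /= ej] := flow_lt0_sink wj; subst j'.
have [_ /= wk] := flow_alternating gw aw ik.
have [/= wh _] := flow_alternating gw aw hj.
have /= lik := gw _ ik; have /= lhj := gw _ hj.
have jk : (j <= k)%N.
  by rewrite leqNgt; apply/negP => kj; move: wk; rewrite w0.
have hi : (h <= i)%N.
  by rewrite leqNgt; apply/negP => ih; move: wh; rewrite w0.
have [->//|jk'] := eqVneq j k; have [<-//|hi'] := eqVneq h i.
have : j <> k :> nat by move=> /val_inj/eqP; rewrite (negPf jk').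
have : h <> i :> nat by move=> /val_inj/eqP; rewrite (negPf hi').
move=> h1 h2; case: (nw h i j k) => //; lia.
Qed.

Lemma flow_inj_supp0 m (w : 'I_m * 'I_m -> nat) :
    is_graph (supp w) -> alternating (supp w) -> flow w =1 (fun=> 0) ->
  w =1 fun=> 0%N.
Proof.
move=> gw aw w0 e; have [ew|] := boolP (e \in supp w).
  by have [] := flow_alternating gw aw ew; rewrite w0.
by rewrite inE -eqn0Ngt => /eqP.
Qed.

(** The edge found by [flow_inner_edge] depends on the vector only, so it lies in both supports and
    can be removed from both. *)
Lemma flow_inj m (w w' : 'I_m * 'I_m -> nat) :
    is_graph (supp w) -> alternating (supp w) -> noncrossing (supp w) ->
    is_graph (supp w') -> alternating (supp w') -> noncrossing (supp w') ->
    flow w =1 flow w' ->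
  w =1 w'.
Proof.
move: {2}(\sum_e w e)%N (erefl (\sum_e w e)%N) => k.
elim: k w w' => [|k IH] w w' wk gw aw nw gw' aw' nw' eqw.
  have w0 : w =1 fun=> 0%N.
    by move=> e; apply/eqP; move/eqP: wk; rewrite sum_nat_eq0 => /forallP/(_ e).
  move=> e; rewrite w0; apply/esym; move: e; apply: flow_inj_supp0 => // v.
  by rewrite -eqw; apply: big1 => e _; rewrite w0 mul0r.
have [e ew] : exists e, e \in supp w.
  have [/existsP[e ew]|] := boolP [exists e, 0 < w e]%N; first by exists e; rewrite inE.
  rewrite negb_exists => /forallP h; suff /eqP : (\sum_e w e)%N = 0%N by rewrite wk.
  by apply: big1 => e _; move: (h e); rewrite -eqn0Ngt => /eqP.
have [e1 e2] := flow_alternating gw aw ew.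
have [i [j [ij wi wj w0]]] := consecutive_signs (gw _ ew) e1 e2.
have ijw := flow_inner_edge gw aw nw ij wi wj w0.
have ijw' : (i, j) \in supp w'.
  apply: flow_inner_edge; rewrite -?eqw //.
  by move=> u iu uj; rewrite -eqw; exact: w0.
have : decr w (i, j) =1 decr w' (i, j).
  apply: IH.
  - by apply: succn_inj; rewrite -wk (sum_decr ijw).
  - exact: is_graph_sub (supp_decr _ _) gw.
  - exact: alternating_sub (supp_decr _ _) aw.
  - exact: noncrossing_sub (supp_decr _ _) nw.
  - exact: is_graph_sub (supp_decr _ _) gw'.
  - exact: alternating_sub (supp_decr _ _) aw'.
  - exact: noncrossing_sub (supp_decr _ _) nw'.
  - move=> v; apply: (addIr (rt int (i, j) v)).
    by rewrite -!flow_decr ?eqw.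
move=> dec e' ; have := dec e'; move: ijw ijw'; rewrite !inE /decr.
by have [->|ne] := eqVneq; lia.
Qed.

(** Telescoping: one unit along an increasing path has the same vector as one edge from its start to
    its end. The clause on edges starting before [i] ensures that the edge preceding the tail still
    has its unit once the tail has been treated. *)
Lemma flow_sub_path m (w : 'I_m * 'I_m -> nat) (i : 'I_m) s :
    is_graph (supp w) -> path (erel (supp w)) i s ->
  exists w' : 'I_m * 'I_m -> nat,
    [/\ supp w' \subset supp w,
        forall e : 'I_m * 'I_m, (e.1 < i)%N -> w' e = w e,
        forall v, flow w v = flow w' v + rt int (i, last i s) v &
        (\sum_e w e = \sum_e w' e + size s)%N].
Proof.
move=> gw; elim: s i => [|y s IH] i /=.
  move=> _; exists w; split=> // [v|]; last by rewrite addn0.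
  by rewrite /rt subrr addr0.
case/andP=> iy /IH[w' [sw lw fw szw]].
have iy' := gw _ iy; have iyw : (i, y) \in supp w'.
  by rewrite inE lw //; move: iy; rewrite /erel inE.
exists (decr w' (i, y)); split.
- exact: fintype.subset_trans (supp_decr _ _) sw.
- move=> e ei; rewrite /decr; case: eqP => [h|_]; first by move: ei; rewrite h ltnn.
  by rewrite subn0 lw // (ltn_trans ei).
- move=> v; rewrite fw (flow_decr _ iyw) -addrA; congr (_ + _).
  by rewrite /rt /= addrA subrK.
- by rewrite szw (sum_decr iyw) addnS addSn.
Qed.

(** No edge of the support leaves the set of vertices reachable from [i], so the entries there sum
    to at most 0. *)
Lemma flow_reach_sink m (w : 'I_m * 'I_m -> nat) (i : 'I_m) :
  0 < flow w i -> exists2 k, connect (erel (supp w)) i k & flow w k < 0.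
Proof.
move=> wi; pose S := [set v | connect (erel (supp w)) i v].
have [/existsP[k /andP[]]|no] :=
  boolP [exists k, (k \in S) && (flow w k < 0)]; first by rewrite inE; exists k.
have : 0 < \sum_(v in S) flow w v.
  rewrite (bigD1 i) ?inE ?connect0 //=; apply: ltr_pwDl => //.
  apply: sumr_ge0 => v /andP[vS _]; rewrite leNgt; apply: contra no => wv.
  by apply/existsP; exists v; rewrite vS.
rewrite sum_flow ltNge => /negP[]; apply: sumr_le0 => e _.
have [ew|] := boolP (e \in supp w); last first.
  by rewrite inE -eqn0Ngt => /eqP ->; rewrite mul0r.
rewrite mulr_ge0_le0 // subr_le0 ler_nat.
suff : e.1 \in S -> e.2 \in S by case: (e.1 \in S) => // ->.
rewrite !inE => h; apply: connect_trans h _; apply: connect1.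
by rewrite /erel -surjective_pairing.
Qed.

Lemma flow_reach_source m (w : 'I_m * 'I_m -> nat) (j : 'I_m) :
  flow w j < 0 -> exists2 h, connect (erel (supp w)) h j & 0 < flow w h.
Proof.
move=> wj; pose S := [set v | connect (erel (supp w)) v j].
have [/existsP[k /andP[]]|no] :=
  boolP [exists k, (k \in S) && (0 < flow w k)]; first by rewrite inE; exists k.
have : 0 < - \sum_(v in S) flow w v.
  rewrite -sumrN (bigD1 j) ?inE ?connect0 //=; apply: ltr_pwDl.
    by rewrite oppr_gt0.
  apply: sumr_ge0 => v /andP[vS _]; rewrite oppr_ge0 leNgt; apply: contra no => wv.
  by apply/existsP; exists v; rewrite vS.
rewrite oppr_gt0 sum_flow ltNge => /negP[]; apply: sumr_ge0 => e _.
have [ew|] := boolP (e \in supp w); last first.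
  by rewrite inE -eqn0Ngt => /eqP ->; rewrite mul0r.
rewrite mulr_ge0 // subr_ge0 ler_nat.
suff : e.2 \in S -> e.1 \in S by case: (e.2 \in S) => // ->.
rewrite !inE => h; apply: connect_trans h; apply: connect1.
by rewrite /erel -surjective_pairing.
Qed.

(** Induction on the total weight. For a positive entry [i] and the next negative entry [j],
    [connect_meet] gives a path from [i] to [j] in the support; one unit is taken off it, the
    remainder is represented by induction, and the edge [(i, j)] is added back. *)
Lemma flow_noncrossing_alternating m (T : {set 'I_m * 'I_m})
    (c : 'I_m * 'I_m -> nat) :
    is_graph T -> noncrossing T -> supp c \subset T ->
  exists w : 'I_m * 'I_m -> nat,
    [/\ supp w \subset tclosure T, noncrossing (supp w), alternating (supp w) &
        flow w =1 flow c].
Proof.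
move=> gT nT.
have [k] := ubnP (\sum_e c e)%N; elim: k c => // k IH c ck sc.
have gc := is_graph_sub sc gT; have nc := noncrossing_sub sc nT.
have [/forallP c0|] := boolP [forall v, flow c v == 0].
  have e0 : supp (fun _ : 'I_m * 'I_m => 0%N) = finset.set0.
    by apply/setP => e; rewrite !inE.
  exists (fun=> 0%N); rewrite e0; split; first exact: sub0set.
  - by move=> ? ? ? ? _ _ _ []; rewrite inE.
  - by move=> ? ? ? _ _ []; rewrite inE.
  - by move=> v; rewrite (eqP (c0 v)) /flow big1 // => e _; rewrite mul0r.
rewrite negb_forall => /existsP[v0 cv0].
have [a [b [ab ca cb]]] : exists a b : 'I_m, [/\ (a < b)%N, 0 < flow c a & flow c b < 0].
  have [cv|cv] : 0 < flow c v0 \/ flow c v0 < 0.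
    by move: cv0; rewrite neq_lt => /orP[]; [right|left].
    have [k' ck' wk'] := flow_reach_sink cv; exists v0, k'; split=> //.
    have := connect_arc_le gc ck'; rewrite leq_eqVlt => /orP[/eqP/val_inj e|//].
    by move: cv; rewrite e ltNge (ltW wk').
  have [k' ck' wk'] := flow_reach_source cv; exists k', v0; split=> //.
  have := connect_arc_le gc ck'; rewrite leq_eqVlt => /orP[/eqP/val_inj e|//].
  by move: wk'; rewrite e ltNge (ltW cv).
have [i [j [ij ci cj c0]]] := consecutive_signs ab ca cb.
have [l cil wl] := flow_reach_sink ci; have [h chj wh] := flow_reach_source cj.
have il := connect_arc_le gc cil; have hj := connect_arc_le gc chj.
have jl : (j <= l)%N.
  rewrite leqNgt; apply/negP => lj; move: il; rewrite leq_eqVlt => /orP[/eqP/val_inj e|il].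
    by move: wl; rewrite -e ltNge (ltW ci).
  by move: wl; rewrite c0.
have hi : (h <= i)%N.
  rewrite leqNgt; apply/negP => lj; move: hj; rewrite leq_eqVlt => /orP[/eqP/val_inj e|il'].
    by move: wh; rewrite e ltNge (ltW cj).
  by move: wh; rewrite c0.
have cij := connect_meet gc nc hi ij jl cil chj.
have [s ps ls] := connectP cij.
have [c' [sc' _ fc' szc]] := flow_sub_path gc ps.
rewrite -ls in fc'.
have s0 : (0 < size s)%N by case: s ls {ps szc} => //= e; move: ij; rewrite e ltnn.
have [||w [sw nw aw fw]] := IH c'.
- rewrite -ltnS; apply: leq_trans ck; rewrite szc; case: (size s) s0 => // k1 _.
  by rewrite addnS !ltnS leq_addr.
- exact: fintype.subset_trans sc' sc.
have gw := is_graph_sub sw (@is_graph_tclosure _ _).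
have ijne : i != j by apply/eqP => e; move: ij; rewrite e ltnn.
have fwu u : flow w u = flow c u - rt int (i, j) u by rewrite fw fc' addrK.
(* By [flow_alternating], edges of [w] start at positive and end at negative entries. Zeros strictly
   between [i] and [j] therefore exclude edges crossing [(i, j)], and the signs at [i] and [j] keep
   the support alternating. *)
have fw0 (u : 'I_m) : (i < u)%N -> (u < j)%N -> flow w u = 0.
  move=> iu uj; rewrite fwu c0 // /rt /=.
  have /negPf -> : u != i by apply/eqP => e; move: iu; rewrite e ltnn.
  have /negPf -> : u != j by apply/eqP => e; move: uj; rewrite e ltnn.
  by rewrite subrr.
have fwi : 0 <= flow w i.
  by rewrite fwu /rt /= eqxx (negPf ijne) subr0 subr_ge0 -gtz0_ge1.
have fwj : flow w j <= 0.
  rewrite fwu /rt /= eqxx [j == i]eq_sym (negPf ijne) sub0r opprK -[1%:R]/(1 : int).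
  by lia.
pose w' e := (w e + (e == (i, j)))%N.
have sw' : supp w' = (i, j) |: supp w.
  by apply/setP => e; rewrite !inE /w'; case: eqVneq => _; lia.
exists w'; rewrite sw'; split.
- apply/subsetP => e; rewrite in_setU1 => /orP[/eqP ->|]; last exact: (subsetP sw).
  by rewrite mem_tclosure ij /=; apply: connect_arc_sub cij.
- move=> p q r t pq qr rt' []; rewrite !in_setU1.
  case/orP=> [/eqP[ep er]|prw]; case/orP=> [/eqP[eq et]|qtw].
  + by subst; move: pq; rewrite ltnn.
  + subst p r; have [/= h0 _] := flow_alternating gw aw qtw.
    by move: h0; rewrite fw0 ?ltxx //; lia.
  + subst q t; have [/= _ h0] := flow_alternating gw aw prw.
    by move: h0; rewrite fw0 ?ltxx //; lia.
  + exact: (nw p q r t).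
- move=> p q r pq qr []; rewrite !in_setU1.
  case/orP=> [/eqP[ep er]|prw]; case/orP=> [/eqP[eq et]|qtw].
  + by move: ij; rewrite -er -eq ltnn.
  + subst p q; have [/= h0 _] := flow_alternating gw aw qtw.
    by move: (lt_le_trans h0 fwj); rewrite ltxx.
  + subst q r; have [/= _ h0] := flow_alternating gw aw prw.
    by move: (le_lt_trans fwi h0); rewrite ltxx.
  + exact: (aw p q r).
- move=> v; rewrite fc' -fw (@flow_decr _ w' (i, j)); last by rewrite sw' setU11.
  congr (_ + _); apply: eq_bigr => e _; congr (_%:R * _).
  by rewrite /decr /w' addnK.
Qed.

(** * Coordinates with respect to a spanning tree *)

Lemma root_comb_connect (R : pzRingType) m (E : {set 'I_m * 'I_m}) x y :
  connect (adj E) x y ->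
  exists a : 'I_m * 'I_m -> R, forall v,
    (v == x)%:R - (v == y)%:R = \sum_(e in E) a e * rt R e v.
Proof.
have step e (s : R) : e \in E -> forall v,
    \sum_(f in E) (if f == e then s else 0) * rt R f v = s * rt R e v.
  move=> eE v; rewrite (bigD1 e) //= eqxx big1 ?addr0 //.
  by move=> f /andP[_ /negPf ->]; rewrite mul0r.
move=> /connectP[s]; elim: s x => [|z s IH] x /=.
  move=> _ ->; exists (fun=> 0) => v; rewrite subrr big1 // => e _.
  by rewrite mul0r.
case/andP=> xz ps /(IH _ ps)[a ha].
have [e [t [eE et]]] : exists e t, e \in E /\
    forall v, t * rt R e v = (v == x)%:R - (v == z)%:R.
  case/orP: xz => xz; first by exists (x, z), 1; split=> // v; rewrite mul1r.
  by exists (z, x), (-1); split=> // v; rewrite mulN1r opprB.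
exists (fun f => (if f == e then t else 0) + a f) => v.
under eq_bigr do rewrite mulrDl.
by rewrite big_split /= step // et -ha addrA subrK.
Qed.

Lemma root_comb_zero_sum (R : pzRingType) m (E : {set 'I_m * 'I_m})
    (z : 'I_m -> R) : connected E -> \sum_v z v = 0 ->
  exists a : 'I_m * 'I_m -> R, forall v, z v = \sum_(e in E) a e * rt R e v.
Proof.
move=> cE z0; case: m E z cE z0 => [|m] E z cE z0.
  by exists (fun=> 0) => -[].
have /fin_all_exists[a ha] : forall x : 'I_m.+1, exists a : 'I_m.+1 * 'I_m.+1 -> R,
    forall v, (v == x)%:R - (v == ord0)%:R = \sum_(e in E) a e * rt R e v.
  by move=> x; apply: root_comb_connect.
exists (fun e => \sum_x z x * a x e) => v.
under eq_bigr do rewrite mulr_suml; rewrite exchange_big /=.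
under eq_bigr => x _.
  under eq_bigr do rewrite -mulrA; rewrite -mulr_sumr -ha mulrBr; over.
rewrite big_split /= sumrN -mulr_suml z0 mul0r subr0 (bigD1 v) //= eqxx mulr1.
by rewrite big1 ?addr0 // => x /negPf; rewrite eq_sym => ->; rewrite mulr0.
Qed.

(** For [z] of sum 0 and a tree [E], the coefficient of [e] in the expansion of [z] in root vectors
    of [E]; see [tree_coord]. *)
Definition csum (R : pzRingType) m (E : {set 'I_m * 'I_m}) e (z : 'I_m -> R) :=
  \sum_(v in cut_side E e) z v.

Lemma tree_coord (R : pzRingType) m (E : {set 'I_m * 'I_m}) (z : 'I_m -> R) :
    forest E -> connected E -> \sum_v z v = 0 ->
  forall v, z v = \sum_(e in E) csum E e z * rt R e v.
Proof.
move=> fE cE /(root_comb_zero_sum cE)[a ha] v; rewrite ha.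
apply: eq_bigr => e eE; congr (_ * _); rewrite -(sum_comb_cut a fE eE).
by apply: eq_bigr => u _; rewrite ha.
Qed.

Lemma csum_comb (R : pzRingType) m (E : {set 'I_m * 'I_m}) e
    (z : 'I_m -> R) (a : 'I_m * 'I_m -> R) :
    forest E -> e \in E -> (forall v, z v = \sum_(f in E) a f * rt R f v) ->
  csum E e z = a e.
Proof.
move=> fE eE za; rewrite -(sum_comb_cut a fE eE).
by apply: eq_bigr => u _; rewrite za.
Qed.

(** The root vectors of [E] are independent, the cut sides being dual to them, and by [tree_coord]
    they span the vectors of sum 0, a space of dimension [n]. *)
Lemma card_tree n (E : {set 'I_n.+1 * 'I_n.+1}) :
  forest E -> connected E -> #|E| = n.
Proof.
move=> fE cE.
pose B : 'M[rat]_(#|E|, n.+1) := \matrix_(i, j) rt rat (enum_val i) j.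
pose C : 'M[rat]_(n.+1, #|E|) :=
  \matrix_(j, i) (j \in cut_side E (enum_val i))%:R.
have BC : B *m C = 1%:M.
  apply/matrixP => i k; rewrite !mxE.
  have -> : \sum_j B i j * C j k = \sum_(v in cut_side E (enum_val k)) rt rat (enum_val i) v.
    rewrite [RHS]big_mkcond; apply: eq_bigr => j _; rewrite !mxE.
    by case: (j \in _); rewrite ?mulr1 ?mulr0.
  rewrite sum_rt (cut_sideE fE (enum_valP _) (enum_valP _)).
  have [/enum_val_inj ->|ne] := eqVneq (enum_val i) (enum_val k).
    by rewrite eqxx (negPf (cut_side2 fE (enum_valP _))) subr0.
  have /negPf -> : i != k by apply: contraNneq ne => ->.
  by rewrite /= subrr.
have rB : \rank B = #|E| by apply/eqP; apply/row_freeP; exists C.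
pose o : 'cV[rat]_n.+1 := const_mx 1.
have ro : \rank o = 1%N.
  apply/eqP; rewrite eqn_leq rank_leq_col lt0n mxrank_eq0.
  by apply/negP => /eqP/matrixP/(_ ord0 ord0); rewrite !mxE => /eqP; rewrite oner_eq0.
have subB (r : 'rV[rat]_n.+1) : r *m o = 0 -> (r <= B)%MS.
  move=> ro0; have r0 : \sum_v r ord0 v = 0.
    move/matrixP/(_ ord0 ord0): ro0; rewrite mxE [in RHS]mxE => h; rewrite -[RHS]h.
    by apply: eq_bigr => v _; rewrite [o _ _]mxE mulr1.
  have -> : r = r *m C *m B; last exact: submxMl.
  apply/rowP => v; rewrite (tree_coord fE cE r0 v) mxE big_enum_val /=.
  apply: eq_bigr => k _; rewrite [B _ _]mxE mxE; congr (_ * _).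
  rewrite /csum big_mkcond; apply: eq_bigr => u _; rewrite [C _ _]mxE.
  by case: (_ \in _); rewrite ?mulr1 ?mulr0.
rewrite -rB; have -> : \rank B = \rank (kermx o).
  apply: eqmx_rank; apply/andP; split.
    apply/sub_kermxP/matrixP => i j; rewrite mxE [RHS]mxE.
    under eq_bigr do rewrite [o _ _]mxE mulr1 mxE.
    transitivity (\sum_(v in [set: 'I_n.+1]) rt rat (enum_val i) v).
      by apply: eq_bigl => v; rewrite inE.
    by rewrite sum_rt !inE subrr.
  apply/row_subP => i; apply: subB.
  by rewrite -row_mul mulmx_ker row0.
by rewrite mxrank_ker ro subn1.
Qed.

Lemma cut_side1 m (E : {set 'I_m * 'I_m}) e : e.1 \in cut_side E e.
Proof. by rewrite inE connect0. Qed.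

Lemma cut_side_connect m (T : {set 'I_m * 'I_m}) e x y :
    forest T -> e \in T -> connect (erel T) x y -> y \in cut_side T e ->
  x \in cut_side T e.
Proof.
move=> fT eT /connectP[s]; elim: s x => [|z s IH] x /=; first by move=> _ ->.
case/andP=> xz ps ls yS; rewrite (cut_sideE fT eT xz) /=.
by rewrite (IH z) ?orbT.
Qed.

(** A directed path can leave the cut side along [e] only, and never returns. *)
Lemma cut_side_cover m (T : {set 'I_m * 'I_m}) e x y :
    forest T -> e \in T -> connect (erel T) x y ->
  (x \in cut_side T e) && (y \notin cut_side T e) =
  connect (erel T) x e.1 && connect (erel T) e.2 y.
Proof.
move=> fT eT cxy; apply/andP/andP => -[xS yS]; last first.
  split; first exact: cut_side_connect xS (cut_side1 _ _).
  by apply/negP => /(cut_side_connect fT eT yS); apply/negP/cut_side2.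
have [s ps ls] := connectP cxy; elim: s x ps ls xS {cxy} => [|z s IH] x /=.
  by move=> _ <- xS; rewrite xS in yS.
case/andP=> xz ps ls; rewrite (cut_sideE fT eT xz) => /orP[/eqP <-|/=].
  by split; [exact: connect0|apply/connectP; exists s].
move=> zS; have [c1 c2] := IH z ps ls zS; split=> //.
by apply: connect_trans c1; apply: connect1.
Qed.

Lemma csum_root_ge0 m (T : {set 'I_m * 'I_m}) e f :
  forest T -> e \in T -> f \in tclosure T -> 0 <= csum T e (rt int f).
Proof.
move=> fT eT /tclosure_connect cf; rewrite /csum sum_rt subr_ge0 ler_nat.
have := cut_side_connect fT eT cf; case: (f.2 \in _) => // -> //.
Qed.

(** The link between [covers] and cones: the root of [f] is the sum of the roots of the edges on the
    path of [T] underlying [f]. *)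
Lemma csum_root_gt0 m (T : {set 'I_m * 'I_m}) e f :
    forest T -> e \in T -> f \in tclosure T ->
  (0 < csum T e (rt int f)) = connect (erel T) f.1 e.1 && connect (erel T) e.2 f.2.
Proof.
move=> fT eT /tclosure_connect cf; rewrite /csum sum_rt subr_gt0 ltr_nat.
rewrite -(cut_side_cover fT eT cf).
by case: (f.1 \in _); case: (f.2 \in _).
Qed.

Lemma csum_linear m (T : {set 'I_m * 'I_m}) e (A : {pred 'I_m * 'I_m})
    (a : 'I_m * 'I_m -> int) (z : 'I_m -> int) :
    (forall v, z v = \sum_(f in A) a f * rt int f v) ->
  csum T e z = \sum_(f in A) a f * csum T e (rt int f).
Proof.
move=> za; rewrite /csum; under eq_bigr do rewrite za.
by rewrite exchange_big; apply: eq_bigr => f _; rewrite mulr_sumr.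
Qed.

(** Inequalities suffice because the cone of a tree is simplicial. *)
Definition in_cone m (T : {set 'I_m * 'I_m}) (z : 'I_m -> int) : Prop :=
  \sum_v z v = 0 /\ forall e, e \in T -> 0 <= csum T e z.

Lemma root_sum0 (R : pzRingType) m (A : {pred 'I_m * 'I_m}) (a : 'I_m * 'I_m -> R) :
  \sum_v \sum_(f in A) a f * rt R f v = 0.
Proof.
transitivity (\sum_(v in [set: 'I_m]) \sum_(f in A) a f * rt R f v).
  by apply: eq_bigl => v; rewrite inE.
rewrite sum_comb big1 // => f _; by rewrite !inE subrr mulr0.
Qed.

Lemma comb_in_cone m (T A : {set 'I_m * 'I_m})
    (a : 'I_m * 'I_m -> int) (z : 'I_m -> int) :
    forest T -> A \subset tclosure T -> (forall f, f \in A -> 0 <= a f) ->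
    (forall v, z v = \sum_(f in A) a f * rt int f v) ->
  in_cone T z.
Proof.
move=> fT sA a0 za; split; first by under eq_bigr do rewrite za; exact: root_sum0.
move=> e eT; rewrite (csum_linear _ _ za); apply: sumr_ge0 => f fA.
by rewrite mulr_ge0 ?a0 // csum_root_ge0 // (subsetP sA).
Qed.

Definition wt m (G : {set 'I_m * 'I_m}) (a : 'I_m * 'I_m -> int) :
  'I_m * 'I_m -> nat := fun e => if e \in G then `|a e|%N else 0%N.

Lemma flow_wt m (G : {set 'I_m * 'I_m}) (a : 'I_m * 'I_m -> int) v :
    (forall g, g \in G -> 0 <= a g) ->
  flow (wt G a) v = \sum_(g in G) a g * rt int g v.
Proof.
move=> a0; rewrite /flow [RHS]big_mkcond; apply: eq_bigr => e _.
rewrite /wt; case: ifP => [/a0 h|_]; last by rewrite mul0r.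
by rewrite natz gez0_abs.
Qed.

Lemma supp_wt m (G : {set 'I_m * 'I_m}) (a : 'I_m * 'I_m -> int) :
  supp (wt G a) \subset G.
Proof. by apply/subsetP => e; rewrite inE /wt; case: ifP. Qed.

Lemma supp_wt_pos m (G : {set 'I_m * 'I_m}) (a : 'I_m * 'I_m -> int) :
  (forall g, g \in G -> 0 < a g) -> supp (wt G a) = G.
Proof.
move=> a0; apply/setP => e; rewrite inE /wt.
by have [/a0|//] := boolP (e \in G); rewrite absz_gt0 lt0r => /andP[].
Qed.

Lemma comb_face_inj m (T A B : {set 'I_m * 'I_m}) (a b : 'I_m * 'I_m -> int) :
    face T A -> face T B ->
    (forall f, f \in A -> 0 <= a f) -> (forall f, f \in B -> 0 <= b f) ->
    (forall v, \sum_(f in A) a f * rt int f v = \sum_(f in B) b f * rt int f v) ->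
  wt A a =1 wt B b.
Proof.
move=> fA fB a0 b0 ab.
have fA' := face_sub (supp_wt A a) fA; have fB' := face_sub (supp_wt B b) fB.
have [_ nA aA] := fA'; have [_ nB aB] := fB'.
apply: flow_inj => //; [exact: face_graph fA'|exact: face_graph fB'|].
by move=> v; rewrite !flow_wt.
Qed.

(** * Generic vectors and half-open cones *)

Definition generic m (z : 'I_m -> int) : Prop :=
  forall S : {set 'I_m}, S != finset.set0 -> S != [set: 'I_m] ->
  \sum_(v in S) z v != 0.

(** If the support of the representation of [z] were disconnected, the entries of [z] over one of
    its components would sum to 0. *)
Lemma facet_exists m (T : {set 'I_m * 'I_m}) (z : 'I_m -> int) :
    nctree T -> in_cone T z -> generic z ->
  exists2 G, facet T G & forall g, g \in G -> 0 < csum G g z.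
Proof.
move=> [fT nT cT] [z0 zT] gz; have [gT _] := fT.
have zE := tree_coord fT cT z0.
have [w [sw nw aw fw]] := flow_noncrossing_alternating gT nT (supp_wt T (csum T ^~ z)).
have fE v : z v = \sum_(e in supp w) (w e)%:R * rt int e v.
  rewrite zE -flow_wt // -fw /flow [RHS]big_mkcond; apply: eq_bigr => e _.
  by case: ifP => //; rewrite inE; case: (w e) => // _; rewrite mul0r.
have fW : face T (supp w) by [].
have foW := face_forest fW.
have cw : connected (supp w).
  move=> x y; apply/negPn/negP => nxy.
  pose S := [set v | connect (adj (supp w)) x v].
  have xS : x \in S by rewrite inE connect0.
  have /negP[] : \sum_(v in S) z v != 0.
    apply: gz; first by apply/set0Pn; exists x.
    by apply/eqP => /setP/(_ y); rewrite !inE (negPf nxy).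
  under eq_bigr do rewrite fE.
  rewrite sum_comb; apply/eqP; apply: big1 => e ew.
  have -> : (e.1 \in S) = (e.2 \in S).
    rewrite !inE; apply: (same_connect_r (@adj_connect_sym _ _)).
    by apply: connect1; rewrite /adj -surjective_pairing ew.
  by rewrite subrr mulr0.
exists (supp w) => // g gw.
rewrite (csum_comb foW gw fE) ltr0n; by rewrite inE in gw.
Qed.

Lemma facet_unique m (T G G' : {set 'I_m * 'I_m}) (z : 'I_m -> int) :
    \sum_v z v = 0 -> facet T G -> facet T G' ->
    (forall g, g \in G -> 0 < csum G g z) ->
    (forall g, g \in G' -> 0 < csum G' g z) ->
  G = G'.
Proof.
move=> z0 [fG cG] [fG' cG'] pG pG'.
rewrite -(supp_wt_pos pG) -(supp_wt_pos pG').
have h : wt G (csum G ^~ z) =1 wt G' (csum G' ^~ z).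
  apply: (comb_face_inj fG fG').
  - by move=> f /pG/ltW.
  - by move=> f /pG'/ltW.
  - by move=> v; rewrite -!tree_coord //; [exact: face_forest fG'|exact: face_forest fG].
by apply/setP => e; rewrite !inE h.
Qed.

Lemma generic_exists n (T : {set 'I_n.+1 * 'I_n.+1}) : nctree T ->
  exists q : 'I_n.+1 -> int, [/\ \sum_v q v = 0,
    forall e, e \in T -> 0 < csum T e q & generic q].
Proof.
move=> [fT nT cT].
pose w v := \sum_(e in T) 1 * rt int e v.
(* Modulo n + 1 all entries of q are 1, so q sums to #|S| over S. *)
pose q v : int := n.+1%:R * w v + (1 - n.+1%:R * (v == ord_max)%:R).
have qS (S : {set 'I_n.+1}) : \sum_(v in S) q v =
    n.+1%:R * (\sum_(v in S) w v - (ord_max \in S)%:R) + #|S|%:R.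
  rewrite /q big_split /= -mulr_sumr big_split /= sumrN -mulr_sumr sum_indic.
  by rewrite sumr_const mulrBr addrAC -addrA.
have w0 : \sum_v w v = 0 by exact: root_sum0.
have setTE (f : 'I_n.+1 -> int) : \sum_(v in [set: 'I_n.+1]) f v = \sum_v f v.
  by apply: eq_bigl => v; rewrite inE.
exists q; split.
- by rewrite -setTE qS setTE w0 inE cardsT card_ord sub0r mulrN mulr1 addNr.
- move=> e eT; rewrite /csum qS.
  rewrite (sum_comb_cut (fun=> 1) fT eT).
  apply: ltr_wpDl; first by rewrite mulr_ge0 // subr_ge0; case: (_ \in _).
  by rewrite ltr0n card_gt0; apply/set0Pn; exists e.1; apply: cut_side1.
- move=> S S0 ST; rewrite qS; set k := _ - _.
  have S0' : (0 < #|S|)%N by rewrite card_gt0.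
  have Sn : (#|S| < n.+1)%N.
    have : (#|S| < #|[set: 'I_n.+1]|)%N by rewrite proper_card // properT.
    by rewrite cardsT card_ord.
  apply/eqP => h; have : (`|k| * n.+1 = #|S|)%N.
    have {}h : n.+1%:R * k = - #|S|%:R by apply/eqP; rewrite -addr_eq0; apply/eqP.
    have := congr1 absz h; rewrite abszN abszM !natz /= mulnC => <- //.
  by case: (absz k) => [|k']; lia.
Qed.

Lemma abs_sum_lt m (q : 'I_m -> int) (S : {set 'I_m}) :
  `|\sum_(v in S) q v| < 1 + \sum_v `|q v|.
Proof.
rewrite addrC ltzD1; apply: le_trans (ler_norm_sum _ _ _) _.
rewrite [leRHS](bigID (mem S)) /= lerDl.
by apply: sumr_ge0.
Qed.

(** * Counting lattice points *)

(** The sign is that of [a], and that of [b] when [a = 0]. *)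
Lemma mulDr_small_gt0 (M a b : int) :
  b != 0 -> `|b| < M -> (0 < M * a + b) = ((b < 0)%R%:R <= a).
Proof.
move=> b0 bM; have M0 : 0 < M by apply: le_lt_trans bM.
have {}bM : - M < b < M by rewrite -ltr_norml.
case: (ltrP b 0) => bs; apply/idP/idP => h; rewrite ?mulr0n ?mulr1n in h *; nia.
Qed.

Lemma cut_side_generic m (G : {set 'I_m * 'I_m}) (q : 'I_m -> int) g :
  generic q -> forest G -> g \in G -> csum G g q != 0.
Proof.
move=> gq fG gG; apply: gq.
  by apply/set0Pn; exists g.1; apply: cut_side1.
by apply/eqP => h; have := cut_side2 fG gG; rewrite h inE.
Qed.

Lemma csum_perturb m (G : {set 'I_m * 'I_m}) g (z q : 'I_m -> int) M :
  csum G g (fun v => M * z v + q v) = M * csum G g z + csum G g q.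
Proof. by rewrite /csum big_split /= mulr_sumr. Qed.

Definition bound m (q : 'I_m -> int) : int := 1 + \sum_v `|q v|.

(** Membership in a half-open cone of [G]: the walls that separate the cone from [q] are removed. *)
Definition fits m (q z : 'I_m -> int) (G : {set 'I_m * 'I_m}) : Prop :=
  forall g, g \in G -> (csum G g q < 0)%R%:R <= csum G g z.

Lemma fits_perturb m (T G : {set 'I_m * 'I_m}) (q z : 'I_m -> int) :
  generic q -> facet T G ->
  (fits q z G <-> forall g, g \in G -> 0 < csum G g (fun v => bound q * z v + q v)).
Proof.
move=> gq [/face_forest fG _].
have h g : g \in G -> (0 < csum G g (fun v => bound q * z v + q v)) =
    ((csum G g q < 0)%R%:R <= csum G g z).
  move=> gG; rewrite csum_perturb mulDr_small_gt0 ?cut_side_generic //.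
  exact: abs_sum_lt.
by split=> H g gG; have := H g gG; rewrite h.
Qed.

Lemma fits_exists m (T : {set 'I_m * 'I_m}) (q z : 'I_m -> int) :
    nctree T -> generic q -> \sum_v z v = 0 ->
    in_cone T (fun v => bound q * z v + q v) ->
  exists2 G, facet T G & fits q z G.
Proof.
move=> tT gq z0 cz; have [|G fG h] := facet_exists tT cz.
  (* A vanishing sum of the perturbed vector would make the sum of [q] over [S] a multiple of
     [bound q], hence 0 by its size, against genericity. *)
  move=> S S0 ST; rewrite big_split /= -mulr_sumr addr_eq0.
  have qS := gq S S0 ST; have qM := abs_sum_lt q S; rewrite -/(bound q) in qM.
  apply: contra_ltN qM => /eqP e; rewrite -normrN -e normrM.
  have b0 : 0 < bound q by rewrite /bound; apply: ltr_pwDl => //; apply: sumr_ge0.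
  rewrite (gtr0_norm b0) ler_peMr ?(ltW b0) // -gtz0_ge1 normr_gt0.
  by apply: contraNneq qS => e0; move/eqP: e; rewrite e0 mulr0 eq_sym oppr_eq0.
by exists G => //; apply/(fits_perturb z gq fG).
Qed.

Lemma fits_unique m (T G G' : {set 'I_m * 'I_m}) (q z : 'I_m -> int) :
    generic q -> \sum_v q v = 0 -> \sum_v z v = 0 -> facet T G -> facet T G' ->
  fits q z G -> fits q z G' -> G = G'.
Proof.
move=> gq q0 z0 fG fG' /(fits_perturb z gq fG) h /(fits_perturb z gq fG') h'.
apply: (facet_unique _ fG fG' h h').
by rewrite big_split /= -mulr_sumr z0 q0 mulr0 addr0.
Qed.

Definition pos_edges m (q : 'I_m -> int) (G : {set 'I_m * 'I_m}) :=
  [set g in G | 0 < csum G g q].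

Definition neg_edges m (q : 'I_m -> int) (G : {set 'I_m * 'I_m}) :=
  [set g in G | csum G g q < 0].

Lemma csum_opp m (G : {set 'I_m * 'I_m}) g (q : 'I_m -> int) :
  csum G g (fun v => - q v) = - csum G g q.
Proof. by rewrite /csum sumrN. Qed.

Lemma generic_opp m (q : 'I_m -> int) : generic q -> generic (fun v => - q v).
Proof. by move=> gq S S0 ST; rewrite sumrN oppr_eq0 gq. Qed.

Definition indicator_vec m (F : {set 'I_m * 'I_m}) (v : 'I_m) : int :=
  \sum_(f in F) 1 * rt int f v.

Lemma csum_indicator m (G F : {set 'I_m * 'I_m}) g :
  forest G -> F \subset G -> g \in G -> csum G g (indicator_vec F) = (g \in F)%:R.
Proof.
move=> fG sF gG; apply: (@csum_comb _ _ _ _ _ (fun e => (e \in F)%:R)) => // v.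
rewrite /indicator_vec big_mkcond [RHS]big_mkcond; apply: eq_bigr => e _.
have [eF|eF] := boolP (e \in F); first by rewrite (subsetP sF).
by rewrite mul0r if_same.
Qed.

(** Once the indicator vector has nonnegative coordinates in [G], uniqueness of representations puts
    [F] inside [G]. The coordinates are then 0 or 1, and those required to be strict, at the
    positive edges for [q], are 1. *)
Lemma fits_indicator m (T F G : {set 'I_m * 'I_m}) (q : 'I_m -> int) :
    face T F -> facet T G ->
  fits (fun v => - q v) (indicator_vec F) G <->
  pos_edges q G \subset F /\ F \subset G.
Proof.
move=> fF fG; have [faG cG] := fG; have foG := face_forest faG; split; last first.
  move=> [pF sF] g gG; rewrite csum_indicator // csum_opp oppr_lt0 ler_nat.
  have := subsetP pF g; rewrite inE gG /=.
  by case: (0 < _) => // ->.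
move=> fit; have c0 g : g \in G -> 0 <= csum G g (indicator_vec F).
  by move=> /fit; apply: le_trans.
have eqw : wt F (fun=> 1) =1 wt G (csum G ^~ (indicator_vec F)).
  apply: (comb_face_inj fF faG) => // v.
  by apply: (tree_coord (z := indicator_vec F)) => //; exact: root_sum0.
have sF : F \subset G.
  apply/subsetP => f fF'; have := eqw f; rewrite /wt fF'.
  by case: (f \in G).
split=> //; apply/subsetP => g; rewrite inE => /andP[gG gq].
have := fit g gG; rewrite csum_opp oppr_lt0 gq csum_indicator //.
by case: (g \in F).
Qed.

(** Covering makes every coordinate of the indicator vector on [T] at least 1, so [bound q] times
    this vector stays in the cone after [q] is subtracted. *)
Lemma covers_fits m (T F : {set 'I_m * 'I_m}) (q : 'I_m -> int) :
    nctree T -> generic q -> \sum_v q v = 0 -> face T F -> covers T F ->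
  exists2 G, facet T G & fits (fun v => - q v) (indicator_vec F) G.
Proof.
move=> tT gq q0 fF cF; have [fT _ _] := tT; have [sF _ _] := fF.
apply: fits_exists => //; [exact: generic_opp|exact: root_sum0|].
split; first by rewrite big_split /= -mulr_sumr root_sum0 mulr0 sumrN q0 subr0.
move=> e eT; rewrite csum_perturb csum_opp subr_ge0.
have -> : bound (fun v => - q v) = bound q.
  by rewrite /bound; congr (_ + _); apply: eq_bigr => v _; rewrite normrN.
have c1 : 1 <= csum T e (indicator_vec F).
  have [f [fF' cf1 cf2]] := cF e eT.
  have pf : 0 < csum T e (rt int f).
    by rewrite csum_root_gt0 ?cf1 ?cf2 // (subsetP sF).
  rewrite (csum_linear _ _ (fun v => erefl)) (bigD1 f) //= mul1r.
  rewrite -gtz0_ge1; apply: ltr_pwDl => //; apply: sumr_ge0 => g /andP[gF _].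
  by rewrite mul1r csum_root_ge0 // (subsetP sF).
have b1 : csum T e q < bound q by apply: le_lt_trans (abs_sum_lt q _); apply: ler_norm.
have b0 : 0 <= bound q by rewrite /bound addr_ge0 // sumr_ge0.
by apply: le_trans (ltW b1) _; rewrite ler_peMr.
Qed.

(** Expand [q] in [G] and take its coordinate at [e]: it is positive, so some edge of [G] with a
    positive coefficient covers [e]. *)
Lemma pos_edges_covers m (T F G : {set 'I_m * 'I_m}) (q : 'I_m -> int) :
    nctree T -> \sum_v q v = 0 -> (forall e, e \in T -> 0 < csum T e q) ->
    facet T G -> pos_edges q G \subset F ->
  covers T F.
Proof.
move=> [fT _ _] q0 qT [faG cG] pF e eT; have [sG _ _] := faG.
have foG := face_forest faG.
have qE := tree_coord foG cG q0.
have := qT e eT; rewrite (csum_linear _ _ qE) => pe.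
have [/existsP[g /andP[gG h]]|] := boolP [exists g in G, 0 < csum G g q * csum T e (rt int g)].
  have gT := subsetP sG g gG.
  have h1 : 0 < csum T e (rt int g).
    rewrite lt_neqAle csum_root_ge0 // andbT eq_sym.
    by apply: contraTneq h => ->; rewrite mulr0.
  move: h; rewrite pmulr_lgt0 // => h.
  move: h1; rewrite csum_root_gt0 // => /andP[c1 c2].
  by exists g; split=> //; apply: (subsetP pF); rewrite inE gG.
rewrite negb_exists => /forallP no; move: pe; rewrite ltNge => /negP[].
apply: sumr_le0 => g gG; rewrite leNgt; apply/negP => h.
by have := no g; rewrite gG h.
Qed.

(** [covers_fits] and [fits_indicator] place each covering face in the interval of some facet,
    [fits_unique] in no more than one, and by [pos_edges_covers] the intervals contain nothing
    else. *)
Lemma sum_covering_faces (V : nmodType) m (T : {set 'I_m * 'I_m}) (q : 'I_m -> int)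
    (phi : {set 'I_m * 'I_m} -> V) :
    nctree T -> generic q -> \sum_v q v = 0 ->
    (forall e, e \in T -> 0 < csum T e q) ->
  \sum_(F | `[< face T F /\ covers T F >]) phi F =
  \sum_(G | `[< facet T G >])
    \sum_(F : {set 'I_m * 'I_m} | (pos_edges q G \subset F) && (F \subset G)) phi F.
Proof.
move=> tT gq q0 qT.
rewrite (exchange_big_dep (fun F => `[< face T F /\ covers T F >])) /=; last first.
  move=> G F /asboolP fG /andP[pF sF]; apply/asboolP; split.
    by apply: face_sub sF _; case: fG.
  exact: pos_edges_covers fG pF.
apply: eq_bigr => F /asboolP[fF cF].
have [G fG fit] := covers_fits tT gq q0 fF cF.
rewrite (big_pred1 G) // => G' /=; apply/andP/eqP => [[/asboolP fG' /andP[pF sF]]|->].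
  have fit' : fits (fun v => - q v) (indicator_vec F) G' by apply/(fits_indicator q fF fG').
  apply: fits_unique fG' fG fit' fit; first exact: generic_opp.
    by rewrite sumrN q0 oppr0.
  exact: root_sum0.
split; first exact/asboolP.
by have [-> ->] := (fits_indicator q fF fG).1 fit.
Qed.

(** * Binomial sums and the enumeration of lattice points *)

(** Splitting on whether some [x] of [G :\: P] lies in [F] reduces the identity to Pascal's rule. *)
Lemma sum_interval_binomial (I : finType) (P G : {set I}) (t : nat) :
    P \subset G ->
  \sum_(F : {set I} | (P \subset F) && (F \subset G))
     (-1) ^+ #|F| * ('C(t + #|F|, #|F|))%:Z =
  (-1) ^+ #|G| * ('C(t + #|P|, #|G|))%:Z.
Proof.
have [k] := ubnP #|G :\: P|; elim: k P G => // k IH P G PGk sPG.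
have [GP|] := boolP (G \subset P).
  have -> : P = G by apply/eqP; rewrite eqEsubset sPG.
  by rewrite (big_pred1 G) // => F; rewrite /= eqEsubset andbC.
move=> /subsetPn[x xG xP].
have sizeP : #|x |: P| = #|P|.+1 by rewrite cardsU1 xP.
have sizeG : #|G| = #|G :\ x|.+1 by rewrite (cardsD1 x) xG.
have cD : #|G :\: P| = #|G :\: (x |: P)|.+1.
  rewrite (cardsD1 x) inE xP xG add1n; congr (_.+1); apply: eq_card => y.
  by rewrite !inE negb_or andbA.
rewrite (bigID (fun F : {set I} => x \in F)) /=.
transitivity ((-1) ^+ #|G| * ('C(t + #|x |: P|, #|G|))%:Z +
              (-1) ^+ #|G :\ x| * ('C(t + #|P|, #|G :\ x|))%:Z); last first.
  rewrite sizeP addnS sizeG binS PoszD exprS; ring.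
congr (_ + _).
- rewrite -IH; first last.
  + by rewrite subUset sub1set xG.
  + by rewrite -ltnS -cD.
  apply: eq_bigl => F; rewrite subUset sub1set.
  by case: (x \in F); case: (P \subset F); case: (F \subset G).
- rewrite -IH; first last.
  + by rewrite subsetD1 sPG.
  + move: PGk; rewrite cD ltnS; apply: leq_trans.
    rewrite ltnS subset_leq_card //; apply/subsetP => y; rewrite !inE negb_or.
    by case/and3P=> -> -> ->.
  apply: eq_bigl => F; rewrite subsetD1.
  by case: (x \in F); case: (P \subset F); case: (F \subset G).
Qed.

Lemma card_neg_pos m (T G : {set 'I_m * 'I_m}) (q : 'I_m -> int) :
  generic q -> facet T G -> (#|neg_edges q G| + #|pos_edges q G| = #|G|)%N.
Proof.
move=> gq [/face_forest foG _].
rewrite -(cardsID [set g | csum G g q < 0] G); congr (_ + _)%N; apply: eq_card => g.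
  by rewrite !inE.
rewrite !inE; have [gG|//] := boolP (g \in G); last by rewrite andbF.
by have := cut_side_generic gq foG gG; case: ltgtP.
Qed.

(** Lowering the weights by 1 on [N] leaves [#|G|] natural numbers of sum at most [t - #|N|]. The
    type ['I_t.+1] makes the set finite and cuts nothing off, each weight being bounded by the
    sum. *)
Lemma card_bounded_weights (I : finType) (G N : {set I}) (t p : nat) :
    N \subset G -> (#|N| + p = #|G|)%N ->
  #|[set w : {ffun I -> 'I_t.+1} | [&& [forall e, (e \notin G) ==> (w e == 0 :> nat)],
       [forall e, (e \in N) ==> (0 < w e)%N] & (\sum_e w e <= t)%N]]| =
  'C(t + p, #|G|).
Proof.
(* For [t < #|N|] the truncated difference would be misleading; both sides are 0, as then
   [t + p < #|G|]. *)
move=> sNG NG; have [tN|Nt] := ltnP t #|N|.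
  rewrite bin_small; last by lia.
  apply/eqP; rewrite cards_eq0; apply/eqP/setP => w; rewrite !inE.
  apply/negP => /and3P[_ /forallP wN]; rewrite leqNgt => /negP[].
  apply: (leq_trans tN); rewrite -sum1_card big_mkcond; apply: leq_sum => e _.
  by have := wN e; case: (e \in N).
set k := (t - #|N|)%N; have -> : (t + p = #|G| + k)%N by rewrite /k; lia.
rewrite -card_partial_ord_partitions.
pose h (s : #|G|.-tuple 'I_k.+1) e : nat :=
  if e \in G then (nth 0%N (map val s) (index e (enum G)) + (e \in N))%N else 0%N.
pose f s : {ffun I -> 'I_t.+1} := [ffun e => inord (h s e)].
have sz (s : #|G|.-tuple 'I_k.+1) : size (map val s) = #|G| by rewrite size_map size_tuple.
have idx e : e \in G -> (index e (enum G) < #|G|)%N by move=> eG; rewrite cardE index_mem mem_enum.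
have hlt s e : (h s e < t.+1)%N.
  rewrite /h; have [eG|//] := boolP (e \in G).
  have : (nth 0%N (map val s) (index e (enum G)) <= k)%N.
    by rewrite (nth_map ord0) ?size_tuple ?idx // -ltnS ltn_ord.
  have [eN|_] := boolP (e \in N); last by rewrite /k; lia.
  have : (0 < #|N|)%N by rewrite card_gt0; apply/set0Pn; exists e.
  by rewrite /k; lia.
have fE s e : f s e = h s e :> nat by rewrite ffunE inordK.
have hsum s : (\sum_e h s e = \sum_(i <- s) i + #|N|)%N.
  have -> : (\sum_(i <- s) i = \sum_(i <- map val s) i)%N by rewrite big_map.
  rewrite /h -big_mkcond big_split /=; congr (_ + _)%N; last first.
    rewrite -sum1_card big_mkcond [in RHS]big_mkcond; apply: eq_bigr => e _.
    have [eN|_] := boolP (e \in N); first by rewrite (subsetP sNG).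
    by case: ifP.
  move: (map val s) (sz s) => l sl.
  rewrite -big_enum [RHS](big_nth 0%N) sl cardE.
  case: (enum G) (enum_uniq G) => [|e0 s0] u; first by rewrite big_nil big_geq.
  rewrite (big_nth e0) !big_mkord; apply: eq_bigr => i _.
  by rewrite index_uniq.
have finj : injective f.
  move=> s s' ss; apply: val_inj; apply: (inj_map val_inj).
  apply: (@eq_from_nth _ 0%N); rewrite !sz // => i iG.
  have iG' : (i < size (enum G))%N by rewrite -cardE.
  have [e0 _] : exists e0, e0 \in G by apply/set0Pn; rewrite -card_gt0; lia.
  have eG : nth e0 (enum G) i \in G by rewrite -mem_enum mem_nth.
  have := congr1 (fun w : {ffun I -> 'I_t.+1} => w (nth e0 (enum G) i) : nat) ss.
  rewrite /= !fE /h eG index_uniq ?enum_uniq // => /eqP.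
  by rewrite eqn_add2r => /eqP.
rewrite -(card_imset _ finj); apply: eq_card => w.
apply/idP/imsetP => [|[s sk ->]]; rewrite inE.
  move=> /and3P[/forallP wG /forallP wN wt].
  have wNle e : ((e \in N) <= w e)%N by have := wN e; case: (e \in N).
  have sumW : (\sum_(e in G) (w e - (e \in N)) + #|N| = \sum_e w e)%N.
    have -> : (#|N| = \sum_(e in G) (e \in N))%N.
      rewrite -sum1_card big_mkcond [RHS]big_mkcond; apply: eq_bigr => e _.
      have [eN|_] := boolP (e \in N); first by rewrite (subsetP sNG).
      by case: ifP.
    rewrite -big_split [LHS]big_mkcond; apply: eq_bigr => e _ /=.
    have := wG e; have := wNle e; case: (e \in G) => /=; first by lia.
    by move=> _ /eqP ->.
  have sumk : (\sum_(e in G) (w e - (e \in N)) <= k)%N by rewrite /k leq_subRL // addnC sumW.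
  have le_k e : e \in G -> (w e - (e \in N) < k.+1)%N.
    by move=> eG; rewrite ltnS; apply: leq_trans sumk; rewrite (bigD1 e) //= leq_addr.
  pose s0 := [seq inord (w e - (e \in N)) : 'I_k.+1 | e <- enum G].
  have s0P : size s0 == #|G| by rewrite size_map cardE.
  have sv : map val s0 = [seq (w e - (e \in N))%N | e <- enum G].
    by rewrite -map_comp; apply/eq_in_map => e; rewrite mem_enum => eG /=; rewrite inordK ?le_k.
  exists (Tuple s0P).
    rewrite inE /= big_map (eq_big_seq (fun e => w e - (e \in N))%N).
      by rewrite big_enum.
    by move=> e; rewrite mem_enum => eG; rewrite inordK ?le_k.
  apply/ffunP => e; apply: ord_inj; rewrite fE /h /= sv.
  have [eG|eG] := boolP (e \in G); last by have := wG e; rewrite eG => /eqP.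
  rewrite (nth_map e) ?nth_index ?mem_enum ?index_mem ?mem_enum //.
  by rewrite subnK.
rewrite inE in sk; apply/and3P; split.
- by apply/forallP => e; apply/implyP => eG; rewrite fE /h (negPf eG).
- apply/forallP => e; apply/implyP => eN; rewrite fE /h eN (subsetP sNG) //.
  by rewrite addn1.
- by under eq_bigr do rewrite fE; rewrite hsum /k in sk *; lia.
Qed.

(** The height of a point; on vectors of sum 0 it is half the sum of the absolute values. *)
Definition hpos (R : realDomainType) m (z : 'I_m -> R) : R :=
  \sum_v Num.max (z v) 0.

(** No vertex is both a source and a sink, so the positive entries collect the total weight without
    cancellation. *)
Lemma hpos_comb (R : realDomainType) m (F : {set 'I_m * 'I_m})
    (a : 'I_m * 'I_m -> R) (z : 'I_m -> R) :
    is_graph F -> alternating F -> (forall f, f \in F -> 0 <= a f) ->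
    (forall v, z v = \sum_(f in F) a f * rt R f v) ->
  hpos z = \sum_(f in F) a f.
Proof.
move=> gF aF a0 zE.
have -> : \sum_(f in F) a f = \sum_v \sum_(f in F) a f * (v == f.1)%:R.
  rewrite exchange_big; apply: eq_bigr => f fF.
  rewrite (bigD1 f.1) //= eqxx mulr1 big1 ?addr0 //.
  by move=> v /negPf ->; rewrite mulr0.
apply: eq_bigr => v _.
have [/existsP[e /andP[eF /eqP ev]]|no] := boolP [exists e in F, e.1 == v].
  have -> : z v = \sum_(f in F) a f * (v == f.1)%:R.
    rewrite zE; apply: eq_bigr => f fF; rewrite /rt -ev [e.1 == f.2]eq_sym.
    by rewrite (negPf (alternating_disj gF aF fF eF)) subr0.
  by apply/max_idPl; apply: sumr_ge0 => f fF; rewrite mulr_ge0 ?a0.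
have ne f : f \in F -> (v == f.1) = false.
  move=> fF; apply: contraNF no => /eqP vf; apply/existsP; exists f.
  by rewrite fF vf eqxx.
rewrite [RHS]big1 => [|f fF]; last by rewrite ne // mulr0.
apply/max_idPr; rewrite zE; apply: sumr_le0 => f fF.
by rewrite mulr_ge0_le0 ?a0 // /rt ne // sub0r oppr_le0.
Qed.

Lemma in_cone_fits m (T : {set 'I_m * 'I_m}) (q z : 'I_m -> int) :
    nctree T -> generic q -> \sum_v q v = 0 ->
    (forall e, e \in T -> 0 < csum T e q) -> in_cone T z ->
  exists2 G, facet T G & fits q z G.
Proof.
move=> tT gq q0 qT [z0 zT]; apply: fits_exists => //.
split; first by rewrite big_split /= -mulr_sumr z0 q0 mulr0 addr0.
move=> e eT; rewrite csum_perturb; apply: addr_ge0; last exact/ltW/qT.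
by rewrite mulr_ge0 ?zT // /bound addr_ge0 // sumr_ge0.
Qed.

(** A lattice point amounts to the one facet that it fits together with its coordinates there. A
    list without repetitions serves both [fset_set] and the grids of cubes used for the volume. *)
Lemma lattice_enum n (T : {set 'I_n.+1 * 'I_n.+1}) (q : 'I_n.+1 -> int) (t : nat) :
    nctree T -> generic q -> \sum_v q v = 0 ->
    (forall e, e \in T -> 0 < csum T e q) ->
  exists s : seq 'rV[int]_n.+1, [/\ uniq s,
    forall z, z \in s <-> in_cone T (z ord0) /\ hpos (z ord0) <= t%:R &
    size s = (\sum_(G | `[< facet T G >]) 'C(t + #|pos_edges q G|, n))%N].
Proof.
move=> tT gq q0 qT; have [fT _ _] := tT.
pose E := ('I_n.+1 * 'I_n.+1)%type.
pose wset (G : {set E}) := [set w : {ffun E -> 'I_t.+1} |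
  [&& [forall e, (e \notin G) ==> (w e == 0 :> nat)],
     [forall e, (e \in neg_edges q G) ==> (0 < w e)%N] & (\sum_e w e <= t)%N]].
pose P := [set x : {set E} * {ffun E -> 'I_t.+1} | `[< facet T x.1 >] && (x.2 \in wset x.1)].
pose vec (x : {set E} * {ffun E -> 'I_t.+1}) : 'rV[int]_n.+1 :=
  \row_v \sum_(e in x.1) (x.2 e)%:R * rt int e v.
have vecE x : forall v, vec x ord0 v = \sum_(e in x.1) (x.2 e)%:R * rt int e v.
  by move=> v; rewrite mxE.
have fitsP x : x \in P -> facet T x.1 /\ fits q (vec x ord0) x.1.
  rewrite inE => /andP[/asboolP fG]; rewrite inE => /and3P[_ /forallP wN _].
  split=> // g gG; rewrite (csum_comb (face_forest fG.1) gG (vecE x)) ler_nat.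
  by have := wN g; rewrite inE gG /=; case: (_ < 0).
have coneP x : x \in P -> in_cone T (vec x ord0) /\ hpos (vec x ord0) <= t%:R.
  move=> xP; have [fG _] := fitsP x xP; have [[sG nG aG] _] := fG.
  split; first by apply: comb_in_cone (vecE x).
  have gG := face_graph fG.1.
  rewrite (hpos_comb gG aG _ (vecE x)) // -natr_sum ler_nat.
  move: xP; rewrite inE => /andP[_]; rewrite inE => /and3P[_ _].
  by apply: leq_trans; rewrite [leqRHS](bigID (mem x.1)) leq_addr.
have vec_inj : {in P &, injective vec}.
  move=> x y xP yP xy; have [fx tx] := fitsP x xP; have [fy ty] := fitsP y yP.
  have exy : x.1 = y.1.
    rewrite xy in tx; apply: (fits_unique gq q0 _ fx fy tx ty).
    by have [[]] := coneP y yP.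
  case: x y exy xP yP xy fx fy {tx ty} => G w [G' w'] /= <- xP yP xy fx _.
  congr (_, _); apply/ffunP => e; apply: val_inj => /=.
  have [eG|eG] := boolP (e \in G); last first.
    move: xP yP; rewrite !inE /= => /andP[_ /and3P[/forallP/(_ e) h _ _]].
    move=> /andP[_ /and3P[/forallP/(_ e) h' _ _]].
    by move: h h'; rewrite eG /= => /eqP -> /eqP ->.
  have := csum_comb (face_forest fx.1) eG (vecE (G, w)).
  rewrite xy (csum_comb (face_forest fx.1) eG (vecE (G, w'))) /=.
  by move=> /eqP; rewrite eqr_nat => /eqP.
exists [seq vec x | x <- enum P]; split.
- by rewrite map_inj_in_uniq ?enum_uniq // => x y; rewrite !mem_enum; apply: vec_inj.
- move=> z; split; first by case/mapP => x; rewrite mem_enum => /coneP h ->.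
  move=> [cz hz]; have [G fG fit] := in_cone_fits tT gq q0 qT cz.
  have c0 g : g \in G -> 0 <= csum G g (z ord0) by move=> /fit; apply: le_trans.
  have zE := tree_coord (face_forest fG.1) fG.2 cz.1.
  have [[sG nG aG] _] := fG.
  rewrite (hpos_comb (face_graph fG.1) aG c0 zE) in hz.
  pose w0 e := wt G (csum G ^~ (z ord0)) e.
  have w0E e : (w0 e)%:R = if e \in G then csum G e (z ord0) else 0.
    by rewrite /w0 /wt; case: ifP => // eG; rewrite natz gez0_abs ?c0.
  have sw0 : (\sum_e w0 e <= t)%N.
    rewrite -(ler_nat int) natr_sum; apply: le_trans hz.
    by rewrite [leRHS]big_mkcond; apply: ler_sum => e _; rewrite w0E.
  have w0t e : (w0 e < t.+1)%N.
    by rewrite ltnS; apply: leq_trans sw0; rewrite (bigD1 e) //= leq_addr.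
  pose w : {ffun E -> 'I_t.+1} := [ffun e => inord (w0 e)].
  have wE e : w e = w0 e :> nat by rewrite ffunE inordK.
  apply/mapP; exists (G, w).
    rewrite mem_enum inE /=; apply/andP; split; first exact/asboolP.
    rewrite inE; apply/and3P; split.
    + by apply/forallP => e; apply/implyP => eG; rewrite wE /w0 /wt (negPf eG).
    + apply/forallP => e; apply/implyP; rewrite inE => /andP[eG neg].
      rewrite wE -(ltr_nat int) w0E eG.
      by have := fit e eG; rewrite neg; apply: lt_le_trans.
    + by under eq_bigr do rewrite wE.
  apply/rowP => v; rewrite mxE zE; apply: eq_bigr => e eG /=.
  by rewrite wE w0E eG.
- rewrite size_map -cardE -sum1_card.
  rewrite (eq_bigl (fun x => `[< facet T x.1 >] && (x.2 \in wset x.1))); last first.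
    by move=> x; rewrite inE.
  rewrite -(pair_big_dep (fun G => `[< facet T G >]) (fun G w => w \in wset G) (fun _ _ => 1%N)) /=.
  apply: eq_bigr => G /asboolP fG; rewrite sum1_card.
  have cG := card_tree (face_forest fG.1) fG.2.
  transitivity 'C(t + #|pos_edges q G|, #|G|); last by congr ('C(_, _)).
  apply: card_bounded_weights; first by apply/subsetP => g; rewrite inE => /andP[].
  exact: card_neg_pos fG.
Qed.

Lemma covering_face_facet n (T F : {set 'I_n.+1 * 'I_n.+1}) :
  nctree T -> face T F -> covers T F -> exists2 G, facet T G & F \subset G.
Proof.
move=> tT fF cF; have [q [q0 qT gq]] := generic_exists tT.
have [G fG fit] := covers_fits tT gq q0 fF cF; exists G => //.
by have [] := (fits_indicator q fF fG).1 fit.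
Qed.

Lemma facet_card n (T G : {set 'I_n.+1 * 'I_n.+1}) : facet T G -> #|G| = n.
Proof. by move=> [fG cG]; apply: card_tree => //; apply: face_forest fG. Qed.

Lemma fnumE n (T : {set 'I_n.+1 * 'I_n.+1}) k : (0 < n)%N -> nctree T ->
  fnum T k = #|[set F | `[< face T F /\ covers T F >] & #|F| == k]|.
Proof.
move=> n0 tT; apply: eq_card => F; rewrite !inE.
apply/asboolP/andP => [/(admissible_covers F k n0 tT)[fF cF /eqP Fk]|[/asboolP[fF cF] /eqP Fk]].
  by split=> //; apply/asboolP.
exact/(admissible_covers F k n0 tT).
Qed.

(** A covering face lies in a facet and fills it if it has [n] edges; conversely a facet contains
    its own positive edges, hence covers. *)
Lemma fnum_top n (T : {set 'I_n.+1 * 'I_n.+1}) : (0 < n)%N -> nctree T ->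
  fnum T n = #|[set G | `[< facet T G >]]|.
Proof.
move=> n0 tT; rewrite fnumE //; apply: eq_card => F; rewrite !inE.
apply/andP/asboolP => [[/asboolP[fF cF] /eqP Fn]|fF].
  have [G fG sFG] := covering_face_facet tT fF cF.
  by suff -> : F = G by []; apply/eqP; rewrite eqEcard sFG Fn (facet_card fG) /=.
split; last by rewrite (facet_card fF).
have [q [q0 qT gq]] := generic_exists tT.
apply/asboolP; split; first exact: fF.1.
by apply: pos_edges_covers q0 qT fF _ => //; apply/subsetP => g; rewrite inE => /andP[].
Qed.

Lemma fnum_sum n (T : {set 'I_n.+1 * 'I_n.+1}) (q : 'I_n.+1 -> int) t :
    (0 < n)%N -> nctree T -> generic q -> \sum_v q v = 0 ->
    (forall e, e \in T -> 0 < csum T e q) ->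
  (-1) ^+ n * \sum_(i < n.+1) (-1) ^+ i * (fnum T i)%:Z * ('C(t + i, i))%:Z =
  (\sum_(G | `[< facet T G >]) 'C(t + #|pos_edges q G|, n))%N%:Z.
Proof.
move=> n0 tT gq q0 qT.
transitivity ((-1) ^+ n * \sum_(F : {set 'I_n.+1 * 'I_n.+1} | `[< face T F /\ covers T F >])
    (-1) ^+ #|F| * ('C(t + #|F|, #|F|))%:Z).
  congr (_ * _).
  (* Covering faces are sorted by size; they lie in facets, so sizes are at most [n] and [inord]
     returns them unchanged. *)
  rewrite (partition_big (fun F : {set 'I_n.+1 * 'I_n.+1} => inord #|F| : 'I_n.+1) xpredT) //=.
  apply: eq_bigr => i _; rewrite fnumE //.
  have eqP0 (F : {set 'I_n.+1 * 'I_n.+1}) : `[< face T F /\ covers T F >] && (inord #|F| == i :> 'I_n.+1)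
      = (F \in [set F | `[< face T F /\ covers T F >] & #|F| == i]).
    rewrite inE; case: asboolP => //= -[fF cF].
    have [G fG sFG] := covering_face_facet tT fF cF.
    have Fn : (#|F| < n.+1)%N 
      by rewrite ltnS; apply: leq_trans (subset_leq_card sFG) _; rewrite (facet_card fG).
    by rewrite -val_eqE /= inordK.
  rewrite (eq_bigl _ _ eqP0).
  rewrite (eq_bigr (fun _ => (-1) ^+ i * ('C(t + i, i))%:Z)); last first.
    by move=> F; rewrite inE => /andP[_ /eqP ->].
  by rewrite sumr_const mulrAC -mulr_natr natz.
rewrite (sum_covering_faces _ tT gq q0 qT) mulr_sumr -natz natr_sum.
apply: eq_bigr => G /asboolP fG; rewrite sum_interval_binomial.
  have -> : #|G| = n by exact: facet_card fG.
  by rewrite signrMK natz.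
by apply/subsetP => g; rewrite inE => /andP[].
Qed.

(** * The polytope *)

From mathcomp Require Import all_classical all_reals all_analysis.
From mathcomp Require Import measurable_realfun.
Import Order.TTheory GRing.Theory Num.Theory.
Import numFieldNormedType.Exports.
Local Open Scope ring_scope.

Lemma root_vecE (R : realType) m (e : 'I_m * 'I_m) v : root_vec R e ord0 v = rt R e v.
Proof. by rewrite !mxE !eqxx. Qed.

Lemma sum_root_vecE (R : realType) m (A : {pred 'I_m * 'I_m}) (c : 'I_m * 'I_m -> R) v :
  (\sum_(e in A) c e *: root_vec R e) ord0 v = \sum_(e in A) c e * rt R e v.
Proof. by rewrite summxE; apply: eq_bigr => e _; rewrite mxE root_vecE. Qed.

Lemma hpos_ge0 (R : realDomainType) m (z : 'I_m -> R) : 0 <= hpos z.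
Proof. by apply: sumr_ge0 => v _; rewrite le_max lexx orbT. Qed.

Lemma hposD (R : realDomainType) m (x y : 'I_m -> R) :
  hpos (fun v => x v + y v) <= hpos x + hpos y.
Proof.
rewrite -big_split; apply: ler_sum => v _ /=.
by rewrite ge_max lerD ?addr_ge0 ?le_max ?lexx ?orbT.
Qed.

Lemma hposZ (R : realDomainType) m (a : R) (x : 'I_m -> R) :
  0 <= a -> hpos (fun v => a * x v) = a * hpos x.
Proof.
by move=> a0; rewrite mulr_sumr; apply: eq_bigr => v _; rewrite maxr_pMr ?mulr0.
Qed.

Lemma eq_hpos (R : realDomainType) m (x y : 'I_m -> R) : x =1 y -> hpos x = hpos y.
Proof. by move=> xy; apply: eq_bigr => v _; rewrite xy. Qed.

Lemma hpos_rt (R : realDomainType) m (e : 'I_m * 'I_m) : (e.1 < e.2)%N -> hpos (rt R e) = 1.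
Proof.
move=> e12; have g1 : is_graph [set e]%SET by move=> f; rewrite inE => /eqP ->.
rewrite (@hpos_comb _ _ [set e]%SET (fun=> 1)) ?big_set1 //.
  move=> i j k ij jk; rewrite !inE => -[/eqP h /eqP h']; move: ij.
  by rewrite -[i]/(i, j).1 -[j]/(j, k).1 h h' ltnn.
by move=> v; rewrite big_set1 mul1r.
Qed.

(** Subadditivity and positive homogeneity of [hpos] make its sublevel set convex, and the
    generators lie in it. *)
Lemma hull_hpos (R : realType) m (x : 'rV[R]_m) :
  @full_root_polytope R m x -> hpos (x ord0) <= 1.
Proof.
apply: (@smallest_sub _ _ _ [set y : 'rV[R]_m | hpos (y ord0) <= 1]%classic).
  move=> y z l; rewrite !inE /= => hy hz.
  rewrite (@eq_hpos _ _ _ (fun v => l%:num * y ord0 v + (1 - l%:num) * z ord0 v)); last first.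
    by move=> v; rewrite !mxE.
  have l0 : 0 <= l%:num by exact: ge0.
  have l1 : 0 <= 1 - l%:num by rewrite subr_ge0; exact: le1.
  apply: le_trans (hposD _ _) _; rewrite !hposZ //.
  apply: (@le_trans _ _ (l%:num * 1 + (1 - l%:num) * 1)).
    by rewrite lerD // ler_wpM2l.
  by rewrite !mulr1 addrC subrK.
move=> y [->|[e e12 <-]] /=.
  rewrite (@eq_hpos _ _ _ (fun=> 0)) => [|v]; last by rewrite mxE.
  by rewrite /hpos big1 // => v _; rewrite maxxx.
by rewrite (eq_hpos (fun v => root_vecE R e v)) hpos_rt.
Qed.

(** Asking for [B (f i)] only where [c i] is nonzero lets sums over all pairs of vertices be
    treated, including pairs that are not edges. *)
Lemma convex_cone_comb (R : realType) (V : lmodType R) (B : set V) (I : eqType)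
    (s : seq I) (c : I -> R) (f : I -> V) :
    @convex_set R V B -> B 0 -> (forall i, i \in s -> 0 <= c i /\ (c i != 0 -> B (f i))) ->
  exists2 y, B y & \sum_(i <- s) c i *: f i = (\sum_(i <- s) c i) *: y.
Proof.
move=> cB B0; elim: s => [|i s IH] cf.
  by exists 0 => //; rewrite !big_nil scaler0.
have [|y By ys] := IH; first by move=> j js; apply: cf; rewrite inE js orbT.
have [ci0 fi] := cf i (mem_head _ _).
have s0 : 0 <= \sum_(j <- s) c j.
  by rewrite big_seq; apply: sumr_ge0 => j js; have [] := cf j; rewrite // inE js orbT.
rewrite !big_cons ys; set W := \sum_(j <- s) c j in s0 *.
have [ci|cin] := eqVneq (c i) 0; first by exists y => //; rewrite ci scale0r !add0r.
have W0 : 0 < c i + W by apply: ltr_pwDl => //; rewrite lt_neqAle eq_sym cin.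
have k0 : 0 <= c i / (c i + W) by rewrite divr_ge0 // ltW.
have k1 : c i / (c i + W) <= 1 by rewrite ler_pdivrMr // mul1r lerDl.
pose k : {i01 R} := Itv01 k0 k1.
have := cB (f i) y k; rewrite !inE => /(_ (fi cin) By) Bk.
exists (k%:num *: f i + (1 - k%:num) *: y) => //.
rewrite scalerDr !scalerA /=; congr (_ *: _ + _ *: _).
  by rewrite mulrC divfK // gt_eqF.
by rewrite mulrBr mulr1 mulrC divfK ?gt_eqF // addrC addKr.
Qed.

Lemma convex_comb_le1 (R : realType) (V : lmodType R) (B : set V) (I : eqType)
    (s : seq I) (c : I -> R) (f : I -> V) :
    @convex_set R V B -> B 0 -> (forall i, i \in s -> 0 <= c i /\ (c i != 0 -> B (f i))) ->
    \sum_(i <- s) c i <= 1 ->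
  B (\sum_(i <- s) c i *: f i).
Proof.
move=> cB B0 cf c1; have [y By ->] := convex_cone_comb cB B0 cf.
have c0 : 0 <= \sum_(i <- s) c i.
  by rewrite big_seq; apply: sumr_ge0 => j js; have [] := cf j js.
pose k : {i01 R} := Itv01 c0 c1.
have := cB y 0 k; rewrite !inE => /(_ By B0) Bk.
suff <- : k%:num *: y + (1 - k%:num) *: 0 = (\sum_(i <- s) c i) *: y by [].
by rewrite scaler0 addr0.
Qed.

(** Greedy transport: the first negative entry [j] has a positive entry [i] before it, as initial
    sums are nonnegative, and moving the smaller of [z i] and [- z j] clears one of the two. Each
    amount moved lowers the height by itself, so the total is [hpos z]. *)
Lemma forward_comb (R : realFieldType) m (z : 'I_m -> R) :
    \sum_v z v = 0 -> (forall k : nat, 0 <= \sum_(v : 'I_m | (v < k)%N) z v) ->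
  exists c : 'I_m * 'I_m -> R, [/\ forall e, 0 <= c e, forall e, c e != 0 -> (e.1 < e.2)%N,
    forall v, z v = \sum_e c e * rt R e v & \sum_e c e = hpos z].
Proof.
have [N] := ubnP #|[pred v | z v != 0]|; elim: N z => // N IH z zN z0 zp.
have [/existsP[j0 zj0]|] := boolP [exists j, z j < 0]; last first.
  rewrite negb_exists => /forallP no.
  have zv v : z v = 0.
    have ge0 u : 0 <= z u by rewrite leNgt.
    apply/eqP; have := psumr_eq0P (fun u _ => ge0 u) z0 => h.
    by rewrite h.
  exists (fun=> 0); split=> //.
  - by move=> e; rewrite eqxx.
  - by move=> v; rewrite zv big1 // => e _; rewrite mul0r.
  - by rewrite big1 // /hpos big1 // => v _; rewrite zv maxxx.
pose neg (j : 'I_m) := z j < 0; have nj0 : neg j0 by [].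
case: (arg_minnP (fun j : 'I_m => j : nat) nj0) => j; rewrite /neg => zj jmin {j0 zj0 nj0 neg}.
have before (u : 'I_m) : (u < j)%N -> 0 <= z u.
  by move=> uj; rewrite leNgt; apply/negP => /jmin; rewrite leqNgt uj.
have [i ij zi] : exists2 i : 'I_m, (i < j)%N & 0 < z i.
  have [/existsP[i /andP[ij zi]]|] := boolP [exists i : 'I_m, (i < j)%N && (0 < z i)].
    by exists i.
  rewrite negb_exists => /forallP no; exfalso.
  have := zp j.+1; rewrite (bigD1 j) //= leNgt => /negP[].
  rewrite big1 ?addr0 // => u /andP[]; rewrite ltnS => uj ne.
  have {ne}uj : (u < j)%N by rewrite ltn_neqAle uj andbT.
  apply/eqP; rewrite eq_le before // andbT leNgt.
  by have := no u; rewrite uj.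
have ne : i != j by apply: contraTneq ij => ->; rewrite ltnn.
pose M := Num.min (z i) (- z j).
have M0 : 0 < M by rewrite lt_min zi oppr_gt0 zj.
have Mi : M <= z i by rewrite ge_min lexx.
have Mj : M <= - z j by rewrite ge_min lexx orbT.
pose z' v := z v - M * rt R (i, j) v.
have z'i : z' i = z i - M by rewrite /z' /rt /= eqxx (negPf ne) subr0 mulr1.
have z'j : z' j = z j + M.
  by rewrite /z' /rt /= eqxx [j == i]eq_sym (negPf ne) sub0r mulrN mulr1 opprK.
have z'u u : u != i -> u != j -> z' u = z u.
  by move=> /negPf ui /negPf uj; rewrite /z' /rt /= ui uj subrr mulr0 subr0.
have rt0 : \sum_v rt R (i, j) v = 0.
  have := @root_sum0 R m (pred1 (i, j)) (fun=> 1).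
  by under eq_bigr do rewrite big_pred1_eq mul1r.
have z'0 : \sum_v z' v = 0 by rewrite /z' big_split /= sumrN -mulr_sumr rt0 z0 mulr0 subr0.
have z'p k : 0 <= \sum_(v : 'I_m | (v < k)%N) z' v.
  rewrite /z' big_split /= sumrN -mulr_sumr.
  have -> : \sum_(v : 'I_m | (v < k)%N) rt R (i, j) v = (i < k)%N%:R - (j < k)%N%:R.
    transitivity (\sum_(v in [set v : 'I_m | (v < k)%N]%SET) rt R (i, j) v).
      by apply: eq_bigl => v; rewrite inE.
    by rewrite sum_rt !inE.
  have [jk|kj] := ltnP j k; first by rewrite (ltn_trans ij jk) subrr mulr0 subr0.
  have [ik|ki] := ltnP i k; last by rewrite subrr mulr0 subr0.
  rewrite subr0 mulr1 subr_ge0; apply: le_trans Mi _.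
  rewrite (bigD1 i) //= lerDl; apply: sumr_ge0 => u /andP[uk _].
  by apply: before; apply: leq_trans kj.
have [|c [c0 cs cz ch]] := IH z' _ z'0 z'p.
  rewrite -ltnS; apply: leq_trans zN; rewrite ltnS.
  have [w wE wz] : exists2 w, z w != 0 & z' w = 0.
    have [h|h] := leP (z i) (- z j).
      by exists i; rewrite ?gt_eqF // z'i /M min_l // subrr.
    by exists j; rewrite ?lt_eqF // z'j /M min_r ?ltW // subrr.
  apply: proper_card; apply/properP; split; last by exists w; rewrite inE ?wE // wz eqxx.
  apply/fintype.subsetP => u; rewrite !inE.
  have [->|ui] := eqVneq u i; first by rewrite (gt_eqF zi).
  have [->|uj] := eqVneq u j; first by rewrite (lt_eqF zj).
  by rewrite z'u.
exists (fun e => c e + (if e == (i, j) then M else 0)); split.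
- by move=> e; rewrite addr_ge0 //; case: ifP => // _; exact: ltW.
- move=> e; have [->|_] := eqVneq e (i, j); [by move=> _; exact: ij|by rewrite addr0; exact: cs].
- move=> v; under eq_bigr do rewrite mulrDl.
  rewrite big_split /= -cz (bigD1 (i, j)) //= eqxx big1 ?addr0; last first.
    by move=> e /negPf ->; rewrite mul0r.
  by rewrite /z' subrK.
- rewrite big_split /= ch (bigD1 (i, j)) //= eqxx big1 ?addr0; last by move=> e /negPf ->.
  have eqS : \sum_(u | u != i) Num.max (z' u) 0 = \sum_(u | u != i) Num.max (z u) 0.
    apply: eq_bigr => u ui; have [->|uj] := eqVneq u j; last by rewrite z'u.
    by rewrite z'j !max_r ?(ltW zj) // -subr_ge0 sub0r opprD subr_ge0.
  rewrite /hpos (bigD1 i) //= [in RHS](bigD1 i) //= eqS z'i.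
  by rewrite (max_l (ltW zi)) max_l ?subr_ge0 // addrAC subrK.
Qed.

Lemma cone_hull (R : realType) m (T : {set 'I_m * 'I_m}) (x : 'rV[R]_m) :
  is_graph T -> root_cone T x -> hpos (x ord0) <= 1 -> @full_root_polytope R m x.
Proof.
move=> gT [a a0 xE] h1.
have xv v : x ord0 v = \sum_(e in T) a e * rt R e v by rewrite xE sum_root_vecE.
have x0 : \sum_v x ord0 v = 0 by under eq_bigr do rewrite xv; exact: root_sum0.
have xp k : 0 <= \sum_(v : 'I_m | (v < k)%N) x ord0 v.
  under eq_bigr do rewrite xv.
  have -> : \sum_(v : 'I_m | (v < k)%N) \sum_(e in T) a e * rt R e v =
      \sum_(v in [set v : 'I_m | (v < k)%N]%SET) \sum_(e in T) a e * rt R e v.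
    by apply: eq_bigl => v; rewrite inE.
  rewrite sum_comb; apply: sumr_ge0 => e eT; rewrite mulr_ge0 // !inE subr_ge0 ler_nat.
  by case: (ltnP e.2 k) => // h3; rewrite (ltn_trans (gT e eT) h3).
have [c [c0 cs cx ch]] := forward_comb x0 xp.
move=> B [cB sB].
have -> : x = \sum_e c e *: root_vec R e.
  by apply/rowP => v; rewrite cx sum_root_vecE.
apply: convex_comb_le1 => //.
- by apply: sB; left.
- by move=> e _; split=> // /cs e12; apply: sB; right; exists e.
- by rewrite ch.
Qed.

Lemma root_polytopeE (R : realType) m (T : {set 'I_m * 'I_m}) (x : 'rV[R]_m) :
    nctree T ->
  root_polytope T x <-> [/\ \sum_v x ord0 v = 0,
    forall e, e \in T -> 0 <= csum T e (x ord0) & hpos (x ord0) <= 1].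
Proof.
move=> [fT nT cT]; split=> [[hx [a a0 xE]]|[x0 xT h1]].
  have xv v : x ord0 v = \sum_(e in T) a e * rt R e v by rewrite xE sum_root_vecE.
  split; last exact: hull_hpos.
    by under eq_bigr do rewrite xv; exact: root_sum0.
  by move=> e eT; rewrite (csum_comb fT eT xv).
have cx : root_cone T x.
  exists (fun e => if e \in T then csum T e (x ord0) else 0).
    by move=> e; case: ifP => // /xT.
  apply/rowP => v; rewrite sum_root_vecE (tree_coord fT cT x0).
  by apply: eq_bigr => e ->.
by split=> //; apply: cone_hull cx h1; case: fT.
Qed.

Lemma hpos_intr (R : realType) m (z : 'I_m -> int) :
  hpos (fun v => (z v)%:~R : R) = (hpos z)%:~R.
Proof.
rewrite /hpos (rmorph_sum (intmul 1)) /=; apply: eq_bigr => v _.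
have [h|h] := leP (z v) 0; first by rewrite max_r // lerz0.
by rewrite max_l // ler0z ltW.
Qed.

Lemma csum_intr (R : realType) m (T : {set 'I_m * 'I_m}) e (z : 'I_m -> int) :
  csum T e (fun v => (z v)%:~R : R) = (csum T e z)%:~R.
Proof. by rewrite /csum (rmorph_sum (intmul 1)). Qed.

Lemma eq_csum (R : pzRingType) m (T : {set 'I_m * 'I_m}) e (x y : 'I_m -> R) :
  x =1 y -> csum T e x = csum T e y.
Proof. by move=> xy; apply: eq_bigr => v _; rewrite xy. Qed.

Lemma dilated_lattice_point (R : realType) m (T : {set 'I_m * 'I_m}) (t : nat)
    (z : 'rV[int]_m) : nctree T ->
  [set t%:R *: x | x in @root_polytope R m T]%classic (map_mx intr z) <->
  in_cone T (z ord0) /\ hpos (z ord0) <= t%:R.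
Proof.
move=> tT.
have zv v : (map_mx intr z : 'rV[R]_m) ord0 v = (z ord0 v)%:~R by rewrite mxE.
split=> [[x /(root_polytopeE _ tT)[x0 xT h1] tx]|[[z0 zT] ht]].
  have xz v : (z ord0 v)%:~R = t%:R * x ord0 v by rewrite -zv -tx mxE.
  split; first split.
  - apply/eqP; rewrite -(intr_eq0 R) (rmorph_sum (intmul 1)) /=.
    by under eq_bigr do rewrite xz; rewrite -mulr_sumr x0 mulr0.
  - move=> e eT; rewrite -(ler0z R) -csum_intr (eq_csum _ _ xz) /csum -mulr_sumr.
    by rewrite mulr_ge0 // xT.
  - by rewrite -(ler_int R) -hpos_intr (eq_hpos xz) hposZ // mulrz_nat ler_piMr.
(* For [t = 0] the dilate is the origin alone; height at most 0 and sum 0 force [z = 0]. *)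
have [t0|t0] := posnP t.
  have z0v v : z ord0 v = 0.
    have le0 u : z ord0 u <= 0.
      move: ht; rewrite t0 => /(le_trans _) h; apply: le_trans (h (Num.max (z ord0 u) 0) _).
        by rewrite le_max lexx.
      by rewrite /hpos (bigD1 u) //= lerDl sumr_ge0 // => w _; rewrite le_max lexx orbT.
    have := @psumr_eq0P _ _ xpredT (fun u => - z ord0 u) => /(_ (fun u _ => _)) h.
    apply/eqP; rewrite -oppr_eq0; apply/eqP; apply: h => //; last by rewrite sumrN z0 oppr0.
    by move=> u; rewrite oppr_ge0.
  exists 0; last by apply/rowP => v; rewrite t0 scale0r zv z0v mxE.
  apply/(root_polytopeE _ tT); split.
  - by apply: big1 => v _; rewrite mxE.
  - by move=> e eT; rewrite /csum big1 // => v _; rewrite mxE.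
  - by rewrite /hpos big1 // => v _; rewrite mxE maxxx.
have tR : (t%:R : R) != 0 by rewrite pnatr_eq0 -lt0n.
exists (t%:R^-1 *: map_mx intr z); last by rewrite scalerA divff // scale1r.
have xv v : (t%:R^-1 *: map_mx intr z : 'rV[R]_m) ord0 v = t%:R^-1 * (z ord0 v)%:~R.
  by rewrite mxE zv.
have ti : 0 <= (t%:R : R)^-1 by rewrite invr_ge0.
apply/(root_polytopeE _ tT); split.
- under eq_bigr do rewrite xv; rewrite -mulr_sumr -(rmorph_sum (intmul 1)) /= z0.
  by rewrite mulr0z mulr0.
- move=> e eT; rewrite (eq_csum _ _ xv) /csum -mulr_sumr mulr_ge0 //.
  by rewrite -[X in 0 <= X]/(csum T e (fun v => (z ord0 v)%:~R : R)) csum_intr ler0z zT.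
- rewrite (eq_hpos xv) hposZ // hpos_intr mulrC ler_pdivrMr ?ltr0n // mul1r.
  by rewrite -(ler_int R) mulrz_nat in ht.
Qed.

Lemma ehrhart_root_polytope (R : realType) n (T : {set 'I_n.+1 * 'I_n.+1})
    (q : 'I_n.+1 -> int) t :
    nctree T -> generic q -> \sum_v q v = 0 ->
    (forall e, e \in T -> 0 < csum T e q) ->
  ehrhart (@root_polytope R n.+1 T) t =
  (\sum_(G | `[< facet T G >]) 'C(t + #|pos_edges q G|, n))%N.
Proof.
move=> tT gq q0 qT; have [s [us sP <-]] := lattice_enum t tT gq q0 qT.
rewrite /ehrhart.
have -> : [set z : 'rV[int]_n.+1 | [set t%:R *: x | x in @root_polytope R n.+1 T]%classic
    (map_mx intr z)]%classic = [set` [fset z in s]%fset]%classic.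
  apply/seteqP; split=> z /=; rewrite !inE.
    by move=> /(dilated_lattice_point _ _ _ tT)/sP.
  by move=> /sP h; apply/(dilated_lattice_point _ _ _ tT).
by rewrite set_fsetK card_fseq undup_id.
Qed.

(** * Volume *)

Lemma lebesgueN_ge0 (R : realType) n (A : set (n.-tuple R)) : (0 <= lebesgueN A)%E.
Proof.
elim: n A => [|n IH] A /=; first by rewrite diracE lee_fin.
by apply: integral_ge0 => x _; exact: IH.
Qed.

(** The integral of a nonnegative function is a supremum over simple functions below it, hence
    monotone without measurability. The polytope can thus be squeezed between grids directly. *)
Lemma lebesgueN_le (R : realType) n (A B : set (n.-tuple R)) :
  (A `<=` B)%classic -> (lebesgueN A <= lebesgueN B)%E.
Proof.
elim: n A B => [|n IH] A B AB /=.
  rewrite !diracE lee_fin ler_nat; case: (boolP (_ \in A)) => //.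
  by rewrite !inE => /AB h; rewrite mem_set.
rewrite /product_measure1 !ge0_integralTE; try by move=> x; exact: lebesgueN_ge0.
apply: ereal_sup_le => _ [h hA <-]; exists h => // x.
apply: le_trans (hA x) _; apply: IH => y /=.
by rewrite /xsection /= !inE; apply: AB.
Qed.

Definition grid (R : realType) n (t : nat) (B : seq (n.-tuple int)) : set (n.-tuple R) :=
  [set u : n.-tuple R | map_tuple (fun x : R => Num.floor (t%:R * x)) u \in B]%classic.

(** The slice at a first coordinate [x] is the grid of the tails of those corners whose head is the
    floor of [t x], so its measure is a sum of interval indicators in [x]. *)
Lemma lebesgueN_grid (R : realType) n t (B : seq (n.-tuple int)) :
  (0 < t)%N -> uniq B -> lebesgueN (@grid R n t B) = ((size B)%:R / t%:R ^+ n)%:E.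
Proof.
move=> t0; have tR : (0 : R) < t%:R by rewrite ltr0n.
elim: n B => [|n IH] B uB.
  rewrite /= diracE expr0 divr1; congr (_%:R%:E).
  have all0 : all (pred1 [tuple]) B by apply/allP => b _; rewrite /= tuple0.
  have [B0|[b bB]] : B = [::] \/ exists b, b \in B.
    by case: B {uB all0} => [|b B]; [left|right; exists b; rewrite mem_head].
    by subst B; case: (boolP (_ \in _)) => //; rewrite inE.
  have -> : ([tuple] \in @grid R 0 t B).
    by rewrite mem_set //= /grid /= (tuple0 [tuple of _]) -(tuple0 b).
  have /(uniq_leq_size uB) : {subset B <= [:: [tuple]]}.
    by move=> c _; rewrite (tuple0 c) mem_head.
  by case: B bB {uB all0} => [|c [|]].
rewrite /= /product_measure1.
pose I (b : n.+1.-tuple int) : set R := `[(thead b)%:~R / t%:R, (thead b + 1)%:~R / t%:R[%classic.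
have mI b : measurable (I b) by exact: measurable_itv.
have inI b x : (x \in I b) = (Num.floor (t%:R * x) == thead b).
  rewrite real_floor_eq ?num_real // /I; apply/idP/idP; rewrite inE /= in_itv /=.
    by rewrite ler_pdivrMr // ltr_pdivlMr // ![x * _]mulrC.
  by rewrite ler_pdivrMr // ltr_pdivlMr // ![x * _]mulrC.
transitivity (\int[@lebesgue_measure R]_x
    (\sum_(b <- B) ((t%:R ^+ n)^-1)%:E * (\1_(I b) x)%:E))%E.
  apply: eq_integral => x _ /=.
  pose Bx : seq (n.-tuple int) := [seq behead_tuple b | b <- B & Num.floor (t%:R * x) == thead b].
  have uBx : uniq Bx.
    rewrite map_inj_in_uniq ?filter_uniq // => b b'; rewrite !mem_filter.
    move=> /andP[/eqP h _] /andP[/eqP h' _] /(congr1 val) /= e.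
    by rewrite (tuple_eta b) (tuple_eta b'); apply: val_inj => /=; rewrite -h -h' e.
  have -> : xsection [set p : R * n.-tuple R | grid t B [tuple of p.1 :: p.2]]%classic x = @grid R n t Bx.
    apply/seteqP; split=> u; rewrite /xsection /grid /= inE /=.
      move=> h; apply/mapP; exists (map_tuple (fun x : R => Num.floor (t%:R * x)) [tuple of x :: u]).
        by rewrite mem_filter; apply/andP; split; [rewrite /thead tnth_map (tnth_nth x)|exact: h].
      by apply: val_inj.
    move=> /mapP[b]; rewrite mem_filter => /andP[/eqP fb bB] e.
    suff -> : map_tuple (fun x : R => Num.floor (t%:R * x)) [tuple of x :: u] = b by [].
    rewrite (tuple_eta b); apply: val_inj => /=; rewrite -fb; congr (_ :: _).
    exact: (congr1 val e).
  rewrite IH // size_map size_filter -sum1_count natr_sum mulr_suml.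
  rewrite big_mkcond -sumEFin; apply: eq_bigr => b _; rewrite indicE inI.
  by rewrite -EFinM; case: (_ == _); rewrite ?mul1r ?mulr1 ?mulr0.
rewrite ge0_integral_sum //; last first.
  move=> b; apply: measurable_funeM; apply/measurable_EFinP.
  by apply: measurable_indic; exact: mI.
rewrite (eq_bigr (fun _ => ((t%:R ^+ n.+1)^-1)%:E)); last first.
  move=> b _; rewrite ge0_integralZl_EFin //.
  - rewrite integral_indic //; last exact: mI.
    transitivity (((t%:R ^+ n)^-1)%:E * lebesgue_measure (I b))%E.
      by congr (_ * lebesgue_measure _)%E; exact: setIT.
    rewrite /I lebesgue_measure_itv /= lte_fin.
    rewrite ltr_pM2r ?invr_gt0 // ltr_int ltrDl ltr01 -EFinB -EFinM; congr (_%:E).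
    rewrite -mulrBl intrD addrAC subrr add0r mul1r exprS invfM mulrC //.
  - by apply/measurable_EFinP; apply: measurable_indic; exact: mI.
rewrite sumEFin big_const_seq count_predT iter_addr_0; congr (_%:E).
by rewrite [RHS]mulr_natl.
Qed.

(** [d] is the error of rounding the first [n] coordinates down. The last entry, fixed by sum 0,
    lies between [-n] and 0, while the others add up to at most [n]. *)
Lemma rounding_error (R : realFieldType) n (d : 'I_n.+1 -> R) :
    \sum_v d v = 0 -> (forall v, v != ord_max -> 0 <= d v <= 1) ->
  [/\ forall S : {set 'I_n.+1}, `|\sum_(v in S) d v| <= n%:R,
      hpos d <= n%:R & hpos (fun v => - d v) <= n%:R].
Proof.
move=> d0 d01.
have sumP (P : pred 'I_n.+1) : 0 <= \sum_(v | (v != ord_max) && P v) d v <= n%:R.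
  apply/andP; split; first by apply: sumr_ge0 => v /andP[/d01/andP[]].
  have -> : (n%:R : R) = \sum_(v : 'I_n.+1 | v != ord_max) 1.
    by rewrite sumr_const cardC1 card_ord.
  rewrite big_mkcondr; apply: ler_sum => v /d01/andP[h0 h1].
  by case: ifP.
have sumT : 0 <= \sum_(v | v != ord_max) d v <= n%:R.
  by have := sumP xpredT; rewrite (eq_bigl (fun v => v != ord_max)) // => v; rewrite andbT.
have dmax : - n%:R <= d ord_max <= 0.
  move: d0; rewrite (bigD1 ord_max) //= => /eqP; rewrite addr_eq0 => /eqP ->.
  by rewrite lerN2 oppr_le0 andbC.
split.
- move=> S; rewrite big_mkcond (bigD1 ord_max) //= -big_mkcondr /=.
  have /andP[s0 s1] := sumP (mem S); have /andP[m0 m1] := dmax.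
  rewrite ler_norml; apply/andP; split.
    apply: (@le_trans _ _ (- n%:R + 0)); first by rewrite addr0.
    by apply: lerD => //; case: ifP => // _; rewrite oppr_le0.
  by apply: (@le_trans _ _ (0 + n%:R)); [apply: lerD => //; case: ifP|rewrite add0r].
- rewrite /hpos (bigD1 ord_max) //= max_r; last by case/andP: dmax.
  rewrite add0r (eq_bigr d) => [|v /d01/andP[h0 _]]; last by rewrite max_l.
  by case/andP: sumT.
- rewrite /hpos (bigD1 ord_max) //= max_l; last by rewrite oppr_ge0; case/andP: dmax.
  rewrite big1 ?addr0; first by rewrite lerNl; case/andP: dmax.
  by move=> v /d01/andP[h0 _]; rewrite max_r // oppr_le0.
Qed.

Lemma leq_expn a b k : (a <= b)%N -> (a ^ k <= b ^ k)%N.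
Proof. by move=> ab; case: k => // k; rewrite leq_exp2r. Qed.

Lemma ffact_le_expn a n : (a ^_ n <= a ^ n)%N.
Proof.
elim: n a => // n IH a; rewrite ffactnS expnS leq_mul2l; apply/orP; right.
by apply: leq_trans (IH _) _; apply: leq_expn; apply: leq_pred.
Qed.

Lemma expn_le_ffact a n : ((a - n) ^ n <= a ^_ n)%N.
Proof.
elim: n a => // n IH a; rewrite ffactnS expnS; apply: leq_mul; first exact: leq_subr.
by apply: leq_trans (IH _); apply: leq_expn; lia.
Qed.

Definition chart (V : Type) n (x : 'I_n.+1 -> V) : n.-tuple V :=
  [tuple x (widen_ord (leqnSn n) i) | i < n].

Definition unchart (V : zmodType) n (b : n.-tuple V) (v : 'I_n.+1) : V :=
  if unlift ord_max v is Some i then tnth b i else - \sum_i tnth b i.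

Lemma widen_lift n (i : 'I_n) : widen_ord (leqnSn n) i = lift ord_max i.
Proof. by apply: val_inj; rewrite /= /bump leqNgt ltn_ord. Qed.

Lemma unchart_widen (V : zmodType) n (b : n.-tuple V) i :
  unchart b (widen_ord (leqnSn n) i) = tnth b i.
Proof. by rewrite /unchart widen_lift liftK. Qed.

Lemma unchart_max (V : zmodType) n (b : n.-tuple V) :
  unchart b ord_max = - \sum_i tnth b i.
Proof. by rewrite /unchart unlift_none. Qed.

Lemma sum_unchart (V : zmodType) n (b : n.-tuple V) : \sum_v unchart b v = 0.
Proof.
rewrite big_ord_recr /= unchart_max; apply/eqP; rewrite subr_eq0; apply/eqP.
by apply: eq_bigr => i _; rewrite unchart_widen.
Qed.

Lemma chart_unchart (V : zmodType) n (b : n.-tuple V) : chart (unchart b) = b.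
Proof. by apply: eq_from_tnth => i; rewrite tnth_mktuple unchart_widen. Qed.

Lemma ord_max_ind n (P : 'I_n.+1 -> Prop) :
  (forall i, P (widen_ord (leqnSn n) i)) -> P ord_max -> forall v, P v.
Proof.
move=> Pw Pm v; case: (unliftP ord_max v) => [i ->|-> //].
by rewrite -widen_lift.
Qed.

Lemma unchart_chart (V : zmodType) n (x : 'I_n.+1 -> V) :
  \sum_v x v = 0 -> unchart (chart x) =1 x.
Proof.
move=> x0; apply: ord_max_ind => [i|]; first by rewrite unchart_widen tnth_mktuple.
move: x0; rewrite big_ord_recr unchart_max /= => /eqP; rewrite addr_eq0 => /eqP e.
rewrite -[RHS]opprK -e; congr (- _).
by apply: eq_bigr => i _; rewrite tnth_mktuple.
Qed.

Definition polytope_chart (R : realType) n (T : {set 'I_n.+1 * 'I_n.+1}) :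
    set (n.-tuple R) :=
  [set chart (x ord0) | x in @root_polytope R n.+1 T]%classic.

Lemma csum_edges m (T : {set 'I_m * 'I_m}) e :
  forest T -> e \in T -> csum T e (indicator_vec T) = 1.
Proof. by move=> fT eT; rewrite csum_indicator // eT. Qed.

Lemma csumD (R : pzRingType) m (T : {set 'I_m * 'I_m}) e (x y : 'I_m -> R) :
  csum T e (fun v => x v + y v) = csum T e x + csum T e y.
Proof. by rewrite /csum big_split. Qed.

Lemma csumM (R : pzRingType) m (T : {set 'I_m * 'I_m}) e (a : R) (x : 'I_m -> R) :
  csum T e (fun v => a * x v) = a * csum T e x.
Proof. by rewrite /csum mulr_sumr. Qed.

(** Rounding changes coordinates on [T] by at most [n]. Adding [n] times the sum of the roots of
    [T], whose coordinates are all 1, makes up for it; this costs [n * hw] in height, and the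
    rounding another [n]. *)
Lemma grid_sub_chart (R : realType) n (T : {set 'I_n.+1 * 'I_n.+1}) (t hw : nat)
    (u : n.-tuple R) (z : 'I_n.+1 -> int) :
    nctree T -> (0 < t)%N -> hpos (indicator_vec T) <= hw%:R ->
    in_cone T z -> hpos z + (n * hw + n)%:R <= t%:R ->
    map_tuple (fun x : R => Num.floor (t%:R * x)) u =
      chart (fun v => z v + n%:R * indicator_vec T v) ->
  polytope_chart T u.
Proof.
move=> tT t0 hhw [z0 zT] hz eu; have [fT _ _] := tT.
have tR : (0 : R) < t%:R by rewrite ltr0n.
pose w v : R := (indicator_vec T v)%:~R.
have w0 : \sum_v w v = 0.
  by rewrite /w -(rmorph_sum (intmul 1)) /= root_sum0.
pose y v := t%:R * unchart u v.
pose d v := y v - ((z v)%:~R + n%:R * w v).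
have zR0 : \sum_v (z v)%:~R = 0 :> R by rewrite -(rmorph_sum (intmul 1)) /= z0.
have d0 : \sum_v d v = 0.
  rewrite /d /y big_split /= sumrN -mulr_sumr sum_unchart big_split /= -mulr_sumr.
  by rewrite w0 zR0 !mulr0 addr0 subr0.
have d01 v : v != ord_max -> 0 <= d v <= 1.
  elim/ord_max_ind: v => [i _|]; last by rewrite eqxx.
  have : tnth (map_tuple (fun x : R => Num.floor (t%:R * x)) u) i =
     z (widen_ord (leqnSn n) i) + n%:R * indicator_vec T (widen_ord (leqnSn n) i).
    by rewrite eu tnth_mktuple.
  rewrite tnth_map /d /y unchart_widen => e.
  have -> : (z (widen_ord (leqnSn n) i))%:~R + n%:R * w (widen_ord (leqnSn n) i) =
     (Num.floor (t%:R * tnth u i))%:~R :> R by rewrite e intrD intrM mulrz_nat.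
  have /andP[h1 h2] := floor_itv (t%:R * tnth u i).
  by rewrite subr_ge0 h1 /= lerBlDl; move: h2; rewrite intrD => /ltW.
have [dS hd _] := rounding_error d0 d01.
have yE v : y v = (z v)%:~R + n%:R * w v + d v by rewrite /d addrC subrK.
exists (\row_v unchart u v); last first.
  by rewrite -[RHS](chart_unchart u); apply: eq_from_tnth => i; rewrite !tnth_mktuple mxE.
have xE v : (\row_v unchart u v) ord0 v = t%:R^-1 * y v.
  by rewrite mxE /y mulKf // gt_eqF.
apply/(root_polytopeE _ tT); split.
- by under eq_bigr do rewrite mxE; exact: sum_unchart.
- move=> e eT; rewrite (eq_csum _ _ xE) csumM mulr_ge0 ?invr_ge0 ?ler0n //.
  rewrite (eq_csum _ _ yE) csumD csumD csumM !csum_intr csum_edges // mulr1 -addrA.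
  rewrite addr_ge0 ?ler0z ?zT //.
  have := dS (cut_side T e); rewrite ler_norml => /andP[h _].
  by rewrite addrC -lerBlDr sub0r.
- rewrite (eq_hpos xE) hposZ ?invr_ge0 ?ler0n // mulrC ler_pdivrMr // mul1r.
  rewrite (eq_hpos yE); apply: le_trans (hposD _ _) _.
  apply: le_trans (lerD (hposD _ _) hd) _.
  rewrite hposZ // !hpos_intr.
  have h1 : (hpos (indicator_vec T))%:~R <= hw%:R :> R.
    by rewrite -(ler_int R) mulrz_nat in hhw.
  have h2 : (hpos z)%:~R + (n * hw + n)%:R <= t%:R :> R.
    by rewrite -(ler_int R) intrD !mulrz_nat in hz.
  apply: le_trans h2; rewrite -addrA lerD2l natrD natrM lerD2r.
  by rewrite ler_wpM2l.
Qed.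

(** The corner of a cube that meets the polytope may lie outside the cone by rounding; the same
    shift brings it back, at the same cost in height. *)
Lemma chart_sub_grid (R : realType) n (T : {set 'I_n.+1 * 'I_n.+1}) (t hw : nat)
    (u : n.-tuple R) :
    nctree T -> (0 < t)%N -> hpos (indicator_vec T) <= hw%:R ->
    polytope_chart T u ->
  exists z : 'I_n.+1 -> int, [/\ in_cone T z, hpos z <= (t + (n * hw + n))%:R &
    map_tuple (fun x : R => Num.floor (t%:R * x)) u =
      chart (fun v => z v - n%:R * indicator_vec T v)].
Proof.
move=> tT t0 hhw [x /(root_polytopeE _ tT)[x0 xT h1] <-]; have [fT _ _] := tT.
have tR : (0 : R) < t%:R by rewrite ltr0n.
pose b := map_tuple (fun x : R => Num.floor (t%:R * x)) (chart (x ord0)).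
pose w := indicator_vec T.
have w0 : \sum_v w v = 0 by exact: root_sum0.
pose z v := unchart b v + n%:R * w v.
pose d v : R := t%:R * x ord0 v - (unchart b v)%:~R.
have d0 : \sum_v d v = 0.
  rewrite /d big_split /= sumrN -mulr_sumr x0 mulr0 -(rmorph_sum (intmul 1)) /=.
  by rewrite sum_unchart subrr.
have d01 v : v != ord_max -> 0 <= d v <= 1.
  elim/ord_max_ind: v => [i _|]; last by rewrite eqxx.
  rewrite /d unchart_widen tnth_map tnth_mktuple.
  have /andP[h2 h3] := floor_itv (t%:R * x ord0 (widen_ord (leqnSn n) i)).
  by rewrite subr_ge0 h2 /= lerBlDl; move: h3; rewrite intrD => /ltW.
have [dS _ hd] := rounding_error d0 d01.
have zE v : (z v)%:~R = t%:R * x ord0 v + (- d v) + n%:R * (w v)%:~R :> R.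
  by rewrite /z intrD intrM mulrz_nat; congr (_ + _); rewrite /d opprB addrC subrK.
exists z; split.
- split; first by rewrite /z big_split /= sum_unchart -mulr_sumr w0 mulr0 addr0.
  move=> e eT; rewrite -(ler0z R) -csum_intr (eq_csum _ _ zE) csumD csumD !csumM.
  rewrite csum_intr csum_edges // mulr1 -addrA addr_ge0 ?mulr_ge0 ?xT ?ler0n //.
  have := dS (cut_side T e); rewrite ler_norml => /andP[_ h].
  by rewrite /csum sumrN addrC subr_ge0.
- rewrite -(ler_int R) mulrz_nat -hpos_intr (eq_hpos zE).
  apply: le_trans (hposD _ _) _; rewrite hposZ // hpos_intr.
  apply: le_trans (lerD (hposD _ _) (lexx _)) _; rewrite hposZ ?ler0n //.
  have h2 : (hpos w)%:~R <= hw%:R :> R by rewrite -(ler_int R) mulrz_nat in hhw.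
  have h3 : n%:R * (hpos w)%:~R <= n%:R * hw%:R :> R by rewrite ler_wpM2l.
  have h4 : t%:R * hpos (x ord0) <= t%:R by rewrite ler_piMr // ltW.
  rewrite natrD natrD natrM -addrA (addrC (n%:R * _)).
  by rewrite lerD // lerD.
- apply: eq_from_tnth => i; rewrite tnth_mktuple /z addrK unchart_widen.
  by [].
Qed.

Lemma hyperplane_volumeE (R : realType) n (T : {set 'I_n.+1 * 'I_n.+1}) : nctree T ->
  hyperplane_volume (@root_polytope R n.+1 T) = lebesgueN (@polytope_chart R n T).
Proof.
move=> tT; rewrite /hyperplane_volume; congr lebesgueN; apply/seteqP; split=> u.
  by move=> [x [xP _] <-]; exists x.
by move=> [x xP <-]; exists x => //; split=> //; have /(root_polytopeE _ tT)[] := xP.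
Qed.

Lemma chart_inj (V : zmodType) n (x y : 'I_n.+1 -> V) :
  \sum_v x v = 0 -> \sum_v y v = 0 -> chart x = chart y -> x =1 y.
Proof. by move=> x0 y0 xy v; rewrite -(unchart_chart x0) xy unchart_chart. Qed.

Lemma volume_lattice_bounds (R : realType) n (T : {set 'I_n.+1 * 'I_n.+1})
    (q : 'I_n.+1 -> int) (hw t : nat) :
    nctree T -> generic q -> \sum_v q v = 0 ->
    (forall e, e \in T -> 0 < csum T e q) -> hpos (indicator_vec T) <= hw%:R ->
    (n * hw + n < t)%N ->
  ((((\sum_(G | `[< facet T G >]) 'C(t - (n * hw + n) + #|pos_edges q G|, n))%N)%:R
     / t%:R ^+ n)%:E <= lebesgueN (@polytope_chart R n T) <=
   (((\sum_(G | `[< facet T G >]) 'C(t + (n * hw + n) + #|pos_edges q G|, n))%N)%:R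
     / t%:R ^+ n)%:E)%E.
Proof.
move=> tT gq q0 qT hhw Ct; set C := (n * hw + n)%N in Ct *.
have t0 : (0 < t)%N by exact: leq_ltn_trans Ct.
have w0 : \sum_v indicator_vec T v = 0 by exact: root_sum0.
apply/andP; split.
  have [s [us sP <-]] := lattice_enum (t - C) tT gq q0 qT.
  pose B := [seq chart (fun v => z ord0 v + n%:R * indicator_vec T v) | z : 'rV[int]_n.+1 <- s].
  have z0 (z : 'rV[int]_n.+1) : z \in s -> \sum_v (z ord0 v + n%:R * indicator_vec T v) = 0.
    by move=> /sP[[z0 _] _]; rewrite big_split /= -mulr_sumr w0 z0 mulr0 addr0.
  have uB : uniq B.
    rewrite map_inj_in_uniq // => z z' zs zs' /(chart_inj (z0 _ zs) (z0 _ zs')) e.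
    by apply/rowP => v; apply: (addIr (n%:R * indicator_vec T v)); exact: e.
  have -> : size s = size B by rewrite size_map.
  rewrite -(@lebesgueN_grid R n t B) //; apply: lebesgueN_le => u /= /mapP[z zs eu].
  have [cz hz] := (sP z).1 zs.
  apply: (grid_sub_chart tT t0 hhw cz _ eu).
  by rewrite -/C -lerBrDr -natrB // ltnW.
have [s [us sP <-]] := lattice_enum (t + C) tT gq q0 qT.
pose B := [seq chart (fun v => z ord0 v - n%:R * indicator_vec T v) | z : 'rV[int]_n.+1 <- s].
have z0 (z : 'rV[int]_n.+1) : z \in s -> \sum_v (z ord0 v - n%:R * indicator_vec T v) = 0.
  by move=> /sP[[z0 _] _]; rewrite big_split /= sumrN -mulr_sumr w0 z0 mulr0 subr0.
have uB : uniq B.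
  rewrite map_inj_in_uniq // => z z' zs zs' /(chart_inj (z0 _ zs) (z0 _ zs')) e.
  by apply/rowP => v; apply: (addIr (- (n%:R * indicator_vec T v))); exact: e.
have -> : size s = size B by rewrite size_map.
rewrite -(@lebesgueN_grid R n t B) //; apply: lebesgueN_le => u /(chart_sub_grid tT t0 hhw).
move=> [z [cz hz eu]]; apply/mapP; exists (\row_v z v).
  apply/sP; split; last by rewrite (@eq_hpos _ _ _ z) // => v; rewrite mxE.
  have [cz0 cz1] := cz; split; first by rewrite -[RHS]cz0; apply: eq_bigr => v _; rewrite mxE.
  by move=> e eT; rewrite (@eq_csum _ _ _ _ _ z) ?cz1 // => v; rewrite mxE.
by rewrite eu; apply: eq_from_tnth => i; rewrite !tnth_mktuple mxE.
Qed.

(** Both bounds tend to [a]; since [harmonic k] is [1 / (k + 1)], the limit is taken along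
    [t = k.+1]. A single [t] already excludes infinite values. *)
Lemma ereal_squeeze (R : realType) (V : \bar R) (a : R) (n C : nat) :
    (forall t, (C < t)%N -> ((a * ((t%:R - C%:R) / t%:R) ^+ n)%:E <= V <=
                             (a * ((t%:R + C%:R) / t%:R) ^+ n)%:E)%E) ->
  V = a%:E.
Proof.
move=> bnd; case: V bnd => [v| |] bnd; last 2 first.
- by have := bnd C.+1 (ltnSn _); rewrite leye_eq andbF.
- by have := bnd C.+1 (ltnSn _); rewrite leeNy_eq.
have cvgc (c : R) : ((a * (1 + c * harmonic k) ^+ n) @[k --> \oo] --> a)%classic.
  have c0 : (c * harmonic k @[k --> \oo] --> c * 0)%classic.
    by apply: cvgMr; exact: cvg_harmonic.
  have c1 : (1 + c * harmonic k @[k --> \oo] --> 1 + c * 0)%classic.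
    by apply: cvgD c0; exact: cvg_cst.
  have cn := cvg_comp _ _ c1 (@exprn_continuous R n (1 + c * 0)).
  have : (a * (1 + c * harmonic k) ^+ n @[k --> \oo] --> a * (1 + c * 0) ^+ n)%classic.
    exact: cvgMr cn.
  by rewrite mulr0 addr0 expr1n mulr1.
have hE (c : R) k : (k.+1%:R + c) / k.+1%:R = 1 + c * harmonic k.
  by rewrite mulrDl divff // pnatr_eq0.
congr (_%:E); apply/eqP; rewrite eq_le; apply/andP; split.
  have cv := cvgc C%:R; rewrite -(cvg_lim (@Rhausdorff R) cv).
  apply: limr_ge; first by apply/cvg_ex; exists a.
  exists C => // k /= Ck; rewrite -hE.
  by have := bnd k.+1 Ck; rewrite !lee_fin => /andP[].
have cv := cvgc (- C%:R); rewrite -(cvg_lim (@Rhausdorff R) cv).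
apply: limr_le; first by apply/cvg_ex; exists a.
exists C => // k /= Ck; rewrite -hE.
by have := bnd k.+1 Ck; rewrite !lee_fin => /andP[].
Qed.

Lemma bin_expn_bounds (R : realType) a n :
  (a - n)%N%:R ^+ n / n`!%:R <= ('C(a, n)%:R : R) <= a%:R ^+ n / n`!%:R.
Proof.
rewrite ler_pdivlMr ?ler_pdivrMr ?ltr0n ?fact_gt0 // -natrM bin_ffact -!natrX !ler_nat.
by rewrite expn_le_ffact ffact_le_expn.
Qed.

Lemma volume_root_polytope (R : realType) n (T : {set 'I_n.+1 * 'I_n.+1}) : nctree T ->
  hyperplane_volume (@root_polytope R n.+1 T) =
  (#|[set G | `[< facet T G >]]|%SET%:R / n`!%:R)%:E.
Proof.
move=> tT; rewrite hyperplane_volumeE //.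
have [q [q0 qT gq]] := generic_exists tT.
pose hw := `|hpos (indicator_vec T)|%N.
have hhw : hpos (indicator_vec T) <= hw%:R by rewrite natz gez0_abs // hpos_ge0.
pose C := (n * hw + n)%N.
(* The extra [n] pays for replacing binomials by powers: from below because [C(a, n)] is at least
   [(a - n)^n / n!], from above because at most [n] edges are positive. *)
apply: (@ereal_squeeze _ _ _ n (C + n)) => t Ct.
have Ct' : (C < t)%N by apply: leq_ltn_trans Ct; exact: leq_addr.
have tR : (0 : R) < t%:R by rewrite ltr0n (leq_ltn_trans _ Ct').
have /andP[lo up] := @volume_lattice_bounds R n T q hw t tT gq q0 qT hhw Ct'.
have pn G : facet T G -> (#|pos_edges q G| <= n)%N.
  move=> fG; apply: leq_trans (subset_leq_card (_ : pos_edges q G \subset G)) _.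
    by apply/fintype.subsetP => g; rewrite inE => /andP[].
  by rewrite (facet_card fG).
set N := #|_|.
have NE : (N%:R : R) = \sum_(G | `[< facet T G >]) 1.
  by rewrite /N -sum1_card natr_sum; apply: eq_bigl => G; rewrite inE.
have i0 : (0 : R) <= (t%:R ^+ n)^-1 by rewrite invr_ge0 exprn_ge0 // ltW.
have f0 : (0 : R) <= (n`!%:R)^-1 by rewrite invr_ge0.
apply/andP; split; [apply: le_trans lo|apply: le_trans up _]; rewrite lee_fin.
  rewrite expr_div_n mulrA ler_wpM2r // natr_sum -mulrA (mulrC _^-1) NE mulr_suml.
  apply: ler_sum => G _; have /andP[b _] := bin_expn_bounds R (t - C + #|pos_edges q G|) n.
  apply: le_trans b; rewrite mul1r ler_wpM2r // -natrB ?(ltnW Ct) //.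
  rewrite -!natrX ler_nat leq_expn // subnDA leq_sub2r //; exact: leq_addr.
rewrite expr_div_n mulrA ler_wpM2r // natr_sum -mulrA (mulrC _^-1) NE mulr_suml.
apply: ler_sum => G /asboolP fG; have /andP[_ b] := bin_expn_bounds R (t + C + #|pos_edges q G|) n.
apply: le_trans b _; rewrite mul1r ler_wpM2r // -natrD.
rewrite -!natrX ler_nat.
by rewrite leq_expn // addnA leq_add2l pn.
Qed.

Theorem theorem1 (R : realType) (n : nat) (n_ge1 : (1 <= n)%N)
    (T : {set 'I_n.+1 * 'I_n.+1}) (lab : 'I_n.+1 * 'I_n.+1 -> nat)
    (T_good : good_tree T lab) :
  (forall t : nat,
     (ehrhart (@root_polytope R n.+1 T) t)%:Z =
     (-1) ^+ n *
       \sum_(i < n.+1) (-1) ^+ i * (fnum T i)%:Z * ('C(t + i, i))%:Z) /\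
  hyperplane_volume (@root_polytope R n.+1 T) =
    ((fnum T n)%:R / (n`!)%:R)%:E.
Proof.
have tT : nctree T.
  have [[[fT _] _ _ _ nT] [_ _ cT]] := T_good.
  by split=> // x y; apply: cT; rewrite inE.
have [q [q0 qT gq]] := generic_exists tT.
split=> [t|]; first by rewrite (fnum_sum t n_ge1 tT gq q0 qT) (ehrhart_root_polytope R t tT gq q0 qT).
by rewrite volume_root_polytope // fnum_top.
Qed.
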